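(* Assume the Markov semigroup $(P_t)$ on the Polish space $(E,\rho)$ is Feller, and that: (1) there exist a measurable $V:E\to[0,\infty)$ and constants $\gamma>0$, $K>0$ such that $P_tV(x)\le V(x)-\gamma\int_0^tP_sV(x)\,ds+Kt$ for all $t\ge0$, $x\in E$; (2) $\rho\wedge1\le\theta$ for a premetric $\theta$; (3) Assumption A holds (with this $\theta$) for some functions $r,L$; (4* ) Assumption B2 holds (with this $\theta$) for some function $R$, the set $B=\{V\le 4K/\gamma\}$ and some $\varepsilon>0$. Then $(P_t)$ has a unique invariant probability measure $\pi$, and for any $\delta\in(0,1)$ there exist constants $C_1,C_2>0$ such that for all $x\in E$, $t\ge0$, $$W_{\rho\wedge1}(P_t(x,\cdot),\pi)\le\frac{C_1(1+\phi(V(x))^\delta)}{\phi(H_\phi^{-1}(C_2t))^\delta},\qquad \phi(u)=\gamma u,\quad H_\phi(x)=\int_1^x\frac{du}{\phi(u)}.$$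
   Context: $(E,\rho)$ Polish, $(P_t)$ a Markov transition function with semigroup $P_t\phi(x)=\int\phi(y)P_t(x,dy)$, $\mathbb P_x$ the law of the Markov process started at $x$. Feller: $P_t$ maps bounded continuous functions to bounded continuous functions. A premetric is a lower semicontinuous $\theta:E\times E\to\mathbb R_+$ with $\theta(x,y)=0\iff x=y$. $W_d(\mu,\nu):=\inf\int d\,d\lambda$ over couplings $\lambda$ of $\mu,\nu$; $d_{TV}(\mu,\nu)=\sup_A|\mu(A)-\nu(A)|$. Assumption A: there exist a non-increasing $r:\mathbb R_+\to\mathbb R_+$ with $r(t)\to0$ and a locally bounded $L:\mathbb R_+\to\mathbb R_+$ such that for any $x,y\in E$ there exist random processes $X^{x,y},Y^{x,y}$ on a common probability space with (1) $\mathrm{Law}(X^{x,y})=\mathbb P_x$ and $d_{TV}(\mathrm{Law}(Y^{x,y}_t),P_t(y,\cdot))\le L(t)\theta(x,y)$, $t\ge0$; (2) $\mathbb E\theta(X^{x,y}_t,Y^{x,y}_t)\le r(t)\theta(x,y)$, $t\ge0$. Assumption B2 (for a set $B$, a non-increasing $R:\mathbb R_+\to\mathbb R_+$ with $R(t)\to0$, and $\varepsilon>0$): for any $x,y\in B$ there exist random processes $X^{x,y},Y^{x,y}$ on a common probability space with (1) $\mathrm{Law}(X^{x,y})=\mathbb P_x$ and $d_{TV}(\mathrm{Law}(Y^{x,y}_t),P_t(y,\cdot))\le1-\varepsilon$, $t\ge0$; (2) $\mathbb E\theta(X^{x,y}_t,Y^{x,y}_t)\le R(t)$, $t\ge0$.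 *)

(* Defs.v *)
From HB Require Import structures.
From mathcomp Require Import all_boot all_order all_algebra.
From mathcomp Require Import all_classical all_reals all_analysis measurable_realfun.
Set Implicit Arguments.
Unset Strict Implicit.
Unset Printing Implicit Defensive.
Import Order.TTheory GRing.Theory Num.Theory.
Import numFieldNormedType.Exports.
Local Open Scope classical_set_scope.
Local Open Scope ring_scope.

Section Defs.
Context {R : realType} {d : measure_display} {E : measurableType d}.
Variable rho : E -> E -> R.

Definition is_metric :=
  [/\ forall x y, 0 <= rho x y,
      forall x y, rho x y = 0 <-> x = y,
      forall x y, rho x y = rho y x &
      forall x y z, rho x z <= rho x y + rho y z].

Definition rho_cauchy (u : nat -> E) :=
  forall e : R, 0 < e -> exists N, forall m n, (N <= m)%N -> (N <= n)%N ->
    rho (u m) (u n) < e.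

Definition rho_converges (u : nat -> E) (x : E) :=
  forall e : R, 0 < e -> exists N, forall n, (N <= n)%N -> rho (u n) x < e.

Definition rho_complete :=
  forall u : nat -> E, rho_cauchy u -> exists x, rho_converges u x.

(* separable: a dense sequence (E is nonempty) *)
Definition rho_separable :=
  exists s : nat -> E, forall x (e : R), 0 < e -> exists n, rho x (s n) < e.

Definition rho_open (U : set E) :=
  forall x, U x -> exists2 e : R, 0 < e & forall y, rho x y < e -> U y.

Definition rho_borel := forall A : set E, measurable A <-> <<s rho_open >> A.

Definition polish :=
  [/\ is_metric, rho_complete, rho_separable & rho_borel].

Definition rho_continuous (f : E -> R) :=
  forall x (e : R), 0 < e -> exists2 del : R, 0 < del &
    forall y, rho x y < del -> `|f y - f x| < e.

Definition bounded_fun (f : E -> R) := exists M : R, forall x, `|f x| <= M.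

Definition premetric (theta : E -> E -> R) :=
  [/\ forall x y, 0 <= theta x y,
      forall x y, theta x y = 0 <-> x = y &
      forall x y (c : R), c < theta x y -> exists2 del : R, 0 < del &
        forall x' y', rho x x' < del -> rho y y' < del -> c < theta x' y'].
End Defs.

Section Markov.
Context {R : realType} {d : measure_display} {E : measurableType d}.
Local Open Scope ereal_scope.

Definition markov_tf (P : R -> E -> probability E R) :=
  [/\ forall t A, (0 <= t)%R -> measurable A ->
        measurable_fun [set: E] ((fun x => P t x A) : E -> \bar R),
      forall x A, measurable A -> P 0%R x A = \d_x A &
      forall s t x A, (0 <= s)%R -> (0 <= t)%R -> measurable A ->
        P (s + t)%R x A = \int[P s x]_y P t y A].

Definition Psg (P : R -> E -> probability E R) (t : R) (f : E -> R) (x : E)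
  : R := fine (\int[P t x]_y (f y)%:E).

Definition feller (rho : E -> E -> R) (P : R -> E -> probability E R) :=
  forall t (f : E -> R), (0 <= t)%R -> bounded_fun f -> rho_continuous rho f ->
    bounded_fun (Psg P t f) /\ rho_continuous rho (Psg P t f).

(* finite-dimensional distributions of the Markov process started at x:
   for a list [(dt_1,A_1);...;(dt_n,A_n)] of time increments and sets,
   fdd l x = P_x(X_{t_1} in A_1, ..., X_{t_n} in A_n), t_k = dt_1+...+dt_k *)
Fixpoint fdd (P : R -> E -> probability E R) (l : seq (R * set E)) (x : E)
  : \bar R :=
  match l with
  | [::] => 1
  | (dt, A) :: l' => \int[P dt x]_(y in A) fdd P l' y
  end.

Fixpoint fdd_event {T : Type} (X : R -> T -> E) (s : R) (l : seq (R * set E))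
  (w : T) : Prop :=
  match l with
  | [::] => True
  | (dt, A) :: l' => A (X (s + dt)%R w) /\ fdd_event X (s + dt)%R l' w
  end.

(* Law(X) = P_x : X is a process (indexed by t >= 0) whose law on the
   product sigma-algebra of E^[0,oo) is that of the Markov process with
   transition function P started at x, i.e. whose finite-dimensional
   distributions are those of P_x. *)
Definition law_is_Px {dO : measure_display} {O : measurableType dO}
  (Pr : probability O R) (X : R -> O -> E) (P : R -> E -> probability E R)
  (x : E) :=
  (forall t, (0 <= t)%R -> measurable_fun [set: O] (X t)) /\
  forall l : seq (R * set E),
    all (fun p => (0 <= p.1)%R) l -> (forall p, p \in l -> measurable p.2) ->
    Pr (fdd_event X 0%R l) = fdd P l x.

Definition dTV (mu nu : set E -> \bar R) : \bar R :=
  ereal_sup [set `|mu A - nu A| | A in [set A : set E | measurable A]].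

Definition coupling (mu nu : set E -> \bar R) (lam : probability (E * E)%type R) :=
  (forall A, measurable A -> lam (A `*` setT) = mu A) /\
  (forall A, measurable A -> lam (setT `*` A) = nu A).

Definition wasserstein (c : E -> E -> R) (mu nu : set E -> \bar R) : \bar R :=
  ereal_inf [set \int[lam]_z (c z.1 z.2)%:E |
             lam in [set lam | coupling mu nu lam]].

Definition is_invariant (P : R -> E -> probability E R) (pi : probability E R) :=
  forall t A, (0 <= t)%R -> measurable A -> \int[pi]_x P t x A = pi A.

Definition assumptionA (P : R -> E -> probability E R) (theta : E -> E -> R)
  (r L : R -> R) :=
  [/\ (forall t, (0 <= t)%R -> (0 <= r t)%R),
      (forall s t, (0 <= s)%R -> (s <= t)%R -> (r t <= r s)%R),
      r t @[t --> +oo%R] --> 0%R,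
      (forall t, (0 <= t)%R -> (0 <= L t)%R) /\
      (forall T, exists M : R, forall t, (0 <= t <= T)%R -> (L t <= M)%R) &
      forall x y, exists (dO : measure_display) (O : measurableType dO)
        (Pr : probability O R) (X Y : R -> O -> E),
        [/\ law_is_Px Pr X P x,
            (forall t, (0 <= t)%R -> measurable_fun [set: O] (Y t)),
            (forall t, (0 <= t)%R ->
               dTV (pushforward Pr (Y t)) (P t y) <= (L t * theta x y)%:E) &
            (forall t, (0 <= t)%R ->
               \int[Pr]_w (theta (X t w) (Y t w))%:E <= (r t * theta x y)%:E)]].

Definition assumptionB2 (P : R -> E -> probability E R) (theta : E -> E -> R)
  (B : set E) (Rf : R -> R) (eps : R) :=
  [/\ (forall t, (0 <= t)%R -> (0 <= Rf t)%R),
      (forall s t, (0 <= s)%R -> (s <= t)%R -> (Rf t <= Rf s)%R),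
      Rf t @[t --> +oo%R] --> 0%R,
      (0 < eps)%R &
      forall x y, B x -> B y -> exists (dO : measure_display) (O : measurableType dO)
        (Pr : probability O R) (X Y : R -> O -> E),
        [/\ law_is_Px Pr X P x,
            (forall t, (0 <= t)%R -> measurable_fun [set: O] (Y t)),
            (forall t, (0 <= t)%R ->
               dTV (pushforward Pr (Y t)) (P t y) <= (1 - eps)%:E) &
            (forall t, (0 <= t)%R ->
               \int[Pr]_w (theta (X t w) (Y t w))%:E <= (Rf t)%:E)]].
End Markov.

Definition H_phi {R : realType} (phi : R -> R) (z : R) : R :=
  fine (\int[@lebesgue_measure R]_(u in `[1%R, z]) (1 / phi u)%:E)%E.

Definition H_phi_inv {R : realType} (phi : R -> R) (y : R) : R :=
  xget 1%R [set z : R | (1 <= z)%R /\ H_phi phi z = y].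

(* Main.v *)
(* Fix delta and consider, for c = min (N theta) 1, the weighted cost
     W(x, y) = c(x, y)^(1 - delta) (1 + b (V x + V y))^delta.
   A generalised coupling becomes a genuine coupling once the total variation
   defect is paid for in the cost c <= 1, and a Hoelder-type inequality turns
   E c and E V into a bound on E W.  Assumption A then contracts W when c < 1,
   Assumption B2 contracts it when c = 1 and V is small at both points, and the
   Lyapunov condition contracts it when V is large, all for one time T and one
   weight b.  Hence P_T maps functions that are a-Lipschitz for W to functions
   that are (al a)-Lipschitz with al < 1.  Since min rho 1 <= c <= W, the laws
   P_(nT)(x, .) form a summable Cauchy sequence in the dual bounded-Lipschitz
   distance, which converges because a Polish space is complete; the Feller
   property makes the limit invariant.  Kantorovich-Rubinstein duality, obtained
   from finite transport duality by discretisation, converts the dual bound into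
   the Wasserstein bound, and for phi u = gamma u the stated rate is exponential
   because the inverse of H_phi is y |-> exp (gamma y). *)

Require Import Defs.
From HB Require Import structures.
From mathcomp Require Import all_boot all_order all_algebra.
From mathcomp Require Import all_classical all_reals all_analysis measurable_realfun giry.
From mathcomp Require Import ring lra.
Set Implicit Arguments.
Unset Strict Implicit.
Unset Printing Implicit Defensive.
Import Order.TTheory GRing.Theory Num.Theory.
Import numFieldNormedType.Exports.
Local Open Scope classical_set_scope.
Local Open Scope ring_scope.

(** * Finite transport duality *)

(** The contraction is stated on test functions because the assumptions give one coupling for each
    pair (x, y), with no measurability in (x, y): such couplings cannot be composed along the chain,
    and W need not satisfy a triangle inequality. A Lipschitz bound for W uses a single coupling per
    pair and iterates by itself.

    The shaping obstacle is a mismatch of time scales. Used at time T, Assumption A would force N to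
    be of order L T, while B2 needs N Rf T small, and L may grow faster than Rf decays. So N is
    fixed from a short time T1, before T = k T1 is chosen from B2 and the drift. For close points
    the gain is made in a single step of length T1, while each of the k steps costs a factor g = (1
    + 2 b C)^delta through the growth of V. The weight b comes last, so small that g^k does not use
    up the gain; far from the sublevel set of V there is contraction for every b > 0.

    The drift leaves V / 4 + C with C = (5/4) K / gamma. For S0 = 4 K / gamma this gives 2 C = (5/8)
    S0, and 1/4 + 5/8 < 1 is what makes the sublevel set in B2 large enough. *)

Section sublinear.
Variables (R : realType) (U : lmodType R).
Implicit Types (p q : U -> R) (u v w : U).

Definition sublinear p :=
  (forall u v, p (u + v) <= p u + p v) /\
  (forall a u, 0 <= a -> p (a *: u) = a * p u).

Lemma sublinear0 p : sublinear p -> p 0 = 0.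
Proof. by case=> _ pZ; rewrite -(scale0r 0) pZ// mul0r. Qed.

Lemma sublinear_opp_ge p u : sublinear p -> - p (- u) <= p u.
Proof.
move=> sp; have := sp.1 u (- u); rewrite subrr (sublinear0 sp).
by rewrite -subr_le0 sub0r; lra.
Qed.

(* Making p additive along v, by the largest minorant that keeps the value at
   v: p_v(u) = inf_(t >= 0) p (u + t v) - t p v. *)
Lemma sublinear_step p v : sublinear p -> exists q,
  [/\ sublinear q, forall u, q u <= p u, q v = p v & q (- v) = - p v].
Proof.
move=> sp; have [pD pZ] := sp.
pose S u := [set p (u + t *: v) - t * p v | t in [set t : R | 0 <= t]].
have lbS u : lbound (S u) (- p (- u)).
  move=> _ [t /= t0 <-]; rewrite -pZ//.
  have := pD (u + t *: v) (- u); rewrite addrAC subrr add0r; lra.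
have infS u : has_inf (S u).
  split; last by exists (- p (- u)); exact: lbS.
  by exists (p (u + 0 *: v) - 0 * p v); exists 0 => /=.
pose q u := inf (S u).
have qle u t : 0 <= t -> q u <= p (u + t *: v) - t * p v.
  by move=> t0; apply: (ge_inf (infS u).2); exists t.
have le_q u (x : R) : (forall t, 0 <= t -> x <= p (u + t *: v) - t * p v) -> x <= q u.
  by move=> h; apply: lb_le_inf; [exact: (infS u).1|move=> _ [t t0 <-]; exact: h].
have qD u w : q (u + w) <= q u + q w.
  rewrite -lerBlDr; apply: (le_q) => t t0.
  rewrite lerBlDr -lerBlDl; apply: (le_q) => s s0.
  rewrite lerBlDl; apply: (le_trans (qle _ (t + s) (addr_ge0 t0 s0))).
  have := pD (u + t *: v) (w + s *: v); rewrite addrACA -scalerDl mulrDl; lra.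
have q0 : q 0 = 0.
  apply/eqP; rewrite eq_le; apply/andP; split.
    by have := qle 0 0 (lexx _); rewrite scale0r addr0 (sublinear0 sp) mul0r subr0.
  by apply: (le_q) => t t0; rewrite add0r pZ// subrr.
have qZle (a : R) u : 0 < a -> q (a *: u) <= a * q u.
  move=> a0; rewrite mulrC -ler_pdivrMr//; apply: (le_q) => t t0.
  rewrite ler_pdivrMr// mulrC.
  apply: (le_trans (qle _ (a * t) (mulr_ge0 (ltW a0) t0))).
  by rewrite -scalerA -scalerDr (pZ _ _ (ltW a0)) mulrBr -mulrA.
have sq : sublinear q.
  split=> // a u; rewrite le_eqVlt => /predU1P[<-|a0].
    by rewrite scale0r mul0r q0.
  apply/eqP; rewrite eq_le qZle//=.
  have := @qZle a^-1 (a *: u); rewrite invr_gt0 => /(_ a0).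
  by rewrite scalerA mulVf ?gt_eqF// scale1r ler_pdivlMl.
have qv1 : q v <= p v by have := qle v 0 (lexx _); rewrite scale0r addr0 mul0r subr0.
have qv2 : q (- v) <= - p v.
  by have := qle (- v) 1 ler01; rewrite scale1r addNr (sublinear0 sp) mul1r sub0r.
have := sublinear_opp_ge v sq; exists q; split=> //.
- by move=> u; have := qle u 0 (lexx _); rewrite scale0r addr0 mul0r subr0.
- by apply/eqP; rewrite eq_le qv1/=; lra.
- by apply/eqP; rewrite eq_le qv2/=; lra.
Qed.

Lemma sublinear_opp_minorant p q v : sublinear q -> (forall u, q u <= p u) ->
  p (- v) = - p v -> q v = p v /\ q (- v) = - p v.
Proof.
move=> sq qp pv; have := sublinear_opp_ge v sq; have := qp v; have := qp (- v).
by rewrite pv => h1 h2 h3; split; apply/eqP; rewrite eq_le ?h1 ?h2/=; lra.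
Qed.

(** One step per vector suffices: a sublinear minorant must agree with p at v and - v as soon as p
    (- v) = - p v, so later steps do not spoil earlier ones. *)
Lemma sublinear_seq p (s : seq U) : sublinear p -> exists q,
  [/\ sublinear q, forall u, q u <= p u & {in s, forall v, q (- v) = - q v}].
Proof.
move=> sp; elim: s => [|v s [q [sq qp qs]]]; first by exists p; split=> //.
have [q' [sq' q'q q'v q'Nv]] := sublinear_step v sq.
exists q'; split=> // [u|w]; first exact: le_trans (q'q u) (qp u).
rewrite in_cons => /predU1P[->|ws]; first by rewrite q'Nv q'v.
by have [-> ->] := sublinear_opp_minorant sq' q'q (qs _ ws).
Qed.

(** A finite Hahn-Banach theorem. The step along u comes before those along s, which then cannot
    lower the value at u. *)
Lemma sublinear_support p u (s : seq U) : sublinear p -> exists q,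
  [/\ sublinear q, forall v, q v <= p v, q u = p u &
      {in s, forall v, q (- v) = - q v}].
Proof.
move=> sp; have [q [sq qp qu qNu]] := sublinear_step u sp.
have [q' [sq' q'q q's]] := sublinear_seq s sq.
have [q'u _] := sublinear_opp_minorant sq' q'q (etrans qNu (congr1 _ (esym qu))).
exists q'; split=> // [v|].
- exact: le_trans (q'q v) (qp v).
- by rewrite q'u.
Qed.

Lemma sublinearZ_opp p v a : sublinear p -> p (- v) = - p v ->
  p (a *: v) = a * p v.
Proof.
move=> sp pv; have [a0|a0] := leP 0 a; first exact: sp.2.
by rewrite -[a]opprK scaleNr -scalerN sp.2 ?oppr_ge0 ?ltW// pv; ring.
Qed.

Lemma sublinear_sum p I (r : seq I) (F : I -> U) : sublinear p ->
  p (\sum_(i <- r) F i) <= \sum_(i <- r) p (F i).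
Proof.
move=> sp; elim/big_rec2: _ => [|i y x _ h]; first by rewrite (sublinear0 sp).
by apply: le_trans (sp.1 _ _) _; rewrite lerD2l.
Qed.

End sublinear.

Section transport_duality.
Variables (R : realType) (n m : nat).

Let delta_seq : seq 'M[R]_(n, m) :=
  [seq delta_mx ij.1 ij.2 | ij <- enum {: 'I_n * 'I_m}].

(** Subadditivity bounds q A by the linear expression; the same bound at - A, with q A >= - q (- A),
    gives equality. *)
Lemma sublinear_mxE (q : 'M[R]_(n, m) -> R) (A : 'M[R]_(n, m)) : sublinear q ->
  {in delta_seq, forall v, q (- v) = - q v} ->
  q A = \sum_i \sum_j A i j * q (delta_mx i j).
Proof.
move=> sq qd.
have le B : q B <= \sum_i \sum_j B i j * q (delta_mx i j).
  rewrite {1}(matrix_sum_delta B); apply: (le_trans (sublinear_sum _ _ sq)).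
  apply: ler_sum => i _; apply: (le_trans (sublinear_sum _ _ sq)).
  apply: ler_sum => j _; rewrite (sublinearZ_opp _ sq)// qd//.
  by apply/mapP; exists (i, j) => //; rewrite mem_enum.
apply/eqP; rewrite eq_le le/=.
apply: le_trans (sublinear_opp_ge A sq).
rewrite -[leLHS]opprK lerN2; apply: (le_trans (le _)).
rewrite -sumrN ler_sum// => i _; rewrite -sumrN ler_sum// => j _.
by rewrite !mxE mulNr.
Qed.

(** The value p h of the dual programme, the infimum of a.f + b.g over potentials with f i + g j >=
    h i j, is sublinear in h. A linear minorant touching p at - c has a coefficient matrix l, which
    is the plan: p <= 0 at minus an elementary matrix makes l nonnegative, p <= a.f + b.g at f + g
    and at its opposite fixes the marginals, and the cost of l is - p (- c). *)
Lemma transport_duality (a : 'I_n -> R) (b : 'I_m -> R) (c : 'I_n -> 'I_m -> R)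
    (M : R) :
  (forall i, 0 <= a i) -> (forall j, 0 <= b j) ->
  \sum_i a i = 1 -> \sum_j b j = 1 ->
  (forall f g, (forall i j, f i + g j <= c i j) ->
     \sum_i a i * f i + \sum_j b j * g j <= M) ->
  exists l : 'I_n -> 'I_m -> R,
    [/\ forall i j, 0 <= l i j,
        forall i, \sum_j l i j = a i,
        forall j, \sum_i l i j = b j &
        \sum_i \sum_j c i j * l i j <= M].
Proof.
move=> a0 b0 a1 b1 cM.
pose val (fg : ('I_n -> R) * ('I_m -> R)) :=
  \sum_i a i * fg.1 i + \sum_j b j * fg.2 j.
pose dom (h : 'M[R]_(n, m)) := [set fg : ('I_n -> R) * ('I_m -> R) |
  forall i j, h i j <= fg.1 i + fg.2 j].
pose S h := [set val fg | fg in dom h].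
(* The product plan shows that the infimum is finite. *)
have lbS h : lbound (S h) (\sum_i \sum_j a i * b j * h i j).
  move=> _ [[f g] /= hfg <-].
  have -> : val (f, g) = \sum_i \sum_j a i * b j * (f i + g j).
    rewrite /val /=; transitivity (\sum_i \sum_j (a i * f i * b j + a i * (b j * g j))).
      under [RHS]eq_bigr do rewrite big_split/= -!mulr_sumr b1 mulr1.
      by rewrite big_split/= -mulr_suml a1 mul1r.
    by apply: eq_bigr => i _; apply: eq_bigr => j _; ring.
  apply: ler_sum => i _; apply: ler_sum => j _.
  by rewrite ler_wpM2l// ?mulr_ge0//; exact: hfg.
have infS h : has_inf (S h).
  split; last by eexists; exact: lbS.
  exists (val (fun=> \sum_i \sum_j `|h i j|, fun=> 0)); eexists; last by [].
  move=> i j /=; rewrite addr0 (bigD1 i)//= (bigD1 j)//= -addrA.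
  apply: le_trans (ler_norm _) _; rewrite lerDl addr_ge0// sumr_ge0// => k _.
  by rewrite sumr_ge0.
pose p h := inf (S h).
have ple h fg : dom h fg -> p h <= val fg.
  by move=> ?; apply: (ge_inf (infS h).2); exists fg.
have lep h (x : R) : (forall fg, dom h fg -> x <= val fg) -> x <= p h.
  by move=> hx; apply: lb_le_inf; [exact: (infS h).1|move=> _ [fg ? <-]; exact: hx].
have valD f1 f2 g1 g2 : val (f1 \+ f2, g1 \+ g2) = val (f1, g1) + val (f2, g2).
  rewrite /val/= addrACA -!big_split/=.
  by congr (_ + _); apply: eq_bigr => i _; rewrite mulrDr.
have valZ k f g : val (k \*o f, k \*o g) = k * val (f, g).
  rewrite /val/= mulrDr !mulr_sumr.
  by congr (_ + _); apply: eq_bigr => i _; rewrite mulrCA.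
have pZ (k : R) h : 0 < k -> p (k *: h) <= k * p h.
  move=> k0; rewrite mulrC -ler_pdivrMr//; apply: (lep) => -[f g] hfg.
  rewrite ler_pdivrMr// mulrC -valZ; apply: (ple) => i j /=.
  by rewrite mxE -mulrDr; apply: ler_wpM2l; [exact: ltW|exact: hfg].
have p0 : p 0 = 0.
  apply/eqP; rewrite eq_le; apply/andP; split.
    have /ple : dom 0 (fun=> 0, fun=> 0) by move=> i j /=; rewrite mxE addr0.
    by rewrite /val/= big1 ?big1 ?addr0// => i _; rewrite mulr0.
  apply: (lep) => fg hfg; apply: le_trans (lbS 0 _ _); last by exists fg.
  by rewrite big1// => i _; rewrite big1// => j _; rewrite mxE mulr0.
have sp : sublinear p.
  split=> [u v|k h].
    rewrite -lerBlDr; apply: (lep) => -[f1 g1] h1.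
    rewrite lerBlDr -lerBlDl; apply: (lep) => -[f2 g2] h2.
    rewrite lerBlDl -valD; apply: (ple) => i j /=; rewrite mxE addrACA.
    by apply: lerD; [exact: h1|exact: h2].
  rewrite le_eqVlt => /predU1P[<-|k0]; first by rewrite scale0r mul0r.
  apply/eqP; rewrite eq_le pZ//=.
  have := @pZ k^-1 (k *: h); rewrite invr_gt0 => /(_ k0).
  by rewrite scalerA mulVf ?gt_eqF// scale1r ler_pdivlMl.
(* The sign turns the constraint f + g <= c into that of [dom], where the potentials dominate the
   matrix. *)
pose C : 'M[R]_(n, m) := \matrix_(i, j) - c i j.
have [q [sq qp qC qd]] := sublinear_support C delta_seq sp.
pose l i j := q (delta_mx i j).
have qE A : q A = \sum_i \sum_j A i j * l i j by exact: sublinear_mxE.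
have l0 i j : 0 <= l i j.
  have : q (- delta_mx i j) <= 0.
    apply: (le_trans (qp _)).
    have /ple : dom (- delta_mx i j) (fun=> 0, fun=> 0).
      by move=> i' j' /=; rewrite !mxE addr0 oppr_le0 ler0n.
    by rewrite /val/= big1 ?big1 ?addr0// => k _; rewrite mulr0.
  rewrite qd ?oppr_le0//.
  by apply/mapP; exists (i, j) => //; rewrite mem_enum.
have qle (f : 'I_n -> R) (g : 'I_m -> R) :
    \sum_i \sum_j (f i + g j) * l i j <= val (f, g).
  have := qE (\matrix_(i, j) (f i + g j)).
  under eq_bigr do under eq_bigr do rewrite mxE.
  by move=> <-; apply: (le_trans (qp _)); apply: (ple) => i j /=; rewrite mxE.
have qeq (f : 'I_n -> R) (g : 'I_m -> R) :
    \sum_i \sum_j (f i + g j) * l i j = val (f, g).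
  apply/eqP; rewrite eq_le qle/=.
  have := qle (fun i => - f i) (fun j => - g j); rewrite -subr_ge0.
  have -> : val (fun i => - f i, fun j => - g j) = - val (f, g).
    rewrite /val/= opprD -!sumrN; congr (_ + _); apply: eq_bigr => i _; ring.
  have -> : \sum_i \sum_j (- f i - g j) * l i j = - \sum_i \sum_j (f i + g j) * l i j.
    rewrite -sumrN; apply: eq_bigr => i _; rewrite -sumrN; apply: eq_bigr => j _; ring.
  by rewrite opprK addrC subr_ge0.
exists l; split=> // [i|j|].
- transitivity (\sum_k \sum_j ((k == i)%:R + 0) * l k j).
    rewrite [RHS](bigD1 i)//= [X in _ + X]big1 ?addr0 => [|k /negPf ki].
      by apply: eq_bigr => j _; rewrite eqxx ?addr0 mul1r.
    by rewrite big1// => j _; rewrite ki ?addr0 mul0r.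
  rewrite (qeq (fun k => (k == i)%:R) (fun=> 0)) /val/= [X in _ + X]big1 => [|k _].
    rewrite (bigD1 i)//= eqxx mulr1 big1 ?addr0// => k /negPf ->.
    by rewrite mulr0.
  by rewrite mulr0.
- transitivity (\sum_i \sum_k (0 + (k == j)%:R) * l i k).
    apply: eq_bigr => i _; rewrite (bigD1 j)//= eqxx ?add0r mul1r big1 ?addr0//.
    by move=> k /negPf ->; rewrite ?addr0 mul0r.
  rewrite (qeq (fun=> 0) (fun k => (k == j)%:R)) /val/= [X in X + _]big1 => [|k _].
    rewrite add0r (bigD1 j)//= eqxx mulr1 big1 ?addr0// => k /negPf ->.
    by rewrite mulr0.
  by rewrite mulr0.
- have -> : \sum_i \sum_j c i j * l i j = - p C.
    rewrite -qC qE -sumrN; apply: eq_bigr => i _; rewrite -sumrN.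
    by apply: eq_bigr => j _; rewrite !mxE mulNr opprK.
  rewrite lerNl; apply: (lep) => -[f g] hfg; rewrite lerNl.
  have := cM (fun i => - f i) (fun j => - g j).
  have -> : \sum_i a i * - f i + \sum_j b j * - g j = - val (f, g).
    rewrite /val/= opprD -!sumrN; congr (_ + _); apply: eq_bigr => i _; ring.
  by apply=> i j; have := hfg i j; rewrite mxE/=; lra.
Qed.

End transport_duality.

(** * Truncated metric and 1-Lipschitz functions *)

Section probability_integral.
Context {R : realType} {d : measure_display} {T : measurableType d}.
Variable mu : probability T R.
Implicit Types f g : T -> R.

Lemma prob_integrable f (M : R) : measurable_fun setT f ->
  (forall x, `|f x| <= M) -> mu.-integrable setT (EFin \o f).
Proof.
move=> mf fM; apply: measurable_bounded_integrable => //.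
  by apply: (@le_lt_trans _ _ 1%E); [exact: probability_le1|exact: ltry].
exists M; split; first exact: num_real.
by move=> y My x _; exact: le_trans (fM x) (ltW My).
Qed.

Lemma prob_integrable01 f : measurable_fun setT f ->
  (forall x, 0 <= f x <= 1) -> mu.-integrable setT (EFin \o f).
Proof.
move=> mf f01; apply: (prob_integrable (M := 1)) => // x.
by have /andP[f0 f1] := f01 x; rewrite ger0_norm.
Qed.

Lemma RintegralE f : mu.-integrable setT (EFin \o f) ->
  (\int[mu]_x f x)%:E = (\int[mu]_x (f x)%:E)%E.
Proof. by move=> fi; rewrite /Rintegral fineK// integrable_fin_num. Qed.

Lemma Rintegral_prob_cst (r : R) : \int[mu]_x r = r.
Proof.
rewrite Rintegral_cst// [X in fine X](_ : _ = 1%E) ?mulr1//.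
exact: probability_setT.
Qed.

Lemma Rintegral01 f : measurable_fun setT f -> (forall x, 0 <= f x <= 1) ->
  0 <= \int[mu]_x f x <= 1.
Proof.
move=> mf f01; rewrite Rintegral_ge0/= => [|x _]; last by case/andP: (f01 x).
rewrite -[leRHS]Rintegral_prob_cst; apply: le_Rintegral => //.
- exact: prob_integrable01.
- by apply: (prob_integrable (M := 1)) => // x; rewrite normr1.
- by move=> x _; case/andP: (f01 x).
Qed.

Lemma le_Rintegral_dist f g (h : T -> R) (M : R) :
  mu.-integrable setT (EFin \o f) -> mu.-integrable setT (EFin \o g) ->
  measurable_fun setT h -> (forall x, `|f x - g x| <= h x) ->
  (\int[mu]_x (h x)%:E <= M%:E)%E ->
  `|\int[mu]_x f x - \int[mu]_x g x| <= M.
Proof.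
move=> fi gi mh fgh hM; rewrite -RintegralB//.
have fgi : mu.-integrable setT (EFin \o (f \- g)).
  by have := integrableB measurableT fi gi.
apply: (le_trans (le_normr_Rintegral _ fgi)) => //.
rewrite -lee_fin RintegralE; last exact: integrable_norm.
apply: (le_trans _ hM); apply: ge0_le_integral => //.
- apply/measurable_EFinP; apply: measurableT_comp => //.
  by apply/measurable_EFinP; exact: measurable_int fgi.
- exact/measurable_EFinP.
- by move=> x _; rewrite lee_fin; exact: fgh.
Qed.

End probability_integral.

(** * Measurability and test functions on a Polish space *)

Section polish_space.
Context {R : realType} {d : measure_display} {E : measurableType d}.
Variable rho : E -> E -> R.
Hypothesis rhoP : polish rho.

Definition lsc (g : E -> R) := forall x c, c < g x ->
  exists2 del : R, 0 < del & forall y, rho x y < del -> c < g y.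

Definition tmetric x y : R := Num.min (rho x y) 1.

(** Values in [0, 1] keep every integral finite and lose nothing up to an additive constant, since
    [tmetric] is at most 1. *)
Definition Lip1 (f : E -> R) := (forall x, 0 <= f x <= 1) /\
  (forall x y, `|f x - f y| <= tmetric x y).

Let rho_metric : is_metric rho. Proof. by case: rhoP. Qed.

Lemma rho_ge0 x y : 0 <= rho x y. Proof. by case: rho_metric. Qed.

Lemma rhoxx x : rho x x = 0.
Proof. by case: rho_metric => _ h _ _; apply/h. Qed.

Lemma rhoC x y : rho x y = rho y x. Proof. by case: rho_metric. Qed.

Lemma rho_triangle y x z : rho x z <= rho x y + rho y z.
Proof. by case: rho_metric. Qed.

Lemma tmetric_ge0 x y : 0 <= tmetric x y.
Proof. by rewrite /tmetric le_min rho_ge0 ler01. Qed.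

Lemma tmetric_le1 x y : tmetric x y <= 1.
Proof. by rewrite /tmetric ge_min lexx orbT. Qed.

Lemma tmetric_le_rho x y : tmetric x y <= rho x y.
Proof. by rewrite /tmetric ge_min lexx. Qed.

Lemma tmetricC x y : tmetric x y = tmetric y x.
Proof. by rewrite /tmetric rhoC. Qed.

Lemma tmetricxx x : tmetric x x = 0.
Proof. by rewrite /tmetric rhoxx; apply/min_idPl; exact: ler01. Qed.

Lemma tmetric_triangle y x z : tmetric x z <= tmetric x y + tmetric y z.
Proof.
have := rho_triangle y x z; have := rho_ge0 x y; have := rho_ge0 y z.
rewrite /tmetric; case: (leP (rho x z) 1); case: (leP (rho x y) 1);
  case: (leP (rho y z) 1); lra.
Qed.

Lemma measurable_rho_open U : rho_open rho U -> measurable U.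
Proof. by case: rhoP => _ _ _ b oU; apply/b; exact: sub_sigma_algebra. Qed.

Lemma rho_open_ball x e : rho_open rho [set y | rho x y < e].
Proof.
move=> y /= xy; exists (e - rho x y) => [|z yz]; first by rewrite subr_gt0.
by apply: le_lt_trans (rho_triangle y x z) _; rewrite -ltrBrDl.
Qed.

Lemma measurable_rho_ball x e : measurable [set y | rho x y < e].
Proof. exact: measurable_rho_open (@rho_open_ball x e). Qed.

(** Separability enters here: W is a countable union of products of balls centred at points of the
    dense sequence with radii 1 / (k + 1), so it belongs to the product sigma-algebra. *)
Lemma measurable_prod_open (W : set (E * E)) :
  (forall x y, W (x, y) -> exists2 e : R, 0 < e &
     forall x' y', rho x x' < e -> rho y y' < e -> W (x', y')) ->
  measurable W.
Proof.
move=> oW; have [_ _ [s sd] _] := rhoP.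
pose B (i : nat) (k : nat) := [set y | rho (s i) y < k.+1%:R^-1].
pose F (ijk : nat * nat * nat) :=
  if `[< B ijk.1.1 ijk.2 `*` B ijk.1.2 ijk.2 `<=` W >]
  then B ijk.1.1 ijk.2 `*` B ijk.1.2 ijk.2 else set0.
have -> : W = \bigcup_ijk F ijk.
  apply/seteqP; split=> [[x y] Wxy|xy [[[i j] k] _]]; last first.
    by rewrite /F/=; case: asboolP => // h; exact: h.
  have [e e0 h] := oW _ _ Wxy.
  have [k ke] : exists k : nat, k.+1%:R^-1 < e / 2.
    have e20 : 0 < e / 2 by lra.
    have [k _ hk] := near_infty_natSinv_lt (PosNum e20).
    by exists k; exact: hk k (leqnn k).
  have k0 : 0 < k.+1%:R^-1 :> R by rewrite invr_gt0.
  have [i xi] := sd x _ k0; have [j yj] := sd y _ k0.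
  exists (i, j, k) => //; rewrite /F/=; case: asboolP.
    by rewrite /B/= => _; split=> /=; rewrite rhoC.
  case=> -[x' y'] [/=]; rewrite /B/=.
  move: ke xi yj; move: (k.+1%:R^-1) => q qe xi yj ix' jy'; apply: h.
    by have := rho_triangle (s i) x x'; lra.
  by have := rho_triangle (s j) y y'; lra.
apply: countable_bigcupT_measurable => [|[[i j] k]]; first exact: countableP.
by rewrite /F; case: asboolP => // _; apply: measurableX; exact: measurable_rho_ball.
Qed.

Lemma measurable_lsc2 (h : E -> E -> R) :
  (forall x y c, c < h x y -> exists2 del : R, 0 < del &
     forall x' y', rho x x' < del -> rho y y' < del -> c < h x' y') ->
  measurable_fun setT (fun z : E * E => h z.1 z.2).
Proof.
move=> hl; apply: (measurability _ (RGenOInfty.measurableE R)) => //.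
move=> _ [_ [c ->] <-]; rewrite setTI; apply: measurable_prod_open => x y /=.
rewrite in_itv/= andbT => /hl[e e0 he]; exists e => // x' y' ? ?.
by rewrite in_itv/= andbT; exact: he.
Qed.

Lemma measurable_lsc g : lsc g -> measurable_fun setT g.
Proof.
move=> gl; apply: (measurability _ (RGenOInfty.measurableE R)) => //.
move=> _ [_ [c ->] <-]; rewrite setTI; apply: measurable_rho_open => x /=.
rewrite in_itv/= andbT => /gl[e e0 he]; exists e => // y ?.
by rewrite in_itv/= andbT; exact: he.
Qed.

Lemma lsc_continuous g : rho_continuous rho g -> lsc g.
Proof.
move=> gc x c cx; have [|e e0 h] := gc x (g x - c); first by rewrite subr_gt0.
by exists e => // y /h; rewrite ltr_norml => /andP[+ _]; lra.
Qed.

Lemma measurable_tmetric : measurable_fun setT (fun z : E * E => tmetric z.1 z.2).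
Proof.
apply: measurable_minr => //; apply: measurable_lsc2 => x y c cxy.
exists ((rho x y - c) / 2) => [|x' y' xx' yy']; first by lra.
have := rho_triangle x' x y; have := rho_triangle y' x' y.
by rewrite (rhoC y' y); lra.
Qed.

Lemma Lip1_continuous f : Lip1 f -> rho_continuous rho f.
Proof.
move=> [_ fl] x e e0; exists e => // y xy.
by apply: le_lt_trans xy; apply: le_trans (fl y x) _; rewrite tmetricC tmetric_le_rho.
Qed.

Lemma measurable_Lip1 f : Lip1 f -> measurable_fun setT f.
Proof. by move=> /Lip1_continuous/lsc_continuous/measurable_lsc. Qed.

Lemma Lip1_integrable f (mu : probability E R) : Lip1 f ->
  mu.-integrable setT (EFin \o f).
Proof.
by move=> fl; apply: prob_integrable01; [exact: measurable_Lip1|exact: fl.1].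
Qed.

(* G k is the inf-convolution of g with k.+1 rho. *)
Lemma Lip1_approx g : (forall x, 0 <= g x <= 1) -> lsc g ->
  exists G : nat -> E -> R,
    [/\ forall k, Lip1 (fun x => k.+1%:R^-1 * G k x),
        forall k x, 0 <= G k x <= g x,
        forall x k l, (k <= l)%N -> G k x <= G l x &
        forall x, G k x @[k --> \oo] --> g x].
Proof.
move=> g01 gl.
pose S k x := [set g y + k.+1%:R * rho x y | y in [set: E]].
have S0 (k : nat) x : lbound (S k x) 0.
  move=> _ [y _ <-]; rewrite addr_ge0//; first by case/andP: (g01 y).
  by rewrite mulr_ge0// rho_ge0.
have infS k x : has_inf (S k x).
  by split; [exists (g x + k.+1%:R * rho x x), x|exists 0; exact: S0].
pose G k x := inf (S k x).
have Gle k x y : G k x <= g y + k.+1%:R * rho x y.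
  by apply: (ge_inf (infS k x).2); exists y.
have leG k x (a : R) : (forall y, a <= g y + k.+1%:R * rho x y) -> a <= G k x.
  by move=> h; apply: lb_le_inf; [exact: (infS k x).1|move=> _ [y _ <-]; exact: h].
have G0 k x : 0 <= G k x by apply: (leG) => y; apply: S0; exists y.
have Gg k x : G k x <= g x by have := Gle k x x; rewrite rhoxx mulr0 addr0.
have G1 k x : G k x <= 1 by apply: le_trans (Gg k x) _; case/andP: (g01 x).
have Glip k x y : G k x - G k y <= k.+1%:R * rho x y.
  rewrite lerBlDr addrC -lerBlDr; apply: (leG) => z.
  rewrite lerBlDr; apply: le_trans (Gle k x z) _.
  by rewrite -addrA lerD2l -mulrDr ler_wpM2l// addrC rho_triangle.
have Gnd x k l : (k <= l)%N -> G k x <= G l x.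
  move=> kl; apply: (leG) => y; apply: le_trans (Gle k x y) _.
  by rewrite lerD2l ler_wpM2r ?rho_ge0// ler_nat ltnS.
exists G; split=> //.
- move=> k; have k0 : 0 < k.+1%:R^-1 :> R by rewrite invr_gt0.
  have k1 : k.+1%:R^-1 <= 1 :> R by rewrite invf_le1// ler1n.
  split=> [x|x y].
    rewrite mulr_ge0 ?(ltW k0)//=; apply: le_trans (G1 k x).
    by rewrite ler_piMl.
  rewrite -mulrBr normrM gtr0_norm// /tmetric le_min; apply/andP; split.
    rewrite ler_pdivrMl// ler_norml Glip andbT.
    by have := Glip k y x; rewrite rhoC; lra.
  have := G0 k x; have := G0 k y; have := G1 k x; have := G1 k y => h1 h2 h3 h4.
  apply: (@le_trans _ _ `|G k x - G k y|); first by rewrite ler_piMl.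
  by rewrite ler_norml; lra.
- by move=> k x; rewrite G0 Gg.
- move=> x; apply/cvgrPdist_le => e e0.
  have [|del del0 h] := gl x (g x - e); first lra.
  near=> k; rewrite ler_norml; apply/andP; split.
    by have := Gg k x; lra.
  rewrite lerBlDr addrC -lerBlDr; apply: (leG) => y.
  have /andP[gy0 gy1] := g01 y; have /andP[gx0 gx1] := g01 x.
  have [xy|xy] := ltP (rho x y) del.
    have := h _ xy; have : 0 <= k.+1%:R * rho x y by rewrite mulr_ge0// rho_ge0.
    by lra.
  suff : 1 <= k.+1%:R * rho x y by lra.
  apply: (@le_trans _ _ (k.+1%:R * del)); last by rewrite ler_wpM2l.
  rewrite -ler_pdivrMr// div1r ltW//.
  apply: (@lt_trans _ _ k%:R); last by rewrite ltr_nat.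
  by near: k; exact: nbhs_infty_gtr.
Unshelve. all: by end_near. Qed.

Lemma Lip1_approx_integral (mu : probability E R) g (G : nat -> E -> R) :
  (forall x, 0 <= g x <= 1) -> lsc g ->
  (forall k, Lip1 (fun x => k.+1%:R^-1 * G k x)) ->
  (forall k x, 0 <= G k x <= g x) ->
  (forall x, G k x @[k --> \oo] --> g x) ->
  \int[mu]_x G k x @[k --> \oo] --> \int[mu]_x g x.
Proof.
move=> g01 gl GL G0g Gg.
have mG k : measurable_fun setT (G k).
  rewrite (_ : G k = fun x => k.+1%:R * (k.+1%:R^-1 * G k x)); last first.
    by apply/funext => x; rewrite mulrA divff ?mul1r// pnatr_eq0.
  by apply: measurable_funM => //; exact: measurable_Lip1.
apply: fine_cvg; rewrite RintegralE; last first.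
  by apply: prob_integrable01 => //; exact: measurable_lsc.
apply: (@dominated_cvg _ _ _ mu setT measurableT (fun k => EFin \o G k) _ (cst 1%E)).
- by move=> k; apply/measurable_EFinP.
- by move=> x _; apply: cvg_EFin; [exact: nearW|exact: Gg].
- by [].
- exact: (finite_measure_integrable_cst mu 1).
- move=> k x _ /=; rewrite lee_fin; have /andP[h1 h2] := G0g k x.
  by rewrite ger0_norm// (le_trans h2)//; case/andP: (g01 x).
Qed.

Lemma indic01 (U : set E) x : 0 <= (\1_U x : R) <= 1.
Proof. by rewrite indicE; case: (x \in U); rewrite !lexx ler01. Qed.

Lemma lsc_indic U : rho_open rho U -> lsc (\1_U : E -> R).
Proof.
move=> oU x c; rewrite indicE; case: (boolP (x \in U)) => [|_ c0].
  rewrite inE => /oU[e e0 h] c1; exists e => // y /h Uy.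
  by rewrite indicE mem_set.
exists 1 => // y _; apply: lt_le_trans c0 _.
by case/andP: (indic01 U y).
Qed.

(** Open sets form a generating pi-system, and the indicator of an open set is lower semicontinuous,
    hence a limit of multiples of functions in [Lip1]. *)
Lemma prob_eq_Lip1 (mu nu : probability E R) :
  (forall f, Lip1 f -> \int[mu]_x f x = \int[nu]_x f x) ->
  forall A, measurable A -> mu A = nu A.
Proof.
move=> eqf.
apply: (measure_unique (rho_open rho) (fun=> setT)).
- by apply/seteqP; split=> A; case: rhoP => _ _ _ b /b.
- move=> A B oA oB x [/oA[e e0 h] /oB[e' e'0 h']].
  by exists (Num.min e e') => [|y]; rewrite lt_min ?e0// => /andP[? ?]; split; auto.
- by move=> _ x _; exists 1.
- by rewrite bigcup_const//; exists 0%N.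
- move=> U oU.
  have g01 := indic01 U; have gl := lsc_indic oU.
  have [G [GL G0g _ Gc]] := Lip1_approx g01 gl.
  have eqG k : \int[mu]_x G k x = \int[nu]_x G k x.
    have k0 : k.+1%:R != 0 :> R by rewrite pnatr_eq0.
    have := eqf _ (GL k).
    have sc (m : probability E R) : \int[m]_x (k.+1%:R^-1 * G k x) = k.+1%:R^-1 * \int[m]_x G k x.
      have : m.-integrable setT (EFin \o G k).
        have := integrableZl measurableT k.+1%:R (Lip1_integrable m (GL k)).
        apply: eq_integrable => // x _ /=.
        by rewrite -EFinM mulrA divff// mul1r.
      by move=> ?; rewrite RintegralZl.
    by rewrite !sc => /(mulfI (invr_neq0 k0)).
  have c1 := Lip1_approx_integral (mu := mu) g01 gl GL G0g Gc.
  have c2 := Lip1_approx_integral (mu := nu) g01 gl GL G0g Gc.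
  have : \int[mu]_x (\1_U x : R) = \int[nu]_x (\1_U x : R).
    apply: (cvg_unique _ c1); last first.
      by move: c2; under eq_fun do rewrite -eqG.
    exact: norm_hausdorff.
  have mU := measurable_rho_open oU.
  move=> eqU; have := congr1 EFin eqU; rewrite !RintegralE; last 2 first.
  + exact: integrable_indic.
  + exact: integrable_indic.
  by rewrite !integral_indic// !setIT.
- by move=> _; apply: (@le_lt_trans _ _ 1%E); [exact: probability_le1|exact: ltry].
Qed.

End polish_space.

(** * Gluing generalised couplings *)

Section measure_constructions.
Context {R : realType} {d : measure_display} {T : measurableType d}.
Local Open Scope ereal_scope.

Section density.
Variables (m : {measure set T -> \bar R}) (f : T -> \bar R).
Hypotheses (mf : measurable_fun setT f) (f0 : forall x, 0 <= f x).

Let dens A := \int[m]_(x in A) f x.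

Let dens0 : dens set0 = 0. Proof. by rewrite /dens integral_set0. Qed.

Let dens_ge0 A : 0 <= dens A. Proof. exact: integral_ge0. Qed.

Let dens_sigma_additive : semi_sigma_additive dens.
Proof. exact: semi_sigma_additive_nng_induced. Qed.

HB.instance Definition _ := isMeasure.Build _ _ _ dens
  dens0 dens_ge0 dens_sigma_additive.

Lemma density_measure : exists M : {measure set T -> \bar R},
  forall A, M A = \int[m]_(x in A) f x.
Proof. by exists dens. Qed.

End density.

Lemma prob_of_measure (M : {measure set T -> \bar R}) : M setT = 1 ->
  exists Q : probability T R, forall A, Q A = M A.
Proof.
move=> M1; exists (mnormalize M (dirac point : probability T R)) => A /=.
by rewrite /mnormalize M1/= onee_eq0/= invr1 mule1.
Qed.

Lemma prob_of_finite_measure (M : {measure set T -> \bar R}) (k : R) : (0 < k)%R ->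
  M setT = k%:E ->
  exists Q : probability T R, forall A, k%:E * Q A = M A.
Proof.
move=> k0 Mk; exists (mnormalize M (dirac point : probability T R)) => A /=.
rewrite /mnormalize Mk/= eqe gt_eqF//=.
by rewrite muleCA -EFinM divff ?mule1// gt_eqF.
Qed.

Lemma prob_law d' (O : measurableType d') (Pr : probability O R) (X : O -> T) :
  measurable_fun setT X ->
  exists Q : probability T R, (forall A, Q A = Pr (X @^-1` A)) /\
    (forall h : T -> \bar R, measurable_fun setT h -> (forall x, 0 <= h x) ->
       \int[Q]_x h x = \int[Pr]_w h (X w)).
Proof.
move=> mX; pose X' : {mfun O >-> T} := HB.pack X (isMeasurableFun.Build _ _ _ _ _ mX).
exists (distribution Pr X'); split=> // h mh h0.
exact: (ge0_integral_pushforward mX).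
Qed.

End measure_constructions.

Section gluing.
Context {R : realType} {d : measure_display} {E : measurableType d}.
Local Open Scope ereal_scope.

Lemma sube_eq_adde (a b c e : \bar R) : a \is a fin_num -> b \is a fin_num ->
  c \is a fin_num -> e \is a fin_num -> a - b = c - e -> a + e = b + c.
Proof.
move: a b c e => [a| |]// [b| |]// [c| |]// [e| |]// _ _ _ _.
by rewrite -!EFinB => -[abce]; rewrite -!EFinD; congr EFin; lra.
Qed.

Lemma adde_cancelr (a b c e : \bar R) : a \is a fin_num -> b \is a fin_num ->
  c \is a fin_num -> e \is a fin_num -> a + c + b = e + c -> a + b = e.
Proof.
move: a b c e => [a| |]// [b| |]// [c| |]// [e| |]// _ _ _ _.
by rewrite -!EFinD => -[?]; congr EFin; lra.
Qed.

(** Jordan decomposition of nu - nu'. On a positive set P the excess is sp A = nu (A [&] P) - nu' (A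
    [&] P), which is at most nu A and has total mass at most tau. *)
Lemma prob_jordan (nu nu' : probability E R) (tau : R) :
  (forall A, measurable A -> `|nu A - nu' A| <= tau%:E) ->
  exists sp sn : {finite_measure set E -> \bar R},
    [/\ forall A, measurable A -> nu A + sn A = nu' A + sp A,
        forall A, measurable A -> sp A <= nu A & sp setT <= tau%:E].
Proof.
move=> ht.
pose s := cadd (charge_of_finite_measure nu)
  (cscale (-1) (charge_of_finite_measure nu')).
have [P [N sPN]] := Hahn_decomposition s.
have [[mP posP] [mN negN] PNT PN0] := sPN.
have sE A : s A = nu A - nu' A by rewrite /s /cadd/= cscaleN1.
have spE A : measurable A -> jordan_pos sPN A = nu (A `&` P) - nu' (A `&` P).
  by move=> mA; rewrite jordan_posE cjordan_posE /crestr0 mem_set// /crestr; exact: sE.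
have fin (p : probability E R) A : measurable A -> p A \is a fin_num.
  by move=> mA; exact: fin_num_measure.
exists (jordan_pos sPN), (jordan_neg sPN); split.
- move=> A mA; apply: sube_eq_adde.
  + exact: fin.
  + exact: fin.
  + exact: (fin_num_measure (jordan_pos sPN)).
  + exact: (fin_num_measure (jordan_neg sPN)).
  transitivity (s A); first exact/esym/sE.
  transitivity (cadd (jordan_pos sPN) (cscale (-1) (jordan_neg sPN)) A).
    exact: jordan_decomp.
  transitivity (jordan_pos sPN A + cscale (-1) (jordan_neg sPN) A) => //.
  by congr (_ + _); rewrite /cscale EFinN mulN1e.
- move=> A mA; suff h : jordan_pos sPN A <= nu A by exact: h.
  rewrite spE//; apply: (@le_trans _ _ (nu (A `&` P))).
    by rewrite leeBlDr ?fin//; [rewrite leeDl|exact: measurableI].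
  by apply: le_measure; rewrite ?inE//; exact: measurableI.
- suff h : jordan_pos sPN setT <= tau%:E by exact: h.
  rewrite spE// setTI; apply: le_trans (ht P mP).
  by rewrite lee_abs.
Qed.

(** The Radon-Nikodym density is at most 1 almost everywhere because sp <= nu. Truncating it at 1
    leaves its integrals unchanged and makes the bound hold everywhere, so that both h and 1 - h are
    usable weights. *)
Lemma prob_jordan_density (nu : probability E R)
    (sp : {finite_measure set E -> \bar R}) :
  (forall A, measurable A -> sp A <= nu A) ->
  exists h : E -> R, [/\ measurable_fun setT h, forall x, (0 <= h x <= 1)%R &
    forall A, measurable A -> \int[nu]_(x in A) (h x)%:E = sp A].
Proof.
move=> spnu.
have dom : sp `<< nu.
  apply/null_content_dominatesP => A mA nuA.
  by apply/eqP; rewrite eq_le measure_ge0 andbT -nuA spnu.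
have [g [g0 gi gE]] := radon_nikodym_finite dom.
have mg : measurable_fun setT g by exact: measurable_int gi.
have min_fin x : mine (g x) 1 \is a fin_num.
  have : 0 <= mine (g x) 1 by rewrite le_min g0 lee01.
  move=> h; rewrite ge0_fin_numE// (@le_lt_trans _ _ 1)// ?ltry//.
  by rewrite ge_min lexx orbT.
pose h x := fine (mine (g x) 1).
have hE x : (h x)%:E = mine (g x) 1 by rewrite /h fineK.
have mh : measurable_fun setT h.
  by apply: measurableT_comp => //; exact: measurable_mine.
have h01 x : (0 <= h x <= 1)%R.
  by rewrite -!lee_fin hE le_min ge_min g0 lexx orbT lee01.
exists h; split=> // A mA.
pose G := [set x | g x <= 1].
have mG : measurable G by rewrite -[G]setTI; exact: emeasurable_fun_le.
have mh' B : measurable_fun B (fun x => (h x)%:E).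
  by apply/measurable_EFinP; exact: measurable_funTS.
have split_int (f : E -> \bar R) : measurable_fun setT f -> (forall x, 0 <= f x) ->
    \int[nu]_(x in A) f x = \int[nu]_(x in A `&` G) f x + \int[nu]_(x in A `&` ~` G) f x.
  move=> mf f0; rewrite -ge0_integral_setU//; last 4 first.
  - exact: measurableI.
  - by apply: measurableI => //; exact: measurableC.
  - exact: measurable_funTS.
  - by apply/disj_setPS => x [[_ +] [_ +]].
  by rewrite -setIUr setUv setIT.
have h0 x : 0 <= (h x)%:E by rewrite lee_fin; case/andP: (h01 x).
rewrite gE// (split_int _ mg g0) (split_int _ (mh' _) h0); congr (_ + _).
  apply: eq_integral => x; rewrite inE => -[_ Gx]; rewrite hE.
  exact/min_idPl.
have mAG : measurable (A `&` ~` G) by apply: measurableI => //; exact: measurableC.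
have e1 : \int[nu]_(x in A `&` ~` G) (h x)%:E = nu (A `&` ~` G).
  rewrite -[RHS]mul1e -integral_cst//; apply: eq_integral => x.
  rewrite inE => -[_ /negP]; rewrite -ltNge => /ltW gx1.
  by rewrite hE; exact/min_idPr.
apply/eqP; rewrite e1 eq_le; apply/andP; split; last by rewrite -gE// spnu.
rewrite -[leLHS]mul1e -integral_cst//; apply: ge0_le_integral => //.
- exact: measurable_funTS.
- by move=> x [_ /negP]; rewrite -ltNge => /ltW.
Qed.

(* Only the part of m whose second coordinate carries the excess of nu over nu'
   is resampled, independently of the first coordinate; weighting m by a
   function of the second coordinate avoids any disintegration. *)
Lemma glue_coupling (mu nu nu' : probability E R) (m : probability (E * E)%type R)
    (tau : R) :
  coupling mu nu m ->
  (forall A, measurable A -> `|nu A - nu' A| <= tau%:E) ->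
  exists m' : probability (E * E)%type R, coupling mu nu' m' /\
    forall h : E * E -> R, measurable_fun setT h -> (forall z, (0 <= h z <= 1)%R) ->
      \int[m']_z (h z)%:E <= \int[m]_z (h z)%:E + tau%:E.
Proof.
move=> [m1 m2] ht.
have [sp [sn [snp spnu spt]]] := prob_jordan ht.
have [h [mh h01 hE]] := prob_jordan_density spnu.
have spfin A : measurable A -> sp A \is a fin_num by exact: fin_num_measure.
have fin (d' : measure_display) (T : measurableType d') (p : probability T R) A :
  measurable A -> p A \is a fin_num by move=> mA; exact: fin_num_measure.
pose k := fine (sp setT).
have kE : sp setT = k%:E by rewrite fineK// spfin.
have k0 : (0 <= k)%R by rewrite -lee_fin -kE measure_ge0.
have snk : sn setT = k%:E.
  have := snp setT measurableT.
  have -> : nu setT = 1 by exact: probability_setT.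
  have -> : nu' setT = 1 by exact: probability_setT.
  rewrite kE.
  have : sn setT \is a fin_num by exact: fin_num_measure.
  by case: (sn setT) => // r _ [r1]; congr EFin; lra.
pose h2 (z : E * E) := (h z.2)%:E.
have mh2 : measurable_fun setT h2.
  by apply/measurable_EFinP; apply: measurableT_comp.
have h2_0 z : 0 <= h2 z by rewrite lee_fin; case/andP: (h01 z.2).
have h2c0 z : 0 <= 1 - h2 z by rewrite /h2 -EFinB lee_fin subr_ge0; case/andP: (h01 z.2).
have mh2c : measurable_fun setT (fun z => 1 - h2 z) by exact: emeasurable_funB.
have [mk mkE] := density_measure m mh2c h2c0.
have [mr mrE] := density_measure m mh2 h2_0.
have mkr A : measurable A -> mk A + mr A = m A.
  move=> mA; rewrite mkE mrE -ge0_integralD//; last 2 first.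
  - exact: measurable_funTS.
  - exact: measurable_funTS.
  under eq_integral do rewrite subeK//.
  by rewrite integral_cst// mul1e.
have msnd : measurable_fun setT (snd : E * E -> E) by exact: measurable_snd.
have mr2 A : measurable A -> mr (setT `*` A) = sp A.
  move=> mA; rewrite mrE -hE// setTX.
  have := @ge0_integral_pushforward _ _ _ _ R _ msnd m A (EFin \o h) mA.
  move=> <-; last 2 first.
  - by apply/measurable_EFinP; exact: measurable_funTS.
  - by move=> x _; rewrite lee_fin; case/andP: (h01 x).
  apply: eq_measure_integral => B mB _.
  by transitivity (m (setT `*` B)); [rewrite setTX|exact: m2].
have mrT : mr setT = k%:E by rewrite -kE -mr2// setXTT.
(* Without excess nu and nu' coincide and m itself serves; otherwise the excess can be
   normalised. *)
have [k_eq0|k_neq0] := eqVneq k 0%R.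
  exists m; split=> [|H mH H01]; last first.
    by rewrite leeDl// (le_trans _ spt).
  split=> // A mA; rewrite m2//; have := snp A mA.
  have -> : sp A = 0.
    apply/eqP; rewrite eq_le measure_ge0 andbT.
    apply: (@le_trans _ _ (sp setT)); last by rewrite kE k_eq0.
    by apply: le_measure; rewrite ?inE.
  have -> : sn A = 0.
    apply/eqP; rewrite eq_le measure_ge0 andbT.
    apply: (@le_trans _ _ (sn setT)); last by rewrite snk k_eq0.
    by apply: le_measure; rewrite ?inE.
  by rewrite !adde0.
have kgt0 : (0 < k)%R by rewrite lt_def k_neq0.
have [mr' mr'E] := prob_of_finite_measure kgt0 mrT.
have [al [alE _]] := prob_law mr' (measurable_fst : measurable_fun setT (fst : E * E -> E)).
have [be beE] := prob_of_finite_measure kgt0 snk.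
(* The kept part [mk] plus mass k of a product law: [al] is the normalised first marginal of the
   removed part, so the first marginal is restored, and [be] is the normalised [sn], so the second
   becomes nu - sp + sn = nu'. *)
pose M := measure_add mk (mscale (NngNum k0) (al \x be)).
have ME A B : measurable A -> measurable B ->
    M (A `*` B) = mk (A `*` B) + k%:E * (al A * be B).
  move=> mA mB; rewrite /M measure_addE; congr (_ + _).
  by rewrite /mscale; congr (_ * _); exact: product_measure1E.
have M1 A : measurable A -> M (A `*` setT) = mu A.
  move=> mA; rewrite ME//.
  have -> : be setT = 1 by exact: probability_setT.
  rewrite mule1 alE mr'E.
  have -> : fst @^-1` A = A `*` [set: E] by rewrite setXT.
  by rewrite mkr ?m1//; exact: measurableX.
have M2 A : measurable A -> M (setT `*` A) = nu' A.
  move=> mA; rewrite ME//.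
  have -> : al setT = 1 by exact: probability_setT.
  rewrite mul1e beE.
  have mX : measurable ([set: E] `*` A) by exact: measurableX.
  have nuE : mk ([set: E] `*` A) + sp A = nu A by rewrite -mr2// mkr// m2.
  apply: (@adde_cancelr _ _ (sp A)).
  - have := fin _ _ nu A mA; rewrite -nuE.
    by case: (mk _) (spfin A mA) (measure_ge0 mk ([set: E] `*` A)) => // r; case: (sp A).
  - exact: (fin_num_measure sn).
  - exact: spfin.
  - exact: fin.
  by rewrite nuE; exact: snp.
have MT : M setT = 1 by rewrite -setXTT M1//; exact: probability_setT.
have [m' m'E] := prob_of_measure MT.
exists m'; split; first split=> A mA.
- by rewrite m'E; exact: M1.
- by rewrite m'E; exact: M2.
move=> H mH H01.
have H0 z : [set: E * E] z -> 0 <= (H z)%:E by rewrite lee_fin; case/andP: (H01 z).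
have mHE : measurable_fun [set: E * E] (EFin \o H) by exact/measurable_EFinP.
rewrite (@eq_measure_integral _ _ _ _ M)//; last by move=> A _ _; exact: m'E.
rewrite ge0_integral_measure_add//; apply: leeD.
  rewrite (@eq_measure_integral _ _ _ _ (measure_add mk mr) m); last first.
    move=> A mA _; transitivity (mk A + mr A); first by rewrite mkr.
    exact/esym/measure_addE.
  by rewrite ge0_integral_measure_add// leeDl// integral_ge0.
rewrite ge0_integral_mscale//=; apply: (@le_trans _ _ (k%:E * 1)); last first.
  by rewrite mule1 -kE.
rewrite lee_pmul2l// ?lte_fin//.
have : \int[al \x be]_z (H z)%:E <= \int[al \x be]_z (cst 1%E z).
  apply: ge0_le_integral => // z _; rewrite lee_fin; by case/andP: (H01 z).
rewrite integral_cst// mul1e => /le_trans; apply.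
exact: (probability_le1 (al \x be)).
Qed.

End gluing.

(** * Markov semigroup and Lyapunov bounds *)

Section lower_integral.
Context {R : realType} {d : measure_display} {T : measurableType d}.
Variable mu : {measure set T -> \bar R}.
Local Open Scope ereal_scope.
Import HBNNSimple.

(* f need not be measurable: the integral of a nonnegative function is the
   supremum over the simple functions below it. *)
Lemma integral_ge_cst (D : set T) (f : T -> \bar R) (c : R) : measurable D ->
  (0 <= c)%R -> (forall x, D x -> c%:E <= f x) ->
  c%:E * mu D <= \int[mu]_(x in D) f x.
Proof.
move=> mD c0 cf; rewrite -integral_cst// [leRHS]integral_mkcond [leLHS]integral_mkcond.
have f0 x : D x -> 0 <= f x by move=> /cf; apply: le_trans; rewrite lee_fin.
rewrite [leRHS]ge0_integralTE; last by move=> x; exact: erestrict_ge0.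
pose h := scale_nnsfun (indic_nnsfun R mD) c0.
have hE x : (h x)%:E = (cst c%:E \_ D) x.
  have -> : h x = (c * \1_D x)%R by [].
  rewrite patchE; case: ifPn => xD; first by rewrite indicE xD mulr1.
  by rewrite indicE (negbTE xD) mulr0.
apply: ereal_sup_ubound; exists h.
  move=> x; rewrite hE !patchE; case: ifPn => //.
  by rewrite inE; exact: cf.
by rewrite -integralT_nnsfun; apply: eq_integral => x _; rewrite hE.
Qed.

End lower_integral.

Section markov_semigroup.
Context {R : realType} {d : measure_display} {E : measurableType d}.
Variable P : R -> E -> probability E R.
Hypothesis markovP : markov_tf P.
Implicit Types t s : R.
Local Open Scope ereal_scope.

Lemma measurable_markov_integral t (f : E -> \bar R) : (0 <= t)%R ->
  measurable_fun setT f -> (forall x, 0 <= f x) ->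
  measurable_fun setT (fun x => \int[P t x]_y f y).
Proof.
move=> t0 mf f0; apply: measurable_fun_integral_kernel => // U mU.
by case: markovP => h _ _; exact: h.
Qed.

Lemma markov_giry t : (0 <= t)%R ->
  measurable_fun setT (fun x => P t x : giry E R).
Proof.
move=> t0; apply: measurable_giry_codensity => // B mB.
by case: markovP => h _ _; exact: h.
Qed.

Lemma giry_bindE (mu : probability E R) t (mP : measurable_fun setT (fun x => P t x : giry E R))
    (A : set E) : measurable A ->
  giry_bind mu mP A = \int[mu]_x P t x A.
Proof.
move=> mA; rewrite /giry_bind /= [LHS]giry_int_map//.
exact: measurable_giry_ev.
Qed.

(** The composition of mu with the kernel is a bind of the Giry monad, whose integral formula is the
    claim. It serves both Chapman-Kolmogorov for functions and invariance. *)
Lemma markov_invariant_integral t (mu nu : probability E R) (f : E -> \bar R) :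
  (0 <= t)%R -> (forall A, measurable A -> \int[mu]_x P t x A = nu A) ->
  measurable_fun setT f -> (forall x, 0 <= f x) ->
  \int[mu]_x \int[P t x]_y f y = \int[nu]_x f x.
Proof.
move=> t0 munu mf f0; have mP := markov_giry t0.
have := giry_int_bind mu mP mf f0; rewrite /giry_int => <-.
apply: eq_measure_integral => A mA _.
by transitivity (\int[mu]_x P t x A); [exact: giry_bindE|exact: munu].
Qed.

Lemma chapman_kolmogorov s t x (f : E -> \bar R) : (0 <= s)%R -> (0 <= t)%R ->
  measurable_fun setT f -> (forall x, 0 <= f x) ->
  \int[P (s + t) x]_y f y = \int[P s x]_y \int[P t y]_z f z.
Proof.
move=> s0 t0 mf f0; apply/esym/markov_invariant_integral => // A mA.
by case: markovP => _ _ h; rewrite h.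
Qed.

Lemma markov0 x (f : E -> \bar R) : measurable_fun setT f -> (forall x, 0 <= f x) ->
  \int[P 0 x]_y f y = f x.
Proof.
move=> mf f0; rewrite (@eq_measure_integral _ _ _ _ (dirac x)).
  by rewrite integral_dirac// diracT mul1e.
by move=> A mA _; case: markovP => _ h _; exact: h.
Qed.

End markov_semigroup.

Section lyapunov.
Context {R : realType} {d : measure_display} {E : measurableType d}.
Variables (P : R -> E -> probability E R) (V : E -> R) (gamma K : R).
Hypothesis markovP : markov_tf P.
Hypotheses (mV : measurable_fun setT V) (V0 : forall x, 0 <= V x).
Hypotheses (gamma0 : 0 < gamma) (K0 : 0 < K).
Implicit Types t s h : R.
Hypothesis lyap : forall t x, 0 <= t ->
  (\int[P t x]_y (V y)%:E
   + gamma%:E * \int[lebesgue_measure]_(s in `[0%R, t]%classic) \int[P s x]_y (V y)%:E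
   <= (V x + K * t)%:E)%E.

Let v t x : \bar R := (\int[P t x]_y (V y)%:E)%E.

Let v0 t x : (0 <= v t x)%E.
Proof. by apply: integral_ge0 => y _; rewrite lee_fin. Qed.

Let mVE : measurable_fun setT (fun x => (V x)%:E).
Proof. exact/measurable_EFinP. Qed.

Lemma lyapunov_le t x : 0 <= t -> (v t x <= (V x + K * t)%:E)%E.
Proof.
move=> t0; apply: le_trans (lyap x t0); rewrite leeDl// mule_ge0//.
  by rewrite lee_fin ltW.
by apply: integral_ge0 => s _; exact: v0.
Qed.

Lemma integral_affine (mu : probability E R) (a b : R) : 0 <= a -> 0 <= b ->
  (\int[mu]_y (a * V y + b)%:E = a%:E * \int[mu]_y (V y)%:E + b%:E)%E.
Proof.
move=> a0 b0; under eq_integral do rewrite EFinD.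
rewrite ge0_integralD//; last 2 first.
- by move=> y _; rewrite lee_fin mulr_ge0.
- by apply/measurable_EFinP; exact: measurable_funM.
under eq_integral do rewrite EFinM.
rewrite ge0_integralZl_EFin//; last by move=> y _; rewrite lee_fin.
congr (_ + _)%E; rewrite integral_cst// -[RHS]mule1; congr (_ * _)%E.
exact: probability_setT.
Qed.

Lemma markov_affine s t x (a b : R) : 0 <= s -> 0 <= t -> 0 <= a -> 0 <= b ->
  (forall y, (v t y <= (a * V y + b)%:E)%E) ->
  (v (s + t) x <= a%:E * v s x + b%:E)%E.
Proof.
move=> s0 t0 a0 b0 h; rewrite /v chapman_kolmogorov//.
rewrite -integral_affine//; apply: ge0_le_integral => //.
- by move=> y _; exact: v0.
- by apply: measurable_markov_integral => // y; rewrite lee_fin.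
- by apply/measurable_EFinP; apply: measurable_funD => //; exact: measurable_funM.
- by move=> y _; exact: h.
Qed.

(* t |-> P_t V decreases at most at rate K backwards in time, so P_s V is at
   least P_t V - K t on [0, t]. *)
Lemma lyapunov_step t x : 0 <= t ->
  (v t x <= ((1 + gamma * t)^-1 * V x + K * t)%:E)%E.
Proof.
move=> t0; have gt0 : 0 < 1 + gamma * t by have := mulr_ge0 (ltW gamma0) t0; lra.
have vfin : v t x \is a fin_num.
  by rewrite ge0_fin_numE// (le_lt_trans (lyapunov_le x t0))// ltry.
pose w := fine (v t x); have wE : v t x = w%:E by rewrite fineK.
(* The lower bound for P_s V on [0, t]; the maximum with 0 keeps it nonnegative, as
   [integral_ge_cst] requires. *)
pose c := Num.max 0 (w - K * t).
have c0 : 0 <= c by rewrite le_max lexx.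
have low s : s \in `[0, t] -> (c%:E <= v s x)%E.
  rewrite in_itv/= => /andP[s0 st]; rewrite /c EFin_max ge_max v0/= EFinB leeBlDr//.
  rewrite -wE; have ts0 : 0 <= t - s by rewrite subr_ge0.
  have := @markov_affine s (t - s) x 1 (K * (t - s)) s0 ts0 ler01 (mulr_ge0 (ltW K0) ts0).
  rewrite subrKC mul1e => /(_ _)/le_trans; apply.
    by move=> y; rewrite mul1r; exact: lyapunov_le.
  by rewrite leeD2l// lee_fin ler_pM2l// gerBl.
have := lyap x t0; rewrite -/(v t x) wE lee_fin.
have int_low : ((c * t)%:E <= \int[lebesgue_measure]_(s in `[0%R, t]%classic) v s x)%E.
  have lm : lebesgue_measure (`[0%R, t]%classic : set R) = t%:E.
    rewrite lebesgue_measure_itv/= lte_fin; case: ltP => [_|t0'].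
      by rewrite -EFinB subr0.
    by congr EFin; apply/eqP; rewrite eq_le t0 t0'.
  by rewrite EFinM -lm; apply: integral_ge_cst.
move=> h.
have : (w%:E + gamma%:E * (c * t)%:E <= (V x + K * t)%:E)%E.
  apply: le_trans h; rewrite leeD2l// lee_pmul2l// lte_fin.
rewrite -EFinM -EFinD lee_fin => {}h.
have cw : w - K * t <= c by rewrite le_max lexx orbT.
have : w * (1 + gamma * t) <= V x + K * t * (1 + gamma * t).
  have : gamma * ((w - K * t) * t) <= gamma * (c * t).
    by rewrite ler_pM2l// ler_wpM2r.
  lra.
by rewrite -ler_pdivlMr// mulrDl mulfK ?gt_eqF// mulrC.
Qed.

(** For h > 0, K / gamma * (1 + gamma h) is the fixed point of z |-> q z + K h, q = (1 + gamma
    h)^-1, the affine map of one step. *)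
Lemma lyapunov_iter h n x : 0 <= h ->
  (v (n%:R * h) x <= ((1 + gamma * h)^-1 ^+ n * V x + K / gamma * (1 + gamma * h))%:E)%E.
Proof.
move=> h0; have gh0 := mulr_ge0 (ltW gamma0) h0.
set q := (1 + gamma * h)^-1.
have q0 : 0 <= q by rewrite invr_ge0; lra.
have C0 : 0 <= K / gamma * (1 + gamma * h).
  by rewrite mulr_ge0 ?divr_ge0 ?(ltW K0) ?(ltW gamma0)//; lra.
elim: n => [|n IH].
  rewrite mul0r /v markov0//.
  by rewrite expr0 mul1r lee_fin lerDl.
rewrite -natr1 mulrDl mul1r.
have := @markov_affine (n%:R * h) h x q (K * h) (mulr_ge0 (ler0n _ _) h0) h0 q0
  (mulr_ge0 (ltW K0) h0) (fun y => lyapunov_step y h0).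
move/le_trans; apply.
apply: (@le_trans _ _ (q%:E * (q ^+ n * V x + K / gamma * (1 + gamma * h))%:E + (K * h)%:E)%E).
  by rewrite leeD2r// lee_wpmul2l// lee_fin.
rewrite -EFinM -EFinD lee_fin mulrDr mulrA -exprS -addrA lerD2l.
rewrite le_eqVlt; apply/orP; left; apply/eqP; rewrite /q; field.
by rewrite gt_eqF//= gt_eqF//; lra.
Qed.

Let C := 5 / 4 * (K / gamma).

Let small_step t : 0 <= t -> exists m : nat, (0 < m)%N /\ gamma * (t / m%:R) <= 1 / 4.
Proof.
move=> t0; exists (Num.truncn (4 * gamma * t)).+1; split=> //.
have gt0 : 0 <= 4 * gamma * t by rewrite !mulr_ge0// ltW.
have := truncnS_gt (4 * gamma * t); set m := (Num.truncn _).+1%:R => hm.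
by rewrite mulrA ler_pdivrMr ?ltr0n//; lra.
Qed.

Let CE h : 0 <= h -> gamma * h <= 1 / 4 -> K / gamma * (1 + gamma * h) <= C.
Proof.
move=> h0 hg; rewrite /C mulrC ler_wpM2r//; last by lra.
by rewrite divr_ge0// ltW.
Qed.

(** Cutting t into steps h with gamma h <= 1/4 keeps the additive constant below 5/4 * (K / gamma),
    uniformly in t. *)
Lemma lyapunov_bound t x : 0 <= t -> (v t x <= (V x + 5 / 4 * (K / gamma))%:E)%E.
Proof.
move=> t0; have [m [m0 gm]] := small_step t0.
have h0 : 0 <= t / m%:R by rewrite divr_ge0.
have mE : t = m%:R * (t / m%:R) by rewrite mulrC divfK// pnatr_eq0 -lt0n.
rewrite {1}mE; apply: (le_trans (lyapunov_iter m x h0)); rewrite lee_fin.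
apply: lerD; last exact: CE.
have gh0 := mulr_ge0 (ltW gamma0) h0.
rewrite ler_piMl// exprn_ile1//; first by rewrite invr_ge0; lra.
by rewrite invf_le1; lra.
Qed.

(** The substep t / m is chosen once, so a single k0 serves all x and all larger multiples of t. *)
Lemma lyapunov_contraction t : 0 < t -> exists k0, forall k x, (k0 <= k)%N ->
  (v (k%:R * t) x <= (1 / 4 * V x + 5 / 4 * (K / gamma))%:E)%E.
Proof.
move=> t0; have [m [m0 gm]] := small_step (ltW t0).
have h0 : 0 < t / m%:R by rewrite divr_gt0// ltr0n.
have gh0 := mulr_gt0 gamma0 h0.
set q := (1 + gamma * (t / m%:R))^-1.
have q0 : 0 < q by rewrite invr_gt0; lra.
have q1 : q < 1 by rewrite invf_lt1; lra.
have [k0 _ hk] : \forall k \near \oo, q ^+ k <= 1 / 4.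
  have /cvgrPdist_le/(_ (1 / 4)) : q ^+ k @[k --> \oo] --> 0.
    by apply: cvg_expr; rewrite gtr0_norm.
  move=> /(_ ltac:(lra)); apply: filterS => k.
  by rewrite sub0r normrN ger0_norm// exprn_ge0// ltW.
exists k0 => k x kk0.
have -> : k%:R * t = (k * m)%:R * (t / m%:R).
  by rewrite natrM -mulrA [m%:R * _]mulrC divfK// pnatr_eq0 -lt0n.
apply: (le_trans (lyapunov_iter _ x (ltW h0))); rewrite lee_fin.
apply: lerD; last by apply: CE => //; exact: ltW.
rewrite ler_wpM2r// -/q; apply: le_trans (hk k kk0).
by apply: ler_wiXn2l; [exact: ltW|exact: ltW|exact: leq_pmulr].
Qed.

End lyapunov.

(** * Weighted cost *)

Section powR_lemmas.
Variable R : realType.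
Implicit Types a b A B delta : R.

Lemma powR_young a b delta : 0 < delta < 1 -> 0 <= a -> 0 <= b ->
  a `^ (1 - delta) * b `^ delta <= (1 - delta) * a + delta * b.
Proof.
move=> /andP[d0 d1] a0 b0; have d1' : 0 < 1 - delta by rewrite subr_gt0.
have p0 : 0 < (1 - delta)^-1 by rewrite invr_gt0.
have q0 : 0 < delta^-1 by rewrite invr_gt0.
have /(_ _)/le_trans := conjugate_powR (powR_ge0 a (1 - delta)) (powR_ge0 b delta) p0 q0.
rewrite !invrK subrK => /(_ _ erefl); apply.
rewrite -!powRrM !divff ?gt_eqF// !powRr1//.
by rewrite [_ * (1 - delta)]mulrC [_ * delta]mulrC.
Qed.

Lemma le_powR a b r : 0 <= r -> 0 <= a -> a <= b -> a `^ r <= b `^ r.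
Proof.
by move=> r0 a0 ab; apply: ge0_ler_powR => //; rewrite nnegrE// (le_trans a0).
Qed.

(* Young's inequality at the normalised values a / A and b / B; integrating it
   plays the role of Hoelder's inequality. *)
Lemma powR_young_scaled a b A B delta : 0 < delta < 1 -> 0 <= a -> 0 <= b ->
  0 < A -> 0 < B ->
  a `^ (1 - delta) * b `^ delta <=
  A `^ (1 - delta) * B `^ delta * ((1 - delta) / A * a + delta / B * b).
Proof.
move=> d01 a0 b0 A0 B0.
have aA : 0 <= a / A by rewrite divr_ge0// ltW.
have bB : 0 <= b / B by rewrite divr_ge0// ltW.
have -> : a `^ (1 - delta) * b `^ delta =
    A `^ (1 - delta) * B `^ delta * ((a / A) `^ (1 - delta) * (b / B) `^ delta).
  rewrite -{1}(divfK (lt0r_neq0 A0) a) -{1}(divfK (lt0r_neq0 B0) b).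
  by rewrite (powRM _ aA (ltW A0)) (powRM _ bB (ltW B0)); ring.
rewrite ler_wpM2l ?mulr_ge0 ?powR_ge0//.
apply: le_trans (powR_young d01 aA bB) _.
by rewrite le_eqVlt; apply/orP; left; apply/eqP; ring.
Qed.

End powR_lemmas.

Section coupling_integrals.
Context {R : realType} {d : measure_display} {E : measurableType d}.
Variables (mu nu : probability E R) (m : probability (E * E)%type R).
Hypothesis cm : coupling mu nu m.

Lemma coupling_integral1 (f : E -> \bar R) : measurable_fun setT f ->
  (forall x, (0 <= f x)%E) -> (\int[m]_z f z.1 = \int[mu]_x f x)%E.
Proof.
move=> mf f0.
have mfst : measurable_fun setT (fst : E * E -> E) by exact: measurable_fst.
have := @ge0_integral_pushforward _ _ _ _ R _ mfst m setT f measurableT mf.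
rewrite preimage_setT => <- //.
apply: eq_measure_integral => A mA _.
by transitivity (m (A `*` setT)); [rewrite setXT|exact: cm.1].
Qed.

Lemma coupling_integral2 (f : E -> \bar R) : measurable_fun setT f ->
  (forall x, (0 <= f x)%E) -> (\int[m]_z f z.2 = \int[nu]_x f x)%E.
Proof.
move=> mf f0.
have msnd : measurable_fun setT (snd : E * E -> E) by exact: measurable_snd.
have := @ge0_integral_pushforward _ _ _ _ R _ msnd m setT f measurableT mf.
rewrite preimage_setT => <- //.
apply: eq_measure_integral => A mA _.
by transitivity (m (setT `*` A)); [rewrite setTX|exact: cm.2].
Qed.

Lemma coupling_dist (f : E -> R) (h : E * E -> R) (M : R) :
  measurable_fun setT f -> (forall x, 0 <= f x <= 1) ->
  measurable_fun setT h -> (forall z, `|f z.1 - f z.2| <= h z) ->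
  (\int[m]_z (h z)%:E <= M%:E)%E ->
  `|\int[mu]_x f x - \int[nu]_x f x| <= M.
Proof.
move=> mf f01 mh fh hM.
have f0 x : (0 <= (f x)%:E)%E by rewrite lee_fin; case/andP: (f01 x).
have mfE : measurable_fun setT (EFin \o f) by exact/measurable_EFinP.
rewrite /Rintegral -(coupling_integral1 mfE f0) -(coupling_integral2 mfE f0).
apply: (le_Rintegral_dist (mu := m) (f := fun z => f z.1) (g := fun z => f z.2) _ _ mh) => //.
- by apply: prob_integrable01 => //; exact: measurableT_comp.
- by apply: prob_integrable01 => //; exact: measurableT_comp.
Qed.

End coupling_integrals.

Lemma coupling_product (R : realType) (d : measure_display) (E : measurableType d)
    (mu nu : probability E R) : coupling mu nu ((mu \x nu)%E : probability (E * E)%type R).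
Proof.
split=> A mA.
- transitivity (mu A * nu setT)%E; first exact: product_measure1E.
  by rewrite -[RHS]mule1; congr (_ * _)%E; exact: probability_setT.
- transitivity (mu setT * nu A)%E; first exact: product_measure1E.
  by rewrite -[RHS]mul1e; congr (_ * _)%E; exact: probability_setT.
Qed.

Section weighted_cost.
Context {R : realType} {d : measure_display} {E : measurableType d}.
Variables (V : E -> R) (c : E -> E -> R) (b delta : R).
Hypotheses (mV : measurable_fun setT V) (V0 : forall x, 0 <= V x).
Hypotheses (mc : measurable_fun setT (fun z : E * E => c z.1 z.2)).
Hypotheses (c01 : forall x y, 0 <= c x y <= 1).
Hypotheses (b0 : 0 <= b) (delta01 : 0 < delta < 1).

Definition wcost x y : R := c x y `^ (1 - delta) * (1 + b * (V x + V y)) `^ delta.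

Definition wlip (a : R) (f : E -> R) := [/\ measurable_fun setT f,
  forall x, 0 <= f x <= 1 & forall x y, `|f x - f y| <= a * wcost x y].

Lemma measurable_wcost : measurable_fun setT (fun z : E * E => wcost z.1 z.2).
Proof.
apply: measurable_funM.
  exact: (measurableT_comp (measurable_powR _) mc).
apply: (measurableT_comp (measurable_powR _)).
apply: measurable_funD => //; apply: measurable_funM => //.
by apply: measurable_funD; apply: measurableT_comp.
Qed.

Lemma wcost_ge0 x y : 0 <= wcost x y.
Proof. by rewrite mulr_ge0 ?powR_ge0. Qed.

Variables (mu nu : probability E R) (vx vy : R).
Hypotheses (mux : (\int[mu]_x (V x)%:E <= vx%:E)%E).
Hypotheses (nuy : (\int[nu]_x (V x)%:E <= vy%:E)%E).

Let vx0 : 0 <= vx.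
Proof.
rewrite -lee_fin; apply: le_trans mux; apply: integral_ge0 => x _.
by rewrite lee_fin.
Qed.

Let vy0 : 0 <= vy.
Proof.
rewrite -lee_fin; apply: le_trans nuy; apply: integral_ge0 => x _.
by rewrite lee_fin.
Qed.

Lemma integral_wcost (m : probability (E * E)%type R) (A : R) : coupling mu nu m ->
  0 < A -> (\int[m]_z (c z.1 z.2)%:E <= A%:E)%E ->
  (\int[m]_z (wcost z.1 z.2)%:E <=
   (A `^ (1 - delta) * (1 + b * (vx + vy)) `^ delta)%:E)%E.
Proof.
move=> cm A0 cA; have /andP[d0 d1] := delta01.
set B := 1 + b * (vx + vy).
have B0 : 0 < B by have := mulr_ge0 b0 (addr_ge0 vx0 vy0); rewrite /B; lra.
set S := A `^ (1 - delta) * B `^ delta.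
have S0 : 0 <= S by rewrite mulr_ge0 ?powR_ge0.
(* Coefficients of the scaled Young inequality at A and B, normalised by k1 A + k2 B = S. The bound
   is linear in c, V z.1 and V z.2, so apart from E c only the marginals of m matter. *)
pose k1 := S * ((1 - delta) / A); pose k2 := S * (delta / B).
have k10 : 0 <= k1 by rewrite mulr_ge0// divr_ge0//; lra.
have k20 : 0 <= k2 by rewrite mulr_ge0// divr_ge0//; lra.
have kE : k1 * A + k2 * B = S.
  by rewrite /k1 /k2; field; rewrite !gt_eqF.
pose g1 (z : E * E) := (k1 * c z.1 z.2)%:E.
pose g2 (z : E * E) := (k2 + k2 * b * V z.1)%:E.
pose g3 (z : E * E) := (k2 * b * V z.2)%:E.
have k2b : 0 <= k2 * b by rewrite mulr_ge0.
have mV1 : measurable_fun setT (fun z : E * E => V z.1) by exact: measurableT_comp.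
have mV2 : measurable_fun setT (fun z : E * E => V z.2) by exact: measurableT_comp.
have mg1 : measurable_fun setT g1.
  by apply/measurable_EFinP; exact: measurable_funM.
have mg2 : measurable_fun setT g2.
  by apply/measurable_EFinP; apply: measurable_funD => //; exact: measurable_funM.
have mg3 : measurable_fun setT g3.
  by apply/measurable_EFinP; exact: measurable_funM.
have g10 z : (0 <= g1 z)%E.
  by rewrite lee_fin mulr_ge0//; case/andP: (c01 z.1 z.2).
have g20 z : (0 <= g2 z)%E by rewrite lee_fin addr_ge0// mulr_ge0.
have g30 z : (0 <= g3 z)%E by rewrite lee_fin mulr_ge0.
apply: (@le_trans _ _ (\int[m]_z (g1 z + (g2 z + g3 z)))%E).
  apply: ge0_le_integral => //.
  - by move=> z _; rewrite lee_fin wcost_ge0.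
  - by apply/measurable_EFinP; exact: measurable_wcost.
  - by apply: emeasurable_funD => //; exact: emeasurable_funD.
  - move=> z _; rewrite /g1 /g2 /g3 -!EFinD lee_fin /wcost.
    have cz0 : 0 <= c z.1 z.2 by case/andP: (c01 z.1 z.2).
    have w0 : 0 <= 1 + b * (V z.1 + V z.2).
      by have := mulr_ge0 b0 (addr_ge0 (V0 z.1) (V0 z.2)); lra.
    apply: le_trans (powR_young_scaled delta01 cz0 w0 A0 B0) _.
    by rewrite -/S le_eqVlt; apply/orP; left; apply/eqP; rewrite /k1 /k2; ring.
rewrite ge0_integralD//; last 2 first.
- by move=> z _; rewrite adde_ge0.
- exact: emeasurable_funD.
rewrite ge0_integralD//.
have i1 : (\int[m]_z g1 z <= (k1 * A)%:E)%E.
  rewrite /g1; under eq_integral do rewrite EFinM.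
  rewrite ge0_integralZl_EFin//; last 2 first.
  - by move=> z _; rewrite lee_fin; case/andP: (c01 z.1 z.2).
  - exact/measurable_EFinP.
  by rewrite (EFinM k1 A) lee_wpmul2l// lee_fin.
have i2 : (\int[m]_z g2 z <= (k2 + k2 * b * vx)%:E)%E.
  rewrite /g2 (coupling_integral1 cm (f := fun x => (k2 + k2 * b * V x)%:E)).
  - under eq_integral do rewrite addrC.
    by rewrite integral_affine// addeC (EFinD k2) (EFinM _ vx) leeD2l// lee_wpmul2l.
  - by apply/measurable_EFinP; apply: measurable_funD => //; exact: measurable_funM.
  - by move=> x; rewrite lee_fin addr_ge0// mulr_ge0.
have i3 : (\int[m]_z g3 z <= (k2 * b * vy)%:E)%E.
  rewrite /g3 (coupling_integral2 cm (f := fun x => (k2 * b * V x)%:E)).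
  - under eq_integral do rewrite -[_ * _]addr0.
    by rewrite integral_affine// adde0 (EFinM _ vy) lee_wpmul2l.
  - by apply/measurable_EFinP; exact: measurable_funM.
  - by move=> x; rewrite lee_fin mulr_ge0.
apply: le_trans (leeD i1 (leeD i2 i3)) _.
by rewrite -!EFinD lee_fin -kE /B le_eqVlt; apply/orP; left; apply/eqP; ring.
Qed.

Lemma wlip_coupling (m : probability (E * E)%type R) (A a : R) f :
  coupling mu nu m -> 0 < A -> (\int[m]_z (c z.1 z.2)%:E <= A%:E)%E ->
  0 <= a -> wlip a f ->
  `|\int[mu]_x f x - \int[nu]_x f x| <=
  a * (A `^ (1 - delta) * (1 + b * (vx + vy)) `^ delta).
Proof.
move=> cm A0 cA a0 [mf f01 fl].
apply: (coupling_dist cm (h := fun z => a * wcost z.1 z.2)) => //.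
  by apply: measurable_funM => //; exact: measurable_wcost.
under eq_integral do rewrite EFinM.
rewrite ge0_integralZl_EFin//; last 2 first.
- by move=> z _; rewrite lee_fin wcost_ge0.
- by apply/measurable_EFinP; exact: measurable_wcost.
by rewrite (EFinM a) lee_wpmul2l ?lee_fin//; exact: integral_wcost.
Qed.

(** The independent coupling with the trivial bound c <= 1: the estimate depends on the two laws
    through V alone. *)
Lemma wlip_product (a : R) f : 0 <= a -> wlip a f ->
  `|\int[mu]_x f x - \int[nu]_x f x| <= a * (1 + b * (vx + vy)) `^ delta.
Proof.
move=> a0 fl.
have := wlip_coupling (coupling_product mu nu) ltr01 _ a0 fl.
rewrite powR1 mul1r; apply.
have : (\int[mu \x nu]_z (c z.1 z.2)%:E <= \int[mu \x nu]_z (cst 1%E z))%E.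
  apply: ge0_le_integral => //.
  - by move=> z _; rewrite lee_fin; case/andP: (c01 z.1 z.2).
  - exact/measurable_EFinP.
  - by move=> z _; rewrite lee_fin; case/andP: (c01 z.1 z.2).
move=> /le_trans; apply; rewrite integral_cst// mul1e.
exact: (probability_le1 (mu \x nu)%E).
Qed.

End weighted_cost.

(** * Contraction of the semigroup *)

Section semigroup_functions.
Context {R : realType} {d : measure_display} {E : measurableType d}.
Variable P : R -> E -> probability E R.
Hypothesis markovP : markov_tf P.
Implicit Types (t s : R) (f : E -> R).

Lemma Psg01 t f : 0 <= t -> measurable_fun setT f -> (forall x, 0 <= f x <= 1) ->
  measurable_fun setT (Psg P t f) /\ (forall x, 0 <= Psg P t f x <= 1).
Proof.
move=> t0 mf f01; split; last by move=> x; exact: Rintegral01.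
apply: measurableT_comp => //; apply: measurable_markov_integral => //.
  exact/measurable_EFinP.
by move=> x; rewrite lee_fin; case/andP: (f01 x).
Qed.

Lemma PsgE t f x : measurable_fun setT f -> (forall x, 0 <= f x <= 1) ->
  (Psg P t f x)%:E = (\int[P t x]_y (f y)%:E)%E.
Proof. by move=> mf f01; apply: RintegralE; exact: prob_integrable01. Qed.

Lemma PsgD s t f x : 0 <= s -> 0 <= t -> measurable_fun setT f ->
  (forall x, 0 <= f x <= 1) -> Psg P (s + t) f x = Psg P s (Psg P t f) x.
Proof.
move=> s0 t0 mf f01; rewrite /Psg chapman_kolmogorov//.
- by congr fine; apply: eq_integral => y _; rewrite -PsgE.
- exact/measurable_EFinP.
- by move=> y; rewrite lee_fin; case/andP: (f01 y).
Qed.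

Lemma Psg0 f : measurable_fun setT f -> (forall x, 0 <= f x <= 1) -> Psg P 0 f = f.
Proof.
move=> mf f01; apply/funext => x; rewrite /Psg markov0//.
- exact/measurable_EFinP.
- by move=> y; rewrite lee_fin; case/andP: (f01 y).
Qed.

Lemma law_marginal (dO : measure_display) (O : measurableType dO)
    (Pr : probability O R) (X : R -> O -> E) x t A :
  law_is_Px Pr X P x -> 0 <= t -> measurable A -> Pr (X t @^-1` A) = P t x A.
Proof.
move=> [_ h] t0 mA; have := h [:: (t, A)].
rewrite /= t0 => /(_ isT) /(_ _); rewrite add0r.
have -> : (\int[P t x]_(y in A) 1 = P t x A)%E.
  rewrite (_ : (fun=> 1%E) = cst 1%E)//; rewrite integral_cst//; exact: mul1e.
move=> <-; last by move=> p; rewrite inE => /eqP ->.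
congr (Pr _); apply/seteqP; split=> w /=; last by case.
by move=> Xw; split.
Qed.

(** The law of (X_t, Y_t) couples P_t(x, .) with the law of Y_t; gluing corrects the second marginal
    to P_t(y, .) at the price tau, because the truncated cost is at most 1. *)
Lemma generalized_coupling (theta : E -> E -> R) x y t (N rr tau : R)
    (dO : measure_display) (O : measurableType dO) (Pr : probability O R)
    (X Y : R -> O -> E) :
  measurable_fun setT (fun z : E * E => theta z.1 z.2) ->
  (forall x y, 0 <= theta x y) -> 0 <= t -> 0 <= N ->
  law_is_Px Pr X P x -> measurable_fun setT (Y t) ->
  (dTV (pushforward Pr (Y t)) (P t y) <= tau%:E)%E ->
  (\int[Pr]_w (theta (X t w) (Y t w))%:E <= rr%:E)%E ->
  exists m : probability (E * E)%type R, coupling (P t x) (P t y) m /\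
    (\int[m]_z (Num.min (N * theta z.1 z.2) 1)%:E <= (N * rr + tau)%:E)%E.
Proof.
move=> mth th0 t0 N0 lawX mY tv thr.
have mX : measurable_fun setT (X t) by exact: lawX.1.
have [nu [nuE _]] := prob_law Pr mY.
have mZ : measurable_fun setT (fun w => (X t w, Y t w)) by exact: measurable_fun_pair.
have [Q [QE Qint]] := prob_law Pr mZ.
have cQ : coupling (P t x) nu Q.
  split=> A mA; rewrite QE.
    rewrite -(law_marginal lawX)//; congr (Pr _); apply/seteqP.
    by split=> w /=; [case|].
  by rewrite nuE; congr (Pr _); apply/seteqP; split=> w /=; [case|].
have tvA A : measurable A -> (`|nu A - P t y A| <= tau%:E)%E.
  move=> mA; rewrite nuE; apply: le_trans tv; apply: ereal_sup_ubound.
  by exists A.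
have [m [cm mh]] := glue_coupling cQ tvA.
exists m; split=> //.
pose h (z : E * E) := Num.min (N * theta z.1 z.2) 1.
have mNth : measurable_fun setT (fun z : E * E => N * theta z.1 z.2).
  exact: measurable_funM.
have mhh : measurable_fun setT h by exact: measurable_minr.
have h01 z : 0 <= h z <= 1.
  by rewrite /h le_min ge_min lexx orbT mulr_ge0//= ler01.
apply: (le_trans (mh h mhh h01)); rewrite EFinD leeD2r//.
have h0 z : (0 <= (h z)%:E)%E by rewrite lee_fin; case/andP: (h01 z).
rewrite Qint//; last exact/measurable_EFinP.
have mthZ : measurable_fun setT (fun w => theta (X t w) (Y t w)).
  exact: (measurableT_comp mth mZ).
apply: (@le_trans _ _ (\int[Pr]_w (N%:E * (theta (X t w) (Y t w))%:E))%E).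
  apply: ge0_le_integral => //.
  - by apply/measurable_EFinP; exact: (measurableT_comp mhh mZ).
  - by apply/measurable_EFinP; apply: measurable_funM.
  - by move=> w _; rewrite -EFinM lee_fin /h/= ge_min lexx.
rewrite ge0_integralZl_EFin//; last 2 first.
- by move=> w _; rewrite lee_fin.
- exact/measurable_EFinP.
by rewrite EFinM lee_wpmul2l// lee_fin.
Qed.

End semigroup_functions.

Lemma powR_le1 (R : realType) (a r : R) : 0 <= r -> 0 <= a -> a <= 1 -> a `^ r <= 1.
Proof.
by move=> r0 a0 a1; apply: le_trans (le_powR r0 a0 a1) _; rewrite powR1.
Qed.

Lemma cvg0_eventually_le (R : realType) (h : R -> R) (e : R) :
  h t @[t --> +oo] --> 0 -> 0 < e -> exists M, 0 <= M /\ forall t, M < t -> h t <= e.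
Proof.
move=> /cvgrPdist_le hc e0; have [M [_ hM]] := hc e e0.
exists (Num.max M 0); split=> [|t]; first by rewrite le_max lexx orbT.
rewrite gt_max => /andP[Mt _]; have := hM t Mt; rewrite sub0r normrN.
by apply: le_trans; exact: ler_norm.
Qed.

Section contraction.
Context {R : realType} {d : measure_display} {E : measurableType d}.
Variables (rho : E -> E -> R) (P : R -> E -> probability E R).
Variables (V : E -> R) (gamma K : R) (theta : E -> E -> R) (r L Rf : R -> R).
Variables (eps delta : R).
Hypotheses (polish_rho : polish rho) (markovP : markov_tf P).
Hypotheses (mV : measurable_fun setT V) (V0 : forall x, 0 <= V x).
Hypotheses (gamma0 : 0 < gamma) (K0 : 0 < K).
Hypothesis lyap : forall t x, 0 <= t ->
  (\int[P t x]_y (V y)%:E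
   + gamma%:E * \int[lebesgue_measure]_(s in `[0%R, t]%classic) \int[P s x]_y (V y)%:E
   <= (V x + K * t)%:E)%E.
Hypothesis premetric_theta : premetric rho theta.
Hypothesis asA : assumptionA P theta r L.
Hypothesis asB : assumptionB2 P theta [set x | V x <= 4 * K / gamma] Rf eps.
Hypothesis delta01 : 0 < delta < 1.

Definition drift_const := 5 / 4 * (K / gamma).

Local Notation C := drift_const.

Lemma drift_const_gt0 : 0 < C.
Proof. by rewrite mulr_gt0 ?divr_gt0//; lra. Qed.

Let C0 := drift_const_gt0.

Let th0 x y : 0 <= theta x y. Proof. by case: premetric_theta. Qed.

Let mth : measurable_fun setT (fun z : E * E => theta z.1 z.2).
Proof. by apply: (measurable_lsc2 polish_rho); case: premetric_theta. Qed.

Definition tcost (N : R) x y := Num.min (N * theta x y) 1.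

Let mcN N : measurable_fun setT (fun z : E * E => tcost N z.1 z.2).
Proof. by apply: measurable_minr => //; exact: measurable_funM. Qed.

Let cN01 N x y : 0 <= N -> 0 <= tcost N x y <= 1.
Proof. by move=> N0; rewrite /tcost le_min ge_min lexx orbT mulr_ge0//= ler01. Qed.

Let Vbound t x : 0 <= t -> (\int[P t x]_y (V y)%:E <= (V x + C)%:E)%E.
Proof. by move=> t0; exact: (lyapunov_bound markovP). Qed.

(** With sig = eta^((1 - delta) / 2) the gain eta^(1 - delta) is sig^2. One factor sig pays for the
    k growth factors, through 1 + 2 b C = w with w^k = 1 / sig; the other remains. *)
Let small_weight (k : nat) (eta : R) : (0 < k)%N -> 0 < eta < 1 ->
  exists b sig : R, [/\ 0 < b, 0 < sig < 1 &
    ((1 + 2 * b * C) `^ delta) ^+ k * eta `^ (1 - delta) <= sig].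
Proof.
move=> k0 /andP[e0 e1]; have /andP[d0 d1] := delta01.
set sig := eta `^ ((1 - delta) / 2).
have s0 : 0 < sig by exact: powR_gt0.
have s1 : sig < 1.
  have -> : 1 = 1 `^ ((1 - delta) / 2) :> R by rewrite powR1.
  by apply: gt0_ltr_powR; rewrite ?nnegrE//; lra.
have w1 : 1 < sig^-1 by rewrite invf_gt1.
set w := sig^-1 `^ (k%:R^-1).
have w1' : 1 < w.
  have -> : 1 = 1 `^ (k%:R^-1) :> R by rewrite powR1.
  by apply: gt0_ltr_powR; rewrite ?nnegrE ?invr_gt0 ?ltr0n//; lra.
have wk : w ^+ k = sig^-1.
  rewrite -powR_mulrn; last by lra.
  rewrite -powRrM mulVf ?powRr1//; first by lra.
  by rewrite pnatr_eq0 -lt0n.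
have C20 : 0 < 2 * C by rewrite pmulr_rgt0.
have w0 : 0 < w - 1 by rewrite subr_gt0.
exists ((w - 1) / (2 * C)), sig; split; first exact: divr_gt0.
  by rewrite s0 s1.
have -> : 1 + 2 * ((w - 1) / (2 * C)) * C = w by field; rewrite gt_eqF.
apply: (@le_trans _ _ (w ^+ k * (sig * sig))).
  rewrite -powRD; last by apply/implyP => _; rewrite gt_eqF.
  rewrite (_ : (1 - delta) / 2 + (1 - delta) / 2 = 1 - delta); last by field.
  have w_ge0 : 0 <= w by lra.
  apply: ler_wpM2r; first exact: powR_ge0.
  apply: lerXn2r; [by rewrite nnegrE powR_ge0|by rewrite nnegrE|].
  by apply: ler1_powR; lra.
by rewrite wk mulrA mulVf ?mul1r// gt_eqF.
Qed.

(** For u = b (V x + V y) and w = b S0: the ratio (1 + u / 4 + 5 w / 8) / (1 + u) decreases in u, so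
    it is largest at u = w. *)
Let far_arith (u w : R) : 0 < w -> w <= u ->
  (1 + 1 / 4 * u + 5 / 8 * w) * (1 + w) <= (1 + 7 / 8 * w) * (1 + u).
Proof.
move=> w0 wu; rewrite -subr_ge0.
rewrite (_ : _ - _ = 3 / 4 * (u - w) + 5 / 8 * (w * (u - w))); last by field.
have h : 0 <= w * (u - w) by rewrite mulr_ge0 ?subr_ge0// ltW.
by lra.
Qed.

Lemma Psg_contraction : exists T N b al : R, [/\ 0 < T, 1 <= N, 0 < b, 0 < al < 1 &
  forall (a : R) f, 0 <= a -> wlip V (tcost N) b delta a f ->
    wlip V (tcost N) b delta (al * a) (Psg P T f)].
Proof.
have /andP[d0 d1] := delta01.
have [r0 r_dec r_cvg [L0 _] coupA] := asA.
have [Rf0 _ Rf_cvg eps0 coupB] := asB.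
have [T1 [T10 rT1]] : exists T1, 0 < T1 /\ r T1 <= 1 / 4.
  have [M1 [M10 rM1]] := @cvg0_eventually_le R r (1 / 4) r_cvg ltac:(lra).
  by exists (M1 + 1); split; [lra|apply: rM1; lra].
have LT1 : 0 <= L T1 by apply: L0; exact: ltW.
(* The transported cost N r T1 theta and the defect L T1 theta are each at most a quarter of N
   theta, so A halves the cost at time T1. *)
have [N [N1 N0 NL]] : exists N, [/\ 1 <= N, 0 < N & L T1 <= N / 4].
  by exists (1 + 4 * L T1); split; lra.
have [e1 [e10 e11 e1eps]] : exists e1, [/\ 0 < e1, e1 <= 1 & e1 <= eps].
  by exists (Num.min eps 1); rewrite lt_min eps0 ltr01 !ge_min !lexx orbT.
have NrL : N * r T1 + L T1 <= 1 / 2 * N by have := ler_wpM2l (ltW N0) rT1; lra.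
have [M2 [M20 RM2]] := @cvg0_eventually_le R Rf (e1 / (2 * N)) Rf_cvg
  ltac:(by rewrite divr_gt0//; lra).
have [k0 Vcontr] := lyapunov_contraction markovP mV V0 gamma0 K0 lyap T10.
(* T = k T1 must pass both the drift time and the time after which N Rf <= e1 / 2. *)
have [k [k_gt0 k0k TM2]] : exists k, [/\ (0 < k)%N, (k0 <= k)%N & M2 < k%:R * T1].
  exists (k0 + Num.truncn (M2 / T1)).+1; split=> //; first by rewrite leqW// leq_addr.
  rewrite -ltr_pdivrMr//; apply: lt_le_trans (truncnS_gt _) _.
  by rewrite ler_nat ltnS leq_addl.
have T0 : 0 < k%:R * T1 by rewrite mulr_gt0// ltr0n.
have VT x := Vcontr k x k0k.
rewrite -/C in VT.
have [T TE] : exists T, T = k%:R * T1 by eexists.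
rewrite -TE in TM2 T0 VT.
(* One bound for both reductions of E c: 1/2 from A, and N Rf T + (1 - eps) <= 1 - e1 / 2 from
   B2. *)
have [eta [eta01 eta1 eta2]] : exists eta : R,
    [/\ 0 < eta < 1, 1 / 2 <= eta & 1 - e1 / 2 <= eta].
  exists (Num.max (1 / 2) (1 - e1 / 2)); rewrite lt_max gt_max !le_max !lexx orbT.
  by split=> //; apply/andP; split; [apply/orP; left|apply/andP; split]; lra.
have NRf : N * Rf T + (1 - eps) <= eta.
  apply: le_trans eta2; have := ler_wpM2l (ltW N0) (RM2 T TM2).
  rewrite (_ : N * (e1 / (2 * N)) = e1 / 2); last by field; rewrite gt_eqF.
  lra.
have /andP[eta0 eta_lt1] := eta01.
have d0' : 0 <= delta by exact: ltW.
have d1' : 0 <= 1 - delta by rewrite subr_ge0 ltW.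
have half0 : 0 <= 1 / 2 :> R by rewrite divr_ge0.
have half_gt0 : 0 < 1 / 2 :> R by rewrite divr_gt0.
have etaP1 : eta `^ (1 - delta) <= 1.
  by apply: powR_le1 => //; exact: ltW.
have halfP : (1 / 2) `^ (1 - delta) <= eta `^ (1 - delta) by exact: le_powR.
have [b [sig [b0 /andP[sig0 sig1] bsig]]] := small_weight k_gt0 eta01.
set g := (1 + 2 * b * C) `^ delta in bsig.
have bC0 : 0 < 2 * b * C by rewrite mulr_gt0// mulr_gt0.
have g1 : 1 <= g.
  have -> : 1 = 1 `^ delta :> R by rewrite powR1.
  by apply: le_powR; [exact: ltW|exact: ler01|rewrite lerDl ltW].
have g0 : 0 <= g by exact: le_trans ler01 g1.
pose S0 := 4 * K / gamma.
have S00 : 0 < S0 by rewrite divr_gt0// mulr_gt0.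
have CS0 : 2 * C = 5 / 8 * S0 by rewrite /drift_const /S0; field; rewrite gt_eqF.
have bS0 : 0 < b * S0 by rewrite mulr_gt0.
(* The ratio of weights after and before time T in the worst case V x + V y = S0. *)
pose q3 := (1 + 7 / 8 * (b * S0)) / (1 + b * S0).
have q30 : 0 < q3 by rewrite divr_gt0// addr_gt0// mulr_gt0.
have q31 : q3 < 1.
  rewrite ltr_pdivrMr ?addr_gt0// mul1r ltrD2l gtr_pMl//.
  by rewrite ltr_pdivrMr// mul1r ltr_nat.
pose al3 := q3 `^ delta.
have al30 : 0 < al3 by exact: powR_gt0.
have al31 : al3 < 1.
  have -> : 1 = 1 `^ delta :> R by rewrite powR1.
  by apply: gt0_ltr_powR; rewrite ?nnegrE// ltW.
pose al := Num.max sig al3.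
have al01 : 0 < al < 1 by rewrite lt_max gt_max sig0 sig1 al31.
have bS_ge0 x y : 0 <= b * (V x + V y) by rewrite mulr_ge0 ?addr_ge0// ltW.
have grow x y : (1 + b * ((V x + C) + (V y + C))) `^ delta <=
    g * (1 + b * (V x + V y)) `^ delta.
  have S_ge0 := bS_ge0 x y.
  rewrite -powRM; [|by rewrite addr_ge0// ltW|by rewrite addr_ge0].
  apply: le_powR; first exact: ltW.
    by rewrite addr_ge0// mulr_ge0 ?(ltW b0)// !addr_ge0// ltW.
  have h := mulr_ge0 (ltW bC0) S_ge0; rewrite -subr_ge0.
  by rewrite (_ : _ - _ = 2 * b * C * (b * (V x + V y)))//; ring.
pose W := wcost V (tcost N) b delta.
pose lip := wlip V (tcost N) b delta.
have W0 x y : 0 <= W x y by exact: wcost_ge0.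
have Wfar x y : 1 <= N * theta x y -> W x y = (1 + b * (V x + V y)) `^ delta.
  by move=> Nt; rewrite /W /wcost /tcost min_r// powR1 mul1r.
have cN01' x y := cN01 x y (ltW N0).
have b0' := ltW b0.
have pair_coupling t x y (A : R) (m : probability (E * E)%type R) a f (vx vy : R) :
    (\int[P t x]_y (V y)%:E <= vx%:E)%E -> (\int[P t y]_y (V y)%:E <= vy%:E)%E ->
    coupling (P t x) (P t y) m -> 0 < A ->
    (\int[m]_z (tcost N z.1 z.2)%:E <= A%:E)%E -> 0 <= a -> lip a f ->
    `|Psg P t f x - Psg P t f y| <=
    a * (A `^ (1 - delta) * (1 + b * (vx + vy)) `^ delta).
  move=> hx hy cm A0 cA a0 fl.
  exact: (wlip_coupling mV V0 (mcN N) cN01' b0' delta01 hx hy cm A0 cA a0 fl).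
have pair_product t x y a f (vx vy : R) :
    (\int[P t x]_y (V y)%:E <= vx%:E)%E -> (\int[P t y]_y (V y)%:E <= vy%:E)%E ->
    0 <= a -> lip a f ->
    `|Psg P t f x - Psg P t f y| <= a * (1 + b * (vx + vy)) `^ delta.
  move=> hx hy a0 fl.
  exact: (wlip_product mV V0 (mcN N) cN01' b0' delta01 hx hy a0 fl).
have close a f x y : 0 <= a -> lip a f -> N * theta x y < 1 ->
    `|Psg P T1 f x - Psg P T1 f y| <= a * (g * eta `^ (1 - delta) * W x y).
  (* The scaled Young inequality divides by the bound on E c, so theta x y must be positive. *)
  move=> a0 fl Nt1; have [->|xy] := pselect (x = y).
    by rewrite subrr normr0 !mulr_ge0 ?powR_ge0.
  have th_gt0 : 0 < theta x y.
    rewrite lt_def th0 andbT; apply/eqP.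
    by case: premetric_theta => _ h _ /h.
  have Nt0 : 0 < N * theta x y by rewrite mulr_gt0.
  have [dO [Om [Pr [X [Y [lawX mY tv thr]]]]]] := coupA x y.
  have [m [cm mN]] := generalized_coupling mth th0 (ltW T10) (ltW N0) lawX
    (mY _ (ltW T10)) (tv _ (ltW T10)) (thr _ (ltW T10)).
  have A0 : 0 < 1 / 2 * (N * theta x y) by rewrite mulr_gt0.
  have mA : (\int[m]_z (tcost N z.1 z.2)%:E <= (1 / 2 * (N * theta x y))%:E)%E.
    apply: (le_trans mN); rewrite lee_fin.
    rewrite -[leLHS](_ : (N * r T1 + L T1) * theta x y = _); last by ring.
    by rewrite mulrA ler_wpM2r.
  have := pair_coupling _ _ _ _ _ _ _ _ _ (Vbound x (ltW T10)) (Vbound y (ltW T10))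
    cm A0 mA a0 fl.
  move=> /le_trans; apply; rewrite ler_wpM2l// /W /wcost /tcost min_l ?(ltW Nt1)//.
  rewrite (powRM _ half0 (ltW Nt0)).
  have -> : g * eta `^ (1 - delta) * ((N * theta x y) `^ (1 - delta) *
      (1 + b * (V x + V y)) `^ delta) =
    eta `^ (1 - delta) * (N * theta x y) `^ (1 - delta) *
      (g * (1 + b * (V x + V y)) `^ delta) by ring.
  apply: ler_pM; rewrite ?mulr_ge0 ?powR_ge0//.
  by rewrite ler_wpM2r ?powR_ge0.
have grow1 a f : 0 <= a -> lip a f -> lip (g * a) (Psg P T1 f).
  move=> a0 fl; have [mf f01 _] := fl.
  have [mPf Pf01] := Psg01 markovP (ltW T10) mf f01.
  split=> // x y; have [Nt|Nt] := ltP (N * theta x y) 1.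
    apply: (le_trans (close _ _ _ _ a0 fl Nt)).
    rewrite [leRHS](_ : _ = a * (g * W x y)); last by rewrite /W; ring.
    by rewrite ler_wpM2l// ler_wpM2r// ler_piMr.
  apply: (le_trans (pair_product _ _ _ _ _ _ _ (Vbound x (ltW T10)) (Vbound y (ltW T10)) a0 fl)).
  rewrite -/(W x y) Wfar// [leRHS](_ : _ = a * (g * (1 + b * (V x + V y)) `^ delta)).
    by rewrite ler_wpM2l.
  by ring.
have growj j a f : 0 <= a -> lip a f -> lip (g ^+ j * a) (Psg P (j%:R * T1) f).
  move=> a0 fl; have [mf f01 _] := fl; elim: j => [|j IH].
    by rewrite mul0r Psg0// mul1r.
  have -> : Psg P (j.+1%:R * T1) f = Psg P T1 (Psg P (j%:R * T1) f).
    apply/funext => x; rewrite -PsgD//; last 2 first.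
    - exact: ltW.
    - by rewrite mulr_ge0// ltW.
    by rewrite -natr1 mulrDl mul1r addrC.
  rewrite exprS -mulrA; apply: grow1 => //.
  by rewrite mulr_ge0// exprn_ge0.
have gk : g <= g ^+ k.
  by rewrite -(prednK k_gt0) exprS ler_peMr ?exprn_ege1.
exists T, N, b, al; split=> // a f a0 fl.
have [mf f01 _] := fl.
have [mPf Pf01] := Psg01 markovP (ltW T0) mf f01.
have le_al u x y : u <= al -> a * (u * W x y) <= al * a * W x y.
  by move=> ual; rewrite [al * a]mulrC -mulrA ler_wpM2l// ler_wpM2r.
have sig_al : sig <= al by rewrite le_max lexx.
have al3_al : al3 <= al by rewrite le_max lexx orbT.
split=> // x y; rewrite -/(W x y); have [Nt|Nt] := ltP (N * theta x y) 1.
  (* A is applied to the outermost P_T1 only; the inner function has already grown to the Lipschitz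
     constant g^(k - 1) a. *)
  have PE z : Psg P T f z = Psg P T1 (Psg P (k.-1%:R * T1) f) z.
    rewrite -PsgD//; last 2 first.
    - exact: ltW.
    - by rewrite mulr_ge0// ltW.
    by rewrite TE -{1}(prednK k_gt0) -natr1 mulrDl mul1r addrC.
  rewrite !PE.
  have a0' : 0 <= g ^+ k.-1 * a by rewrite mulr_ge0// exprn_ge0.
  apply: (le_trans (close _ _ _ _ a0' (growj k.-1 _ _ a0 fl) Nt)).
  apply: le_trans (le_al sig x y sig_al).
  rewrite [leLHS](_ : _ = a * (g ^+ k * eta `^ (1 - delta) * W x y)).
    by rewrite ler_wpM2l// ler_wpM2r.
  by rewrite -{2}(prednK k_gt0) exprS; ring.
have [Bxy|nBxy] := pselect (V x <= S0 /\ V y <= S0).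
  have [dO [Om [Pr [X [Y [lawX mY tv thr]]]]]] := coupB x y Bxy.1 Bxy.2.
  have [m [cm mN]] := generalized_coupling mth th0 (ltW T0) (ltW N0) lawX
    (mY _ (ltW T0)) (tv _ (ltW T0)) (thr _ (ltW T0)).
  have mA : (\int[m]_z (tcost N z.1 z.2)%:E <= eta%:E)%E.
    by apply: (le_trans mN); rewrite lee_fin.
  have := pair_coupling _ _ _ _ _ _ _ _ _ (Vbound x (ltW T0)) (Vbound y (ltW T0))
    cm eta0 mA a0 fl.
  move=> /le_trans; apply; apply: le_trans (le_al sig x y sig_al).
  rewrite ler_wpM2l// Wfar//.
  apply: (@le_trans _ _ (eta `^ (1 - delta) * (g * (1 + b * (V x + V y)) `^ delta))).
    by rewrite ler_wpM2l ?powR_ge0.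
  rewrite mulrA ler_wpM2r ?powR_ge0//; apply: le_trans bsig.
  by rewrite mulrC ler_wpM2r ?powR_ge0.
(* At least one of the two values exceeds S0, and V is nonnegative. *)
have S_ge : S0 <= V x + V y.
  have [Vx|/ltW Vx] := leP (V x) S0; last by rewrite (le_trans Vx)// lerDl.
  have [Vy|/ltW Vy] := leP (V y) S0; last by rewrite (le_trans Vy)// lerDr.
  by case: nBxy.
apply: (le_trans (pair_product _ _ _ _ _ _ _ (VT x) (VT y) a0 fl)).
apply: le_trans (le_al al3 x y al3_al).
rewrite ler_wpM2l// Wfar// /al3 -powRM; [|exact: ltW|by rewrite addr_ge0].
have bS := ler_wpM2l (ltW b0) S_ge.
have VE : 1 + b * (1 / 4 * V x + C + (1 / 4 * V y + C)) =
    1 + 1 / 4 * (b * (V x + V y)) + 5 / 8 * (b * S0).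
  have -> : 5 / 8 * (b * S0) = b * (2 * C) by rewrite CS0; ring.
  by ring.
rewrite VE; apply: le_powR => //.
  by rewrite !addr_ge0// mulr_ge0// ?divr_ge0// ltW.
by rewrite /q3 [leRHS]mulrAC ler_pdivlMr ?addr_gt0//; exact: far_arith.
Qed.

End contraction.

(** * Kantorovich-Rubinstein duality *)

Section finite_index.
Context {R : realType} {d : measure_display} {T : measurableType d} {I : finType}.
Variable J : T -> I.
Hypothesis mJ : forall i, measurable (J @^-1` [set i]).

Lemma measurable_index d' (T' : measurableType d') (h : I -> T') :
  measurable_fun setT (fun x => h (J x)).
Proof.
move=> _ Y mY; rewrite setTI.
have -> : (fun x => h (J x)) @^-1` Y =
    \bigcup_i (if `[< Y (h i) >] then J @^-1` [set i] else set0).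
  apply/seteqP; split=> [x Yx|x [i _]] /=.
    by exists (J x) => //; case: asboolP.
  by case: asboolP => // Yi /= ->.
apply: countable_bigcupT_measurable => [|i]; first exact: countableP.
by case: asboolP.
Qed.

Variable mu : probability T R.

Lemma integral_index (h : I -> R) : (forall i, 0 <= h i) ->
  (\int[mu]_x (h (J x))%:E = (\sum_i h i * fine (mu (J @^-1` [set i])))%:E)%E.
Proof.
move=> h0.
transitivity (\int[mu]_x (\sum_i (h i)%:E * (\1_(J @^-1` [set i]) x)%:E))%E.
  apply: eq_integral => x _; rewrite (bigD1 (J x))//= indicE mem_set// mule1.
  rewrite big1 ?adde0// => i /eqP iJ; rewrite indicE memNset ?mule0//.
  by move=> /= /esym.
rewrite ge0_integral_sum//; last 2 first.
- move=> i; apply/measurable_EFinP; apply: measurable_funM => //.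
- by move=> i x _; rewrite -EFinM lee_fin mulr_ge0.
rewrite -sumEFin; apply: eq_bigr => i _.
rewrite ge0_integralZl_EFin//; last first.
  exact/measurable_EFinP.
rewrite integral_indic// setIT EFinM fineK//.
exact: fin_num_measure.
Qed.

Lemma sum_index : \sum_i fine (mu (J @^-1` [set i])) = 1.
Proof.
have := integral_index (h := fun=> 1) (fun=> ler01); under eq_bigr do rewrite mul1r.
move=> h; apply: EFin_inj; rewrite -h integral_cst// mul1e.
exact: probability_setT.
Qed.

Lemma sum_index_setI A : measurable A ->
  (\sum_i mu (A `&` (J @^-1` [set i])) = mu A)%E.
Proof.
move=> mA; have mAJ i : measurable (A `&` (J @^-1` [set i])) by exact: measurableI.
transitivity (\int[mu]_x (\sum_i (\1_(A `&` (J @^-1` [set i])) x)%:E))%E.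
  rewrite ge0_integral_sum//; last by move=> i; exact/measurable_EFinP.
  by apply: eq_bigr => i _; rewrite integral_indic ?setIT.
transitivity (\int[mu]_x (\1_A x)%:E)%E; last by rewrite integral_indic ?setIT.
apply: eq_integral => x _; rewrite (bigD1 (J x))//= big1 ?adde0.
  by rewrite !indicE in_setI [x \in J @^-1` _]mem_set ?andbT.
move=> i /eqP iJ; rewrite indicE in_setI [x \in J @^-1` _]memNset ?andbF//.
by move=> /= /esym.
Qed.

End finite_index.

Section convex_combination.
Context {R : realType} {d : measure_display} {T : measurableType d} {I : finType}.
Local Open Scope ereal_scope.

Lemma convex_combination (w : I -> R) (Q : I -> probability T R) :
  (forall i, (0 <= w i)%R) -> (\sum_i w i = 1)%R ->
  exists M : probability T R,
    (forall A, M A = \sum_i (w i)%:E * Q i A) /\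
    (forall h : T -> \bar R, measurable_fun setT h -> (forall x, 0 <= h x) ->
      \int[M]_x h x = \sum_i (w i)%:E * \int[Q i]_x h x).
Proof.
move=> w0 w1.
(* [msum] takes a sequence of measures, so I is enumerated and the sequence continued by zero. *)
pose m (k : nat) : {measure set T -> \bar R} :=
  if insub k is Some j then mscale (NngNum (w0 (enum_val (j : 'I_#|I|)))) (Q (enum_val j))
  else mzero.
have mE (j : 'I_#|I|) : m j = mscale (NngNum (w0 (enum_val j))) (Q (enum_val j)).
  by rewrite /m valK.
have bigE (F : I -> \bar R) : \sum_(j < #|I|) F (enum_val j) = \sum_i F i.
  by rewrite -(big_enum_val F); apply: eq_bigl.
have sumE A : msum m #|I| A = \sum_i (w i)%:E * Q i A.
  rewrite /msum -(bigE (fun i => (w i)%:E * Q i A)).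
  by apply: eq_bigr => j _; rewrite mE.
have MT : msum m #|I| setT = 1.
  rewrite sumE -[RHS]/(1%:E) -w1 -sumEFin; apply: eq_bigr => i _.
  rewrite -[RHS]mule1; congr (_ * _); exact: probability_setT.
have [M ME] := prob_of_measure MT.
exists M; split=> [A|h mh h0]; first by rewrite ME -sumE.
rewrite (@eq_measure_integral _ _ _ _ (msum m #|I|)); last by move=> A _ _; exact: ME.
rewrite ge0_integral_measure_sum//.
rewrite -(bigE (fun i => (w i)%:E * \int[Q i]_x h x)).
by apply: eq_bigr => j _; rewrite mE ge0_integral_mscale.
Qed.

Lemma conditional_prob (mu : probability T R) (A : set T) : measurable A ->
  exists Q : probability T R, forall B, measurable B ->
    (fine (mu A))%:E * Q B = mu (B `&` A).
Proof.
move=> mA; have muA : mu A \is a fin_num by exact: fin_num_measure.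
(* On a null set any law will do, since it is weighted by 0. *)
have [A0|A0] := eqVneq (fine (mu A)) 0%R.
  exists (dirac point : probability T R) => B mB; rewrite A0 mul0e; apply/esym/eqP.
  rewrite eq_le measure_ge0 andbT; apply: (@le_trans _ _ (mu A)).
    by apply: le_measure; rewrite ?inE//; exact: measurableI.
  by rewrite -(fineK muA) A0.
have A1 : (0 < fine (mu A))%R by rewrite lt_def A0 fine_ge0.
have muT : mrestr mu mA setT = (fine (mu A))%:E by rewrite /mrestr setTI fineK.
have [Q QE] := prob_of_finite_measure A1 muT.
by exists Q => B mB; exact: QE.
Qed.

End convex_combination.

Lemma finite_min (R : realType) (n : nat) (h : 'I_n.+1 -> R) :
  exists i, forall j, h i <= h j.
Proof.
exists [arg min_(i < ord0) h i]%O.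
by case: Order.TotalTheory.arg_minP => // i _ hi j; exact: hi.
Qed.

Section discretization.
Context {R : realType} {d : measure_display} {E : measurableType d}.
Variable rho : E -> E -> R.
Hypothesis rhoP : polish rho.

Local Notation c := (tmetric rho).

(* The dual potentials f, g are replaced by the c-transform
   F(z) = min_j (c(z, y_j) - g_j), which is 1-Lipschitz because c is a metric. *)
Lemma finite_kantorovich n m (p : 'I_n.+1 -> R) (q : 'I_m.+1 -> R)
    (x : 'I_n.+1 -> E) (y : 'I_m.+1 -> E) (M : R) :
  (forall i, 0 <= p i) -> (forall j, 0 <= q j) ->
  \sum_i p i = 1 -> \sum_j q j = 1 ->
  (forall f, Lip1 rho f -> \sum_i f (x i) * p i - \sum_j f (y j) * q j <= M) ->
  exists l : 'I_n.+1 -> 'I_m.+1 -> R,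
    [/\ forall i j, 0 <= l i j,
        forall i, \sum_j l i j = p i,
        forall j, \sum_i l i j = q j &
        \sum_i \sum_j c (x i) (y j) * l i j <= M].
Proof.
move=> p0 q0 p1 q1 hM; apply: transport_duality => // f g fg.
pose H z j := c z (y j) - g j.
have /choice[jm jmP] : forall z, exists j, forall j', H z j <= H z j'.
  by move=> z; exact: finite_min.
have [j0 j0P] := finite_min (fun j => - g j).
pose F z := H z (jm z) + g j0.
have FLip : Lip1 rho F.
  split=> [z|z z'].
    apply/andP; split.
      have := j0P (jm z); have := tmetric_ge0 rhoP z (y (jm z)).
      by rewrite /F /H; lra.
    have := jmP z j0; have := tmetric_le1 rho z (y j0); rewrite /F /H; lra.
  have half u v : F u - F v <= c u v.
    have := jmP u (jm v); have := tmetric_triangle rhoP v u (y (jm v)).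
    by rewrite /F /H; lra.
  by rewrite ler_norml half andbT; have := half z' z; rewrite (tmetricC rhoP z'); lra.
have h1 : \sum_i p i * f i <= \sum_i F (x i) * p i - g j0.
  rewrite -[g j0]mulr1 -p1 mulr_sumr -sumrB; apply: ler_sum => i _.
  rewrite -mulrBl [leLHS]mulrC ler_wpM2r// /F addrK.
  by have := fg i (jm (x i)); rewrite /H; lra.
have h2 : \sum_j q j * g j <= g j0 - \sum_j F (y j) * q j.
  rewrite -{1}[g j0]mulr1 -q1 mulr_sumr -sumrB; apply: ler_sum => j _.
  rewrite -mulrBl [leLHS]mulrC ler_wpM2r//.
  by have := jmP (y j) j; rewrite /F /H (tmetricxx rhoP); lra.
by have := hM F FLip; lra.
Qed.

(** A point goes to the first point of the dense sequence within e, the index being capped at k. The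
    error is at most e below the cap, and at most 1 on a tail of vanishing mass. Only k0 depends on
    mu, so several laws can share the same cells. *)
Lemma discretization : exists s : nat -> E, forall e : R, 0 < e ->
  exists J : nat -> E -> nat,
    [/\ forall k i, measurable (J k @^-1` [set i]),
        forall k x, (J k x <= k)%N &
        forall mu : probability E R, exists k0, forall k, (k0 <= k)%N ->
          (\int[mu]_x (c x (s (J k x)))%:E <= (2 * e)%:E)%E].
Proof.
have [_ _ [s sd] _] := rhoP; exists s => e e0.
pose cell x := ex_minn (sd x e e0).
have cellP x : rho x (s (cell x)) < e by rewrite /cell; case: ex_minnP.
have cell_min x j : rho x (s j) < e -> (cell x <= j)%N.
  by rewrite /cell; case: ex_minnP => m _ h /h.
have mB j : measurable [set x | rho x (s j) < e].
  rewrite (_ : [set x | _] = [set x | rho (s j) x < e]).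
    exact: measurable_rho_ball.
  by apply/seteqP; split=> x /=; rewrite (rhoC rhoP).
have mcell_le j : measurable [set x | (cell x <= j)%N].
  rewrite (_ : [set x | _] = \bigcup_(i in [set i | (i <= j)%N]) [set x | rho x (s i) < e]).
    by apply: bigcup_measurable => i _.
  apply/seteqP; split=> [x /= xj|x [i /= ij /cell_min xi]]; last exact: leq_trans ij.
  by exists (cell x); [exact: xj|exact: cellP].
have mcell Y : measurable (cell @^-1` Y).
  rewrite (_ : cell @^-1` Y = \bigcup_(i in Y) (cell @^-1` [set i])); last first.
    by apply/seteqP; split=> [x /= Yx|x [i Yi /= ->]]//; exists (cell x).
  apply: bigcup_measurable => i _.
  case: i => [|i].
    rewrite (_ : _ @^-1` _ = [set x | (cell x <= 0)%N])//.
    by apply/seteqP; split=> x /=; [move=> ->|rewrite leqn0 => /eqP].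
  rewrite (_ : _ @^-1` _ = [set x | (cell x <= i.+1)%N] `\` [set x | (cell x <= i)%N]).
    exact: measurableD.
  apply/seteqP; split=> x /=; first by move=> ->; rewrite leqnn ltnn.
  by move=> [h1 /negP]; rewrite -ltnNge => h2; apply/eqP; rewrite eqn_leq h1 h2.
pose J k x := minn (cell x) k.
have mJ k i : measurable (J k @^-1` [set i]).
  exact: (mcell [set m | minn m k = i]).
exists J; split=> // [k x|mu]; first exact: geq_minr.
pose F k := [set x | (k <= cell x)%N].
have mF k : measurable (F k) by exact: (mcell [set m | (k <= m)%N]).
have Fcvg : mu (F k) @[k --> \oo] --> 0%E.
  have <- : mu (\bigcap_k F k) = 0%E.
    rewrite (_ : \bigcap_k F k = set0) ?measure0//.
    by rewrite -subset0 => x /(_ (cell x).+1 I); rewrite /F/= ltnn.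
  apply: nonincreasing_cvg_mu => //.
  - by apply: (@le_lt_trans _ _ 1%E); [exact: probability_le1|exact: ltry].
  - exact: bigcapT_measurable.
  - move=> k l kl; apply/subsetPset => x; exact: leq_trans.
have [k0 _ hk0] : \forall k \near \oo, (mu (F k) <= e%:E)%E.
  have Ffin k : mu (F k) \is a fin_num by exact: fin_num_measure.
  move/fine_cvgP: Fcvg => [_ /cvgrPdist_le/(_ e e0)]; apply: filterS => k /=.
  rewrite sub0r normrN ger0_norm ?fine_ge0// => h.
  by rewrite -(fineK (Ffin k)) lee_fin.
exists k0 => k kk0.
have mcJ : measurable_fun setT (fun x => c x (s (J k x))).
  have mJo i : measurable ((fun x => inord (J k x) : 'I_k.+1) @^-1` [set i]).
    exact: (mcell [set m | inord (minn m k) = i]).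
  have mp : measurable_fun setT (fun x => (x, s (inord (J k x) : 'I_k.+1))).
    apply: measurable_fun_pair => //.
    exact: (measurable_index mJo (fun i : 'I_k.+1 => s i)).
  have := measurableT_comp (measurable_tmetric rhoP) mp.
  by apply: eq_measurable_fun => x _ /=; rewrite inordK// ltnS geq_minr.
apply: (@le_trans _ _ (\int[mu]_x (e%:E + (\1_(F k) x)%:E))%E).
  apply: ge0_le_integral => //.
  - by move=> x _; rewrite lee_fin tmetric_ge0.
  - exact/measurable_EFinP.
  - by apply: emeasurable_funD => //; exact/measurable_EFinP.
  - move=> x _; rewrite -EFinD lee_fin indicE /J; case: (leqP k (cell x)) => kx.
      rewrite mem_set//=; apply: le_trans (tmetric_le1 rho _ _) _.
      by rewrite lerDr ltW.
    apply: le_trans (tmetric_le_rho rho _ _) _; rewrite ltW//.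
    by apply: lt_le_trans (cellP x) _; rewrite lerDl.
rewrite ge0_integralD//; last 2 first.
- by move=> x _; rewrite lee_fin ltW.
- exact/measurable_EFinP.
rewrite integral_cst// integral_indic// setIT (mulrDl 1 1) mul1r EFinD.
apply: leeD; last exact: hk0.
by rewrite -[leRHS]mule1 lee_wpmul2l ?lee_fin ?(ltW e0)//; exact: probability_le1.
Qed.

(** Both laws are discretised on common cells, and the mass l i j of a finite plan is spread as the
    product of the conditional laws on cells i and j, which restores the marginals exactly.
    Discretisation costs 4 e in the dual bound and 4 e again in the primal cost, whence e = e' /
    8. *)
Lemma kantorovich_rubinstein (mu nu : probability E R) (M : R) :
  (forall f, Lip1 rho f -> `|\int[mu]_x f x - \int[nu]_x f x| <= M) ->
  (wasserstein c mu nu <= M%:E)%E.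
Proof.
move=> hM; apply/lee_addgt0Pr => e' e'0.
pose e := e' / 8; have e0 : 0 < e by rewrite divr_gt0.
have [s /(_ e e0)[J0 [mJ0 J0le J0c]]] := discretization.
have [k1 hk1] := J0c mu; have [k2 hk2] := J0c nu.
pose k := maxn k1 k2.
have muc := hk1 k (leq_maxl _ _); have nuc := hk2 k (leq_maxr _ _).
pose J x : 'I_k.+1 := inord (J0 k x).
have JE x : J x = J0 k x :> nat by rewrite inordK// ltnS.
have mJ i : measurable (J @^-1` [set i]).
  rewrite (_ : J @^-1` _ = J0 k @^-1` [set (i : nat)])//.
  apply/seteqP; split=> x /=; first by rewrite -JE => ->.
  by move=> h; apply: val_inj; rewrite /= JE.
pose sJ x := s (J x).
have msJ : measurable_fun setT sJ by exact: (measurable_index mJ (fun i => s i)).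
have mcJ : measurable_fun setT (fun x => c x (sJ x)).
  exact: (measurableT_comp (measurable_tmetric rhoP) (measurable_fun_pair (@measurable_id _ _ _) msJ)).
have cJ (m : probability E R) : (\int[m]_x (c x (s (J0 k x)))%:E <= (2 * e)%:E)%E ->
    (\int[m]_x (c x (sJ x))%:E <= (2 * e)%:E)%E.
  by under eq_integral do rewrite -JE.
have {}muc := cJ _ muc; have {}nuc := cJ _ nuc.
pose wt (m : probability E R) (i : 'I_k.+1) := fine (m (J @^-1` [set i])).
have wt0 m i : 0 <= wt m i by exact: fine_ge0.
have sumE (m : probability E R) f : Lip1 rho f ->
    \sum_(i < k.+1) f (s i) * wt m i = \int[m]_x f (sJ x).
  move=> [f01 _]; rewrite /Rintegral /sJ (integral_index mJ m (h := fun i => f (s i)))//.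
  by move=> i; case/andP: (f01 (s i)).
have disc (m : probability E R) f : Lip1 rho f ->
    (\int[m]_x (c x (sJ x))%:E <= (2 * e)%:E)%E ->
    `|\int[m]_x f x - \sum_(i < k.+1) f (s i) * wt m i| <= 2 * e.
  move=> fl mc; rewrite sumE//.
  apply: (le_Rintegral_dist (h := fun x => c x (sJ x))) => //.
  - exact: (Lip1_integrable rhoP).
  - apply: prob_integrable01 => [|x]; last exact: fl.1.
    by apply: measurableT_comp => //; exact: (measurable_Lip1 rhoP).
  - by move=> x; exact: fl.2.
have [l [l0 lrow lcol lM]] : exists l : 'I_k.+1 -> 'I_k.+1 -> R,
    [/\ forall i j, 0 <= l i j, forall i, \sum_j l i j = wt mu i,
        forall j, \sum_i l i j = wt nu j &
        \sum_(i < k.+1) \sum_(j < k.+1) c (s i) (s j) * l i j <= M + 4 * e].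
  apply: (finite_kantorovich (x := fun i : 'I_k.+1 => s i) (y := fun i : 'I_k.+1 => s i)) => //.
  - exact: sum_index.
  - exact: sum_index.
  - move=> f fl; have := disc mu f fl muc; have := disc nu f fl nuc; have := hM f fl.
    by rewrite !ler_norml; lra.
have /choice[mui muiE] : forall i, exists Q : probability E R, forall B, measurable B ->
    ((wt mu i)%:E * Q B = mu (B `&` (J @^-1` [set i])))%E.
  by move=> i; exact: conditional_prob.
have /choice[nuj nujE] : forall i, exists Q : probability E R, forall B, measurable B ->
    ((wt nu i)%:E * Q B = nu (B `&` (J @^-1` [set i])))%E.
  by move=> i; exact: conditional_prob.
pose Q (ij : 'I_k.+1 * 'I_k.+1) : probability (E * E)%type R := (mui ij.1 \x nuj ij.2)%E.
have QE ij A B : measurable A -> measurable B ->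
    (Q ij (A `*` B) = mui ij.1 A * nuj ij.2 B)%E.
  by move=> mA mB; exact: product_measure1E.
pose w (ij : 'I_k.+1 * 'I_k.+1) := l ij.1 ij.2.
have w1 : \sum_ij w ij = 1.
  rewrite -(pair_bigA _ l)/=; under eq_bigr do rewrite lrow.
  exact: sum_index.
have [m [mE mint]] := convex_combination Q (fun ij => l0 ij.1 ij.2) w1.
have p1 (p : probability E R) : (p setT = 1)%E by exact: probability_setT.
have part (p : probability E R) := sum_index_setI mJ p.
have cm : coupling mu nu m.
  split=> A mA; rewrite mE.
    under eq_bigr do rewrite QE// p1 mule1.
    rewrite -(pair_bigA _ (fun i j => (l i j)%:E * mui i A)%E)/=.
    rewrite -[RHS]part//; apply: eq_bigr => i _.
    rewrite -ge0_sume_distrl; last by move=> j _; rewrite lee_fin.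
    by rewrite sumEFin lrow muiE.
  under eq_bigr do rewrite QE// p1 mul1e.
  rewrite -(pair_bigA _ (fun i j => (l i j)%:E * nuj j A)%E)/= exchange_big/=.
  rewrite -[RHS]part//; apply: eq_bigr => i _.
  rewrite -ge0_sume_distrl; last by move=> j _; rewrite lee_fin.
  by rewrite sumEFin lcol nujE.
apply: (@le_trans _ _ (\int[m]_z (c z.1 z.2)%:E)%E).
  by apply: ereal_inf_lbound; exists m.
pose g1 (z : E * E) := (c z.1 (sJ z.1))%:E.
pose g2 (z : E * E) := (c (sJ z.1) (sJ z.2))%:E.
pose g3 (z : E * E) := (c z.2 (sJ z.2))%:E.
have msJ1 : measurable_fun setT (fun z : E * E => sJ z.1) by exact: measurableT_comp.
have msJ2 : measurable_fun setT (fun z : E * E => sJ z.2) by exact: measurableT_comp.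
have mg1 : measurable_fun setT g1.
  by apply/measurable_EFinP; exact: (measurableT_comp mcJ).
have mg3 : measurable_fun setT g3.
  by apply/measurable_EFinP; exact: (measurableT_comp mcJ).
have mg2 : measurable_fun setT g2.
  apply/measurable_EFinP.
  exact: (measurableT_comp (measurable_tmetric rhoP) (measurable_fun_pair msJ1 msJ2)).
have g10 z : (0 <= g1 z)%E by rewrite lee_fin tmetric_ge0.
have g20 z : (0 <= g2 z)%E by rewrite lee_fin tmetric_ge0.
have g30 z : (0 <= g3 z)%E by rewrite lee_fin tmetric_ge0.
apply: (@le_trans _ _ (\int[m]_z (g1 z + (g2 z + g3 z)))%E).
  apply: ge0_le_integral => //.
  - by move=> z _; rewrite lee_fin tmetric_ge0.
  - by apply/measurable_EFinP; exact: measurable_tmetric.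
  - by apply: emeasurable_funD => //; exact: emeasurable_funD.
  - move=> z _; rewrite -!EFinD lee_fin.
    have := tmetric_triangle rhoP (sJ z.1) z.1 z.2.
    have := tmetric_triangle rhoP (sJ z.2) (sJ z.1) z.2.
    by rewrite (tmetricC rhoP (sJ z.2) z.2); lra.
rewrite ge0_integralD//; last 2 first.
- by move=> z _; rewrite adde_ge0.
- exact: emeasurable_funD.
rewrite ge0_integralD//.
have i1 : (\int[m]_z g1 z <= (2 * e)%:E)%E.
  rewrite (coupling_integral1 cm (f := fun x => (c x (sJ x))%:E))//.
  - exact/measurable_EFinP.
  - by move=> x; rewrite lee_fin tmetric_ge0.
have i3 : (\int[m]_z g3 z <= (2 * e)%:E)%E.
  rewrite (coupling_integral2 cm (f := fun x => (c x (sJ x))%:E))//.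
  - exact/measurable_EFinP.
  - by move=> x; rewrite lee_fin tmetric_ge0.
have i2 : (\int[m]_z g2 z <= (M + 4 * e)%:E)%E.
  rewrite mint//.
  apply: (@le_trans _ _ (\sum_(ij : 'I_k.+1 * 'I_k.+1) (c (s ij.1) (s ij.2) * l ij.1 ij.2)%:E)%E); last first.
    rewrite sumEFin lee_fin; apply: le_trans lM.
    by rewrite (pair_bigA _ (fun i j : 'I_k.+1 => c (s i) (s j) * l i j)).
  apply: lee_sum => -[i j] _ /=; rewrite /w/=.
  (* If l i j > 0, both cells have positive mass, so the conditional laws are carried by their cells
     and g2 is constant almost surely. *)
  have [->|lij] := eqVneq (l i j) 0; first by rewrite mul0e mulr0.
  have lij0 : 0 < l i j by rewrite lt_def lij l0.
  have pi0 : 0 < wt mu i.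
    by rewrite -lrow (bigD1 j)//= ltr_pwDl// sumr_ge0.
  have qj0 : 0 < wt nu j.
    by rewrite -lcol (bigD1 i)//= ltr_pwDl// sumr_ge0.
  rewrite mulrC EFinM lee_wpmul2l ?lee_fin//.
  pose D := (J @^-1` [set i]) `*` (J @^-1` [set j]).
  have mD : measurable D by exact: measurableX.
  have full (p : probability E R) (pi : probability E R) a (ha : 0 < wt p a) :
      (forall B, measurable B -> (wt p a)%:E * pi B = p (B `&` (J @^-1` [set a])))%E ->
      (pi (J @^-1` [set a]) = 1)%E.
    move=> /(_ _ (mJ a)); rewrite setIid => h.
    have pfin : p (J @^-1` [set a]) \is a fin_num by exact: fin_num_measure.
    have pifin : pi (J @^-1` [set a]) \is a fin_num by exact: fin_num_measure.
    move: h; rewrite -(fineK pfin) -/(wt p a) -(fineK pifin) -EFinM => -[].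
    by rewrite -[RHS]mulr1 => /(mulfI (lt0r_neq0 ha)) ->.
  have QD : (Q (i, j) (~` D) = 0)%E.
    rewrite probability_setC//.
    have -> : Q (i, j) D = 1%E.
      rewrite /D QE//= (full mu _ i pi0 (muiE i)) (full nu _ j qj0 (nujE j)).
      exact: mule1.
    by rewrite subee.
  rewrite (@ge0_negligible_integral _ _ _ _ setT (~` D))//; last exact: measurableC.
  rewrite setDE setCK setTI.
  have -> : (\int[Q (i, j)]_(x in D) g2 x = \int[Q (i, j)]_(x in D) cst (c (s i) (s j))%:E x)%E.
    apply: eq_integral => z; rewrite inE => -[/= z1 z2].
    by rewrite /g2 /sJ z1 z2.
  rewrite integral_cst//.
  rewrite -[leRHS]mule1 lee_wpmul2l ?lee_fin ?tmetric_ge0//.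
  exact: probability_le1.
apply: le_trans (leeD i1 (leeD i2 i3)) _.
by rewrite -!EFinD lee_fin /e; lra.
Qed.

End discretization.

(** * Completeness of the space of laws *)

Lemma dependent_choice_nat (X : Type) (Q : nat -> X -> Prop) (r : nat -> X -> X -> Prop) :
  (exists x, Q 0%N x) ->
  (forall n x, Q n x -> exists y, Q n.+1 y /\ r n x y) ->
  exists u : nat -> X, forall n, Q n (u n) /\ r n (u n) (u n.+1).
Proof.
move=> [x0 Qx0] step.
have /choice[F FP] : forall nx : nat * X, exists y,
    Q nx.1 nx.2 -> Q nx.1.+1 y /\ r nx.1 nx.2 y.
  move=> [n x] /=; have [Qx|nQx] := pselect (Q n x); last by exists x.
  by have [y hy] := step n x Qx; exists y.
pose u := fix u n := if n is n'.+1 then F (n', u n') else x0.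
have Qu n : Q n (u n) by elim: n => //= n IH; exact: (FP (n, u n) IH).1.
by exists u => n; split=> //; exact: (FP (n, u n) (Qu n)).2.
Qed.

(** * Splitting sets under the uniform law on [0, 1] *)

Section uniform_splitting.
Variable R : realType.
Local Notation Om := (measurableTypeR R).

Definition unif : probability Om R := uniform_prob (@ltr01 R).

Let unif_itv (A : set Om) (a b : R) : measurable A -> a <= b ->
  (unif (A `&` `]a, b]%classic) <= (b - a)%:E)%E.
Proof.
move=> mA ab.
have mI : measurable (`]a, b]%classic : set Om) by exact: measurable_itv.
apply: (@le_trans _ _ (unif `]a, b]%classic)).
  by apply: le_measure; rewrite ?inE//; exact: measurableI.
apply: (@le_trans _ _ (\int[lebesgue_measure]_(x in `]a, b]%classic) (cst 1%E x))%E).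
  apply: ge0_le_integral => //.
  - by move=> x _; rewrite lee_fin uniform_pdf_ge0.
  - apply/measurable_EFinP; apply: measurable_funTS; exact: measurable_uniform_pdf.
  - by move=> x _; rewrite lee_fin /uniform_pdf; case: ifP; rewrite ?subr0 ?invr1.
rewrite integral_cst// mul1e.
have := @lebesgue_measure_itv R `]a, b]; rewrite /= lte_fin => ->.
by case: ltP => [_|ba]; rewrite -?EFinB// lee_fin subr_ge0.
Qed.

Let unifE (A B : set Om) : A `&` `[0, 1]%classic = B `&` `[0, 1]%classic ->
  unif A = unif B.
Proof.
move=> AB; rewrite /unif/= /uniform_prob integral_uniform_pdf AB.
by rewrite -integral_uniform_pdf.
Qed.

(** Absence of atoms: G a, the mass of A up to a, is 1-Lipschitz and runs from 0 at -1 to the mass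
    of A at 2, so it takes the value s. *)
Lemma unif_split (A : set Om) (s : R) : measurable A -> 0 <= s -> (s%:E <= unif A)%E ->
  exists B, [/\ measurable B, B `<=` A & unif B = s%:E].
Proof.
move=> mA s0 sA.
have mI (a : R) : measurable (`]-oo, a]%classic : set Om) by exact: measurable_itv.
have mAI a : measurable (A `&` `]-oo, a]%classic) by exact: measurableI.
have fin B : measurable B -> unif B \is a fin_num by move=> ?; exact: fin_num_measure.
pose G a := fine (unif (A `&` `]-oo, a]%classic)).
have GE a : unif (A `&` `]-oo, a]%classic) = (G a)%:E by rewrite fineK// fin.
have Gstep a b : a <= b -> 0 <= G b - G a <= b - a.
  move=> ab.
  have mab : measurable (`]a, b]%classic : set Om) by exact: measurable_itv.
  have e : unif (A `&` `]-oo, b]%classic) =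
      (unif (A `&` `]-oo, a]%classic) + unif (A `&` `]a, b]%classic))%E.
    rewrite -measureU//; last 2 first.
    - exact: measurableI.
    - rewrite -subset0 => x [[_ /=]]; rewrite !in_itv/= => xa [_ /andP[ax _]].
      by move: ax; rewrite ltNge xa.
    congr (unif _); rewrite -setIUr; congr (_ `&` _).
    apply/seteqP; split=> x /=; rewrite !in_itv/=.
      by case: (leP x a) => xa xb; [left|right].
    by case=> [xa|/andP[]//]; exact: le_trans ab.
  have u0 : (0 <= unif (A `&` `]a, b]%classic))%E by exact: measure_ge0.
  have := unif_itv mA ab; move: e u0; rewrite !GE.
  case: (unif (A `&` `]a, b]%classic)) => // x; rewrite -EFinD => -[->].
  by rewrite !lee_fin addrAC subrr add0r => -> ->.
have Gcont : continuous G.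
  move=> a; apply/cvgrPdist_le => e e0; near=> b.
  have ab : `|a - b| <= e.
    near: b; apply/nbhs_ballP; exists e => //= b; rewrite /ball/= => /ltW.
    by [].
  apply: le_trans ab; have [ab|/ltW ba] := leP a b.
    by have /andP[h1 h2] := Gstep a b ab; rewrite distrC [`|a - b|]distrC !ger0_norm// subr_ge0.
  by have /andP[h1 h2] := Gstep b a ba; rewrite !ger0_norm// subr_ge0.
have G1 : G (-1) = 0.
  rewrite /G (@unifE _ set0) ?measure0//; rewrite set0I -subset0 => x [[_ /=]].
  by rewrite !in_itv/= => h1 /andP[h2 _]; lra.
have G2 : (G 2)%:E = unif A.
  rewrite -GE; apply: unifE; apply/seteqP; split=> x /=; first by case=> -[].
  rewrite !in_itv/= => -[Ax h]; split=> //; split=> //.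
  by case/andP: h => _ h; lra.
have sG : s <= G 2 by rewrite -lee_fin G2.
have /(@IVT _ G (-1) 2 s) : -1 <= 2 :> R by lra.
case.
- exact: continuous_subspaceT.
- by rewrite G1 min_l ?max_r ?s0 ?sG//; exact: le_trans sG.
move=> a _ Ga; exists (A `&` `]-oo, a]%classic); split=> //.
by rewrite GE Ga.
Unshelve. all: by end_near. Qed.

Lemma unif_partition (A : set Om) m (lam : nat -> R) : measurable A ->
  (forall j, 0 <= lam j) -> unif A = (\sum_(j < m.+1) lam j)%:E ->
  exists g : Om -> nat, (forall w, (g w <= m)%N) /\
    forall j, (j <= m)%N -> measurable (A `&` g @^-1` [set j]) /\
      unif (A `&` g @^-1` [set j]) = (lam j)%:E.
Proof.
move=> mA lam0; elim: m A mA => [|m IH] A mA AE.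
  exists (fun=> 0%N); split=> // j; rewrite leqn0 => /eqP ->.
  rewrite (_ : _ @^-1` _ = setT); last by apply/seteqP; split.
  by rewrite setIT AE big_ord1.
have sA : ((lam m.+1)%:E <= unif A)%E.
  by rewrite AE lee_fin big_ord_recr/= lerDr sumr_ge0.
have [B [mB BA BE]] := unif_split mA (lam0 _) sA.
have mAB : measurable (A `\` B) by exact: measurableD.
have ABE : unif (A `\` B) = (\sum_(j < m.+1) lam j)%:E.
  have ABi : A `&` B = B by exact/setIidPr.
  rewrite measureD//; last first.
    by apply: (@le_lt_trans _ _ 1%E); [exact: probability_le1|exact: ltry].
  rewrite ABi; transitivity ((\sum_(j < m.+2) lam j)%:E - (lam m.+1)%:E)%E.
    by congr (_ - _)%E; [exact: AE|exact: BE].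
  by rewrite big_ord_recr/= -EFinB addrK.
have [g [gm gE]] := IH _ mAB ABE.
exists (fun w => if w \in B then m.+1 else g w); split=> [w|j].
  by case: ifP => // _; exact: leqW.
rewrite leq_eqVlt => /predU1P[->|jm].
  rewrite (_ : _ `&` _ = B)//; apply/seteqP; split=> w /=.
    case=> Aw; case: ifPn; rewrite ?inE// => _ gw.
    by have := gm w; rewrite gw ltnn.
  by move=> Bw; split; [exact: BA|rewrite mem_set].
rewrite (_ : _ `&` _ = (A `\` B) `&` g @^-1` [set j]); first exact: gE.
apply/seteqP; split=> w /=.
  by case=> Aw; case: ifPn => [_ jE|/negP]; [move: jm; rewrite -jE ltnn|rewrite inE].
by case=> [[Aw nBw] gw]; split=> //; rewrite memNset.
Qed.

(** Each level set of S is partitioned with masses lam i j, so (S, S') realises a prescribed joint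
    law with S given in advance; this lets transport plans be chained on one probability space. *)
Lemma unif_refine (S : Om -> nat) n m (lam : nat -> nat -> R) :
  (forall i, measurable (S @^-1` [set i])) -> (forall w, (S w <= n)%N) ->
  (forall i j, 0 <= lam i j) ->
  (forall i, (i <= n)%N -> unif (S @^-1` [set i]) = (\sum_(j < m.+1) lam i j)%:E) ->
  exists S' : Om -> nat, [/\ forall j, measurable (S' @^-1` [set j]),
    forall w, (S' w <= m)%N &
    forall i j, (i <= n)%N -> (j <= m)%N ->
      unif (S @^-1` [set i] `&` S' @^-1` [set j]) = (lam i j)%:E].
Proof.
move=> mS Sn lam0 SE.
have /choice[g gP] : forall i, exists g : Om -> nat, (forall w, (g w <= m)%N) /\
    ((i <= n)%N -> forall j, (j <= m)%N ->
      measurable (S @^-1` [set i] `&` g @^-1` [set j]) /\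
      unif (S @^-1` [set i] `&` g @^-1` [set j]) = (lam i j)%:E).
  move=> i; have [i_le|i_gt] := leqP i n; last by exists (fun=> 0%N).
  by have [g [gm gE]] := unif_partition (mS i) (lam0 i) (SE i i_le); exists g.
pose S' w := g (S w) w.
have fib i j : S @^-1` [set i] `&` S' @^-1` [set j] = S @^-1` [set i] `&` g i @^-1` [set j].
  by apply/seteqP; split=> w [/= Sw]; rewrite /S' Sw.
exists S'; split=> [j|w|i j i_le jm].
- have -> : S' @^-1` [set j] = \bigcup_i (S @^-1` [set i] `&` S' @^-1` [set j]).
    by apply/seteqP; split=> [w /= S'w|w [i _ []]]//; exists (S w).
  apply: bigcupT_measurable => i; rewrite fib.
  have [jm|jm] := leqP j m; last first.
    rewrite (_ : _ `&` _ = set0)// -subset0 => w [_ /= gw].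
    by have := (gP i).1 w; rewrite gw leqNgt jm.
  have [i_le|i_gt] := leqP i n; first exact: ((gP i).2 i_le j jm).1.
  rewrite (_ : _ `&` _ = set0)// -subset0 => w [/= Sw _].
  by have := Sn w; rewrite Sw leqNgt i_gt.
- exact: (gP (S w)).1.
- by rewrite fib; exact: ((gP i).2 i_le j jm).2.
Qed.

End uniform_splitting.

(** * Almost sure limits of random points *)

Section limit_law.
Context {R : realType} {d : measure_display} {E : measurableType d}.
Variable rho : E -> E -> R.
Hypothesis rhoP : polish rho.
Local Notation c := (tmetric rho).

Lemma Lip1_rho_lim f (u : nat -> E) x : Lip1 rho f -> rho_converges rho u x ->
  f (u n) @[n --> \oo] --> f x.
Proof.
move=> [_ fl] ux; apply/cvgrPdist_le => e e0; have [N hN] := ux e e0.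
near=> n; apply: (@le_trans _ _ (rho (u n) x)).
  by rewrite distrC; apply: le_trans (fl _ _) _; exact: tmetric_le_rho.
by apply/ltW/hN; near: n; exact: nbhs_infty_ge.
Unshelve. all: by end_near. Qed.

(** The Lipschitz approximations G k increase to the indicator of an open U, so v lies in U exactly
    when some G k v exceeds 1/2, and each G k v is a pointwise limit of real measurable functions.
    The factor 1 / (k + 1) only puts G k into [Lip1]. *)
Lemma measurable_rho_lim d' (O : measurableType d') (u : nat -> O -> E) (v : O -> E) :
  (forall n, measurable_fun setT (u n)) ->
  (forall w, rho_converges rho (u ^~ w) (v w)) -> measurable_fun setT v.
Proof.
move=> mu uv; apply: (measurability (rho_open rho)).
  by apply/seteqP; split=> A; case: rhoP => _ _ _ b /b.
move=> _ [U oU <-]; rewrite setTI.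
have [G [GL G0g _ Gc]] := Lip1_approx rhoP (@indic01 R _ E U) (lsc_indic oU).
have -> : v @^-1` U = \bigcup_k [set w | k.+1%:R^-1 * (1 / 2) < k.+1%:R^-1 * G k (v w)].
  have k0 k : 0 < k.+1%:R^-1 :> R by rewrite invr_gt0.
  apply/seteqP; split=> w /=.
    move=> Uw; have := Gc (v w); rewrite indicE mem_set//= => /cvgrPdist_lt.
    move=> /(_ (1 / 2)) /(_ ltac:(lra))[k _ /(_ k (leqnn k))] /=.
    rewrite ltr_norml => /andP[_ h]; exists k => //=; rewrite ltr_pM2l//; lra.
  move=> [k _ /=]; rewrite ltr_pM2l// => hk; apply: contrapT => nU.
  have /andP[_] := G0g k (v w); rewrite indicE memNset//=; lra.
apply: bigcupT_measurable => k.
have mGv : measurable_fun setT (fun w => k.+1%:R^-1 * G k (v w)).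
  apply: (@measurable_fun_cvg _ _ _ _ (fun n w => k.+1%:R^-1 * G k (u n w))).
    by move=> n; apply: (measurableT_comp (measurable_Lip1 rhoP (GL k))).
  by move=> w _; exact: (Lip1_rho_lim (GL k) (uv w)).
rewrite (_ : [set w | _] = (fun w => k.+1%:R^-1 * G k (v w)) @^-1`
    `]k.+1%:R^-1 * (1 / 2), +oo[%classic).
  by rewrite -[X in measurable X]setTI; apply: mGv => //; exact: measurable_itv.
by apply/seteqP; split=> w /=; rewrite in_itv/= andbT.
Qed.

Lemma tmetric_path (u : nat -> E) m n : (m <= n)%N ->
  c (u m) (u n) <= \sum_(m <= i < n) c (u i) (u i.+1).
Proof.
move=> /subnK <-; elim: (n - m)%N => [|k IH]; first by rewrite add0n big_geq// tmetricxx.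
rewrite addSn big_nat_recr ?leq_addl//=.
by apply: le_trans (tmetric_triangle rhoP (u (k + m)%N) _ _) _; rewrite lerD2r.
Qed.

Lemma summable_rho_cauchy (u : nat -> E) (M : R) :
  (forall n, \sum_(0 <= i < n) c (u i) (u i.+1) <= M) -> rho_cauchy rho u.
Proof.
move=> hM e e0; pose S n := \sum_(0 <= i < n) c (u i) (u i.+1).
have Snd m n : (m <= n)%N -> S m <= S n.
  move=> mn; rewrite /S (big_cat_nat _ mn)//= lerDl sumr_ge0// => i _.
  exact: tmetric_ge0.
(* Below 1 the truncated metric is rho itself. *)
pose e1 := Num.min e 1; have e10 : 0 < e1 by rewrite lt_min e0 ltr01.
have supS : has_sup (range S).
  by split; [exists (S 0%N), 0%N|exists M => _ [n _ <-]; exact: hM].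
have [_ [N _ <-] hN] := sup_adherent e10 supS.
have half m n : (N <= m)%N -> (m <= n)%N -> c (u m) (u n) < e1.
  move=> Nm mn; apply: le_lt_trans (tmetric_path u mn) _.
  have -> : \sum_(m <= i < n) c (u i) (u i.+1) = S n - S m.
    by rewrite /S [X in _ = X - _](big_cat_nat _ mn)//= addrAC subrr add0r.
  have : S n <= sup (range S) by apply: (ub_le_sup supS.2); exists n.
  have := Snd _ _ Nm; move: hN; move: (sup _) => a; lra.
exists N => m n Nm Nn.
suff : c (u m) (u n) < e1.
  rewrite /tmetric /e1 !lt_min !gt_min; case/andP=> /orP[//|].
  by move=> h1 /orP[|]; rewrite ?ltxx// => h2; move: h1; 
    have [?|?] := ltP (rho (u m) (u n)) e; rewrite ?ltxx//; lra.
have [mn|/ltnW nm] := leqP m n; first exact: half.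
by rewrite tmetricC//; exact: half.
Qed.

(** The sum of the increments has finite expectation, so it is finite almost surely and the paths
    are almost surely Cauchy; pi is the law of the limit. *)
Lemma limit_random_variable d' (O : measurableType d') (Q : probability O R)
    (u : nat -> O -> E) (eta : nat -> R) (M : R) :
  (forall n, measurable_fun setT (u n)) ->
  (forall n, (\int[Q]_w (c (u n w) (u n.+1 w))%:E <= (eta n)%:E)%E) ->
  (forall n, \sum_(0 <= i < n) eta i <= M) ->
  exists pi : probability E R, forall f, Lip1 rho f ->
    \int[Q]_w f (u n w) @[n --> \oo] --> \int[pi]_x f x.
Proof.
move=> mu ueta etaM.
pose cu n w := (c (u n w) (u n.+1 w))%:E.
have mcu n : measurable_fun setT (cu n).
  apply/measurable_EFinP.
  exact: (measurableT_comp (measurable_tmetric rhoP) (measurable_fun_pair (mu n) (mu n.+1))).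
have cu0 n w : (0 <= cu n w)%E by rewrite lee_fin tmetric_ge0.
pose g w := (\sum_(n <oo) cu n w)%E.
have g0 w : (0 <= g w)%E by apply: nneseries_ge0 => n _ _; exact: cu0.
have mg : measurable_fun setT g.
  apply: (emeasurable_fun_cvg (fun n w => \sum_(0 <= i < n) cu i w)%E).
    by move=> n; apply: emeasurable_sum.
  by move=> w _; apply: is_cvg_nneseries => n _ _; exact: cu0.
have gint : Q.-integrable setT g.
  apply/integrableP; split=> //.
  under eq_integral do rewrite gee0_abs//.
  apply: (@le_lt_trans _ _ M%:E); last exact: ltry.
  rewrite integral_nneseries//; apply: lime_le.
    by apply: is_cvg_nneseries => n _ _; apply: integral_ge0 => w _; exact: cu0.
  apply: nearW => n; apply: (@le_trans _ _ (\sum_(0 <= i < n) (eta i)%:E)%E).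
    by apply: lee_sum => i _; exact: ueta.
  by rewrite sumEFin lee_fin.
pose G := [set w | g w \is a fin_num].
have gfin : {ae Q, forall w, G w}.
  by have := integrable_ae measurableT gint; apply: filterS => w; exact.
have mG : measurable G.
  rewrite (_ : G = [set: O] `&` [set w | (g w < +oo)%E]).
    exact: emeasurable_fun_lt.
  by rewrite setTI; apply/seteqP; split=> w /=; rewrite /G/= ge0_fin_numE.
have lim_ex w : exists x, G w -> rho_converges rho (u ^~ w) x.
  have [Gw|nGw] := pselect (G w); last by exists point.
  have [_ comp _ _] := rhoP.
  have [|x ux] := comp (u ^~ w); last by exists x.
  apply: (@summable_rho_cauchy _ (fine (g w))) => n.
  rewrite -lee_fin fineK// -sumEFin.
  by apply: (@nneseries_lim_ge _ (fun i => cu i w) xpredT 0 n) => i *; exact: cu0.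
have /choice[v0 v0P] := lim_ex.
(* Sequence and limit are both made constant off G, so that convergence holds everywhere and gives
   measurability of v. *)
pose v w := if w \in G then v0 w else point.
pose u' n w := if w \in G then u n w else point.
have mbG : measurable_fun setT (fun w => w \in G).
  apply: (measurable_fun_bool true); rewrite setTI.
  rewrite (_ : _ @^-1` _ = G)//; apply/seteqP; split=> w /=.
    exact: set_mem.
  exact: mem_set.
have mu' n : measurable_fun setT (u' n) by exact: measurable_fun_ifT.
have u'v w : rho_converges rho (u' ^~ w) (v w).
  rewrite /u' /v; case: ifPn => [|_]; first by rewrite inE => /v0P.
  by move=> e e0; exists 0%N => n _; rewrite (rhoxx rhoP).
have mv : measurable_fun setT v by exact: measurable_rho_lim mu' u'v.
have [pi [_ piE]] := prob_law Q mv.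
exists pi => f fl.
have mf := measurable_Lip1 rhoP fl; have f01 := fl.1.
have f0 x : (0 <= (f x)%:E)%E by rewrite lee_fin; case/andP: (f01 x).
have mfE : measurable_fun setT (EFin \o f) by exact/measurable_EFinP.
apply: fine_cvg; rewrite RintegralE; last exact: (Lip1_integrable rhoP).
rewrite (piE _ mfE f0).
have cvg_ae : {ae Q, forall w, [set: O] w -> (f (u n w))%:E @[n --> \oo] --> (f (v w))%:E}.
  apply: filterS gfin => w Gw _; apply: cvg_EFin; first exact: nearW.
  by apply: Lip1_rho_lim => //; rewrite /v mem_set//; exact: v0P.
have bound_ae : {ae Q, forall w n, [set: O] w -> (`|(f (u n w))%:E| <= cst 1 w)%E}.
  apply: aeW => w n _ /=; have /andP[h0 h1] := f01 (u n w).
  by rewrite lee_fin ger0_norm.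
have [_ _] := @dominated_convergence _ _ _ Q setT measurableT
  (fun n w => (f (u n w))%:E) (fun w => (f (v w))%:E) (cst 1%E)
  (fun n => measurableT_comp mfE (mu n)) (measurableT_comp mfE mv) cvg_ae
  (finite_measure_integrable_cst Q 1 measurableT) bound_ae.
by [].
Qed.

End limit_law.

Section wasserstein_limit.
Context {R : realType} {d : measure_display} {E : measurableType d}.
Variable rho : E -> E -> R.
Hypothesis rhoP : polish rho.
Local Notation c := (tmetric rho).

(* A Skorokhod-type construction: the limit law is the law of an almost sure
   limit of step functions on [0, 1], each refining the previous one along a
   finite optimal transport plan. *)
Lemma wasserstein_complete (mu : nat -> probability E R) (a : nat -> R) (M : R) :
  (forall n f, Lip1 rho f -> `|\int[mu n]_x f x - \int[mu n.+1]_x f x| <= a n) ->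
  (forall n, \sum_(0 <= i < n) a i <= M) ->
  exists pi : probability E R, forall f, Lip1 rho f ->
    \int[mu n]_x f x @[n --> \oo] --> \int[pi]_x f x.
Proof.
move=> mua aM; have [s sP] := discretization rhoP.
pose e n : R := (1 / 2) ^+ n.
have e0 n : 0 < e n by rewrite exprn_gt0.
have /choice[Jk JkP] : forall n, exists Jk : (E -> nat) * nat,
    [/\ forall i, measurable (Jk.1 @^-1` [set i]), forall x, (Jk.1 x <= Jk.2)%N &
      (\int[mu n]_x (c x (s (Jk.1 x)))%:E <= (2 * e n)%:E)%E].
  move=> n; have [J [mJ Jle Jc]] := sP (e n) (e0 n).
  have [k hk] := Jc (mu n); exists (J k, k); split=> //=.
  exact: hk.
pose kk n := (Jk n).2; pose JJ n := (Jk n).1.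
have mJJ n i : measurable (JJ n @^-1` [set i]) by have [] := JkP n.
have JJle n x : (JJ n x <= kk n)%N by have [_ h _] := JkP n; exact: h.
have JJc n : (\int[mu n]_x (c x (s (JJ n x)))%:E <= (2 * e n)%:E)%E by have [] := JkP n.
pose p n i := fine (mu n (JJ n @^-1` [set i])).
have p0 n i : 0 <= p n i by exact: fine_ge0.
have inord_fiber d' (T : measurableType d') (S : T -> nat) n (i : 'I_n.+1) :
    (forall w, (S w <= n)%N) -> (fun w => inord (S w) : 'I_n.+1) @^-1` [set i] =
    S @^-1` [set (i : nat)].
  move=> Sn; apply/seteqP; split=> w /=; first by move=> <-; rewrite inordK// ltnS.
  by move=> Sw; apply: val_inj; rewrite /= inordK// ltnS.
have mJo n (i : 'I_(kk n).+1) :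
    measurable ((fun x => inord (JJ n x) : 'I_(kk n).+1) @^-1` [set i]).
  by rewrite inord_fiber.
have p1 n : \sum_(i < (kk n).+1) p n i = 1.
  by rewrite -(sum_index (mJo n) (mu n)); apply: eq_bigr => i _; rewrite inord_fiber.
have sumE n f : Lip1 rho f ->
    \sum_(i < (kk n).+1) f (s i) * p n i = \int[mu n]_x f (s (JJ n x)).
  move=> [f01 _].
  have fs0 (i : 'I_(kk n).+1) : 0 <= f (s i) by case/andP: (f01 (s i)).
  have := integral_index (mJo n) (mu n) fs0.
  under eq_integral do rewrite inordK ?ltnS ?JJle//.
  rewrite /Rintegral => ->/=; apply: eq_bigr => i _; by rewrite inord_fiber.
have msJ n : measurable_fun setT (fun x => s (JJ n x)).
  have := measurable_index (mJo n) (fun i : 'I_(kk n).+1 => s i).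
  by apply: eq_measurable_fun => x _ /=; rewrite inordK// ltnS.
have disc n f : Lip1 rho f ->
    `|\int[mu n]_x f x - \sum_(i < (kk n).+1) f (s i) * p n i| <= 2 * e n.
  move=> fl; rewrite sumE//.
  apply: (le_Rintegral_dist (h := fun x => c x (s (JJ n x)))) => //.
  - exact: (Lip1_integrable rhoP).
  - apply: prob_integrable01 => [|x]; last exact: fl.1.
    by apply: measurableT_comp => //; exact: (measurable_Lip1 rhoP).
  - exact: (measurableT_comp (measurable_tmetric rhoP)
      (measurable_fun_pair (@measurable_id _ _ _) (msJ n))).
  - by move=> x; exact: fl.2.
have eS n : e n.+1 = 1 / 2 * e n by rewrite /e exprS.
(* The two discretisation errors are 2 e n and 2 e n.+1 = e n; as the e n sum to at most 2, the
   total stays below M + 8. *)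
pose eta n := a n + 4 * e n.
have /choice[lam lamP] : forall n, exists lam : nat -> nat -> R,
    [/\ forall i j, 0 <= lam i j,
        forall i, (i <= kk n)%N -> \sum_(j < (kk n.+1).+1) lam i j = p n i,
        forall j, (j <= kk n.+1)%N -> \sum_(i < (kk n).+1) lam i j = p n.+1 j &
        \sum_(i < (kk n).+1) \sum_(j < (kk n.+1).+1) c (s i) (s j) * lam i j <= eta n].
  move=> n.
  have hf f : Lip1 rho f -> \sum_(i < (kk n).+1) f (s i) * p n i -
      \sum_(j < (kk n.+1).+1) f (s j) * p n.+1 j <= eta n.
    move=> fl; have := disc n f fl; have := disc n.+1 f fl; have := mua n f fl.
    by rewrite !ler_norml eS /eta; have := e0 n; lra.
  have [l [l0 lrow lcol lM]] := finite_kantorovich rhoP (fun i : 'I_(kk n).+1 => p0 n i)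
    (fun j : 'I_(kk n.+1).+1 => p0 n.+1 j) (p1 n) (p1 n.+1) hf.
  (* Plans are indexed by nat because the number of cells depends on n; values outside the range are
     irrelevant. *)
  exists (fun i j => l (inord i) (inord j)); split.
  - by move=> i j; exact: l0.
  - move=> i ik; under eq_bigr do rewrite inord_val.
    by rewrite lrow inordK.
  - move=> j jk; under eq_bigr do rewrite inord_val.
    by rewrite lcol inordK.
  - by under eq_bigr do under eq_bigr do rewrite !inord_val.
pose U := unif R.
pose Good n (S : measurableTypeR R -> nat) :=
  [/\ forall i, measurable (S @^-1` [set i]), forall w, (S w <= kk n)%N &
      forall i, (i <= kk n)%N -> U (S @^-1` [set i]) = (p n i)%:E].
pose Rel n (S S' : measurableTypeR R -> nat) :=
  forall i j, (i <= kk n)%N -> (j <= kk n.+1)%N ->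
    U (S @^-1` [set i] `&` S' @^-1` [set j]) = (lam n i j)%:E.
have [S SP] : exists S : nat -> measurableTypeR R -> nat,
    forall n, Good n (S n) /\ Rel n (S n) (S n.+1).
  apply: dependent_choice_nat.
    have UT : U setT = (\sum_(j < (kk 0%N).+1) p 0%N j)%:E.
      by rewrite p1; exact: probability_setT.
    have [g [gk gE]] := unif_partition measurableT (p0 0%N) UT.
    exists g; split=> // [i|i ik]; last by have := (gE i ik).2; rewrite setTI.
    have [ik|ik] := leqP i (kk 0%N); first by have := (gE i ik).1; rewrite setTI.
    rewrite (_ : _ @^-1` _ = set0)// -subset0 => w /= gw.
    by have := gk w; rewrite gw leqNgt ik.
  move=> n S0 [mS Sk SE]; have [l0 lrow lcol _] := lamP n.
  have [|S' [mS' S'k S'E]] := unif_refine (m := kk n.+1) mS Sk l0.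
    by move=> i ik; rewrite lrow// SE.
  exists S'; split=> //; split=> // j jk.
  have mSo (i : 'I_(kk n).+1) :
      measurable ((fun x => inord (S0 x) : 'I_(kk n).+1) @^-1` [set i]).
    by rewrite inord_fiber.
  rewrite -(sum_index_setI mSo U (mS' j)) -lcol// -sumEFin; apply: eq_bigr => i _.
  by rewrite setIC inord_fiber// S'E// -ltnS.
have mS n i : measurable (S n @^-1` [set i]) by have [[h _ _] _] := SP n; exact: h.
have Sk n w : (S n w <= kk n)%N by have [[_ h _] _] := SP n; exact: h.
have SE n i : (i <= kk n)%N -> U (S n @^-1` [set i]) = (p n i)%:E.
  by have [[_ _ h] _] := SP n; exact: h.
have mSo n (i : 'I_(kk n).+1) :
    measurable ((fun x => inord (S n x) : 'I_(kk n).+1) @^-1` [set i]).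
  by rewrite inord_fiber.
pose u n w := s (S n w).
have mu_n n : measurable_fun setT (u n).
  have := measurable_index (mSo n) (fun i : 'I_(kk n).+1 => s i).
  by apply: eq_measurable_fun => w _ /=; rewrite inordK// ltnS.
have ucost n : (\int[U]_w (c (u n w) (u n.+1 w))%:E <= (eta n)%:E)%E.
  pose Z w : 'I_(kk n).+1 * 'I_(kk n.+1).+1 := (inord (S n w), inord (S n.+1 w)).
  have ZE ij : Z @^-1` [set ij] =
      S n @^-1` [set (ij.1 : nat)] `&` S n.+1 @^-1` [set (ij.2 : nat)].
    rewrite -!inord_fiber//; case: ij => i j; apply/seteqP; split=> w /=.
      by rewrite /Z => -[-> ->].
    by case=> <- <-.
  have mZ ij : measurable (Z @^-1` [set ij]) by rewrite ZE; exact: measurableI.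
  have c0 (ij : 'I_(kk n).+1 * 'I_(kk n.+1).+1) : 0 <= c (s ij.1) (s ij.2).
    exact: tmetric_ge0.
  have := integral_index mZ U c0.
  under eq_integral do rewrite /Z/= !inordK ?ltnS ?Sk//.
  move=> ->; rewrite lee_fin; have [_ _ _] := lamP n; apply: le_trans.
  rewrite (pair_bigA _ (fun (i : 'I_(kk n).+1) (j : 'I_(kk n.+1).+1) =>
    c (s i) (s j) * lam n i j))/=.
  apply: ler_sum => -[i j] _ /=; rewrite ZE/=.
  have i_le : (i <= kk n)%N by rewrite -ltnS.
  have j_le : (j <= kk n.+1)%N by rewrite -ltnS.
  by rewrite ((SP n).2 _ _ i_le j_le).
have [|pi piP] := limit_random_variable rhoP mu_n ucost (M := M + 8).
  move=> n; rewrite /eta big_split/=; apply: lerD; first exact: aM.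
  rewrite -mulr_sumr.
  suff -> : \sum_(0 <= i < n) e i = 2 - 2 * e n by have := e0 n; lra.
  elim: n => [|n IH]; first by rewrite big_geq// /e expr0; lra.
  by rewrite big_nat_recr//= IH eS; lra.
exists pi => f fl; have := piP f fl.
have uE n : \int[U]_w f (u n w) = \sum_(i < (kk n).+1) f (s i) * p n i.
  have fs0 (i : 'I_(kk n).+1) : 0 <= f (s i) by case/andP: (fl.1 (s i)).
  have := integral_index (mSo n) U fs0.
  under eq_integral do rewrite inordK ?ltnS ?Sk//.
  rewrite /Rintegral /u => ->/=; apply: eq_bigr => i _.
  by rewrite inord_fiber// SE// -ltnS.
under eq_fun do rewrite uE.
(* The limit is known along the discretised laws, which differ from mu n by at most 2 e n on f. *)
move=> h; have : (\sum_(i < (kk n).+1) f (s i) * p n i) +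
    (\int[mu n]_x f x - \sum_(i < (kk n).+1) f (s i) * p n i) @[n --> \oo] -->
    \int[pi]_x f x + 0.
  apply: cvgD => //; apply/cvgrPdist_le => e' e'0.
  have e2 : 0 < e' / 2 by rewrite divr_gt0.
  have /cvgrPdist_le/(_ _ e2) : e n @[n --> \oo] --> 0.
    by apply: cvg_expr; rewrite ger0_norm; lra.
  apply: filterS => n; rewrite sub0r normrN gtr0_norm// => hn.
  rewrite sub0r normrN; apply: (le_trans (disc n f fl)); lra.
by rewrite addr0; under eq_fun do rewrite subrKC.
Qed.

End wasserstein_limit.

(** * Ergodicity *)

Section weak_limit.
Context {R : realType} {d : measure_display} {E : measurableType d}.
Variable rho : E -> E -> R.
Hypothesis rhoP : polish rho.
Variables (mu : nat -> probability E R) (pi : probability E R).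
Hypothesis mu_pi : forall f, Lip1 rho f ->
  \int[mu n]_x f x @[n --> \oo] --> \int[pi]_x f x.

(** The portmanteau inequality: multiples of [Lip1] functions below g pass to the limit in n, then
    increase to g. *)
Lemma lsc_integral_le_lim (g : E -> R) (l : R) : (forall x, 0 <= g x <= 1) ->
  lsc rho g -> \int[mu n]_x g x @[n --> \oo] --> l -> \int[pi]_x g x <= l.
Proof.
move=> g01 gl gc; have [G [GL G0g Gn Gc]] := Lip1_approx rhoP g01 gl.
have mg := measurable_lsc rhoP gl.
have G01 k x : 0 <= G k x <= 1.
  have /andP[G0 Gg] := G0g k x; rewrite G0/= (le_trans Gg)//.
  by case/andP: (g01 x).
have kG k x : G k x = k.+1%:R * (k.+1%:R^-1 * G k x).
  by rewrite mulrA divff ?mul1r// pnatr_eq0.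
have mG k : measurable_fun setT (G k).
  rewrite (_ : G k = fun x => k.+1%:R * (k.+1%:R^-1 * G k x)).
    by apply: measurable_funM => //; exact: (measurable_Lip1 rhoP (GL k)).
  by apply/funext => x; exact: kG.
have Gint k (Q : probability E R) : \int[Q]_x G k x =
    k.+1%:R * \int[Q]_x (k.+1%:R^-1 * G k x).
  rewrite -RintegralZl//; last exact: (Lip1_integrable rhoP).
  by apply: eq_Rintegral => x _; exact: kG.
have Gk k : \int[pi]_x G k x <= l.
  have c1 : \int[mu n]_x G k x @[n --> \oo] --> \int[pi]_x G k x.
    rewrite Gint; under eq_fun do rewrite Gint.
    by apply: cvgM; [exact: cvg_cst|exact: mu_pi].
  apply: (ler_cvg_to c1 gc); apply: nearW => n.
  apply: le_Rintegral => //; [exact: prob_integrable01|exact: prob_integrable01|].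
  by move=> x _; case/andP: (G0g k x).
have c2 := Lip1_approx_integral rhoP (mu := pi) g01 gl GL G0g Gc.
apply: (ler_cvg_to c2 (cvg_cst l)); exact: nearW.
Qed.

(** The inequality for g and for 1 - g. It is meant for g = P_t f, of which the Feller property
    gives continuity and no Lipschitz bound. *)
Lemma continuous_integral_lim (g : E -> R) (l : R) : (forall x, 0 <= g x <= 1) ->
  rho_continuous rho g -> \int[mu n]_x g x @[n --> \oo] --> l -> \int[pi]_x g x = l.
Proof.
move=> g01 gcont gc; have mg := measurable_lsc rhoP (lsc_continuous gcont).
apply/eqP; rewrite eq_le; apply/andP; split.
  exact: (lsc_integral_le_lim g01 (lsc_continuous gcont)).
have h01 x : 0 <= 1 - g x <= 1 by have := g01 x; lra.
have hcont : rho_continuous rho (fun x => 1 - g x).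
  move=> x e e0; have [del del0 h] := gcont x e e0; exists del => // y /h.
  by rewrite -normrN; congr (`| _ | < _); ring.
have hint (Q : probability E R) : \int[Q]_x (1 - g x) = 1 - \int[Q]_x g x.
  rewrite RintegralB//; first by rewrite Rintegral_prob_cst.
  - by apply: prob_integrable01 => // x; rewrite lexx ler01.
  - exact: prob_integrable01.
have := @lsc_integral_le_lim _ (1 - l) h01 (lsc_continuous hcont).
rewrite hint lerD2l lerN2; apply; under eq_fun do rewrite hint.
by apply: cvgB => //; exact: cvg_cst.
Qed.

End weak_limit.

Lemma sum_geometric_le (R : realType) (al B : R) n : 0 < al < 1 -> 0 <= B ->
  \sum_(0 <= i < n) al ^+ i * B <= B / (1 - al).
Proof.
move=> /andP[a0 a1] B0; rewrite -mulr_suml mulrC ler_wpM2l//.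
have a1' : 0 < 1 - al by rewrite subr_gt0.
rewrite -[leRHS]mul1r ler_pdivlMr// mulrC big_mkord.
rewrite -[1 - al]opprB mulNr -subrX1 opprB gerBl exprn_ge0//.
exact: ltW.
Qed.

Section ergodicity.
Context {R : realType} {d : measure_display} {E : measurableType d}.
Variables (rho : E -> E -> R) (P : R -> E -> probability E R).
Variables (V : E -> R) (gamma K : R) (theta : E -> E -> R) (r L Rf : R -> R).
Variable eps : R.
Hypotheses (rhoP : polish rho) (markovP : markov_tf P).
Hypotheses (mV : measurable_fun setT V) (V0 : forall x, 0 <= V x).
Hypotheses (gamma0 : 0 < gamma) (K0 : 0 < K).
Hypothesis lyap : forall t x, 0 <= t ->
  (\int[P t x]_y (V y)%:E
   + gamma%:E * \int[lebesgue_measure]_(s in `[0%R, t]%classic) \int[P s x]_y (V y)%:E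
   <= (V x + K * t)%:E)%E.
Hypothesis premetric_theta : premetric rho theta.
Hypothesis rho_theta : forall x y, Num.min (rho x y) 1 <= theta x y.
Hypothesis asA : assumptionA P theta r L.
Hypothesis asB : assumptionB2 P theta [set x | V x <= 4 * K / gamma] Rf eps.
Implicit Types (f : E -> R) (x y : E) (s t u : R).

Local Notation C := (drift_const gamma K).

Let C0 : 0 < C. Proof. exact: drift_const_gt0. Qed.

Let th0 x y : 0 <= theta x y. Proof. by case: premetric_theta. Qed.

Let tcost01 N x y : 0 <= N -> 0 <= tcost theta N x y <= 1.
Proof. by move=> N0; rewrite /tcost le_min ge_min lexx orbT mulr_ge0//= ler01. Qed.

Lemma Lip1_wlip (N b delta : R) f : 1 <= N -> 0 <= b -> 0 < delta < 1 ->
  Lip1 rho f -> wlip V (tcost theta N) b delta 1 f.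
Proof.
move=> N1 b0 /andP[d0 d1] fL; have N0 : 0 <= N by exact: le_trans ler01 N1.
split; [exact: (measurable_Lip1 rhoP)|exact: fL.1|move=> x y].
apply: (le_trans (fL.2 x y)); rewrite mul1r /wcost.
have /andP[c0 c1] := tcost01 x y N0.
apply: (@le_trans _ _ (tcost theta N x y)).
  rewrite /tcost le_min tmetric_le1 andbT (le_trans (rho_theta x y))//.
  by rewrite ler_peMl.
apply: (@le_trans _ _ (tcost theta N x y `^ (1 - delta))).
  move: c0; rewrite le_eqVlt => /orP[/eqP <-|c0]; first exact: powR_ge0.
  by apply: ger1_powR; rewrite ?c0//= gerBl ltW.
rewrite ler_peMr ?powR_ge0//.
have {1}-> : 1 = 1 `^ delta :> R by rewrite powR1.
by apply: le_powR; [exact: ltW|exact: ler01|rewrite lerDl mulr_ge0// addr_ge0].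
Qed.

(** P_(nT) f is al^n-Lipschitz for W; a further time s or u costs only the drift bound, which is
    uniform in time. Independent offsets s and u allow different times to be compared. *)
Lemma semigroup_rate delta : 0 < delta < 1 ->
  exists T b al : R, [/\ 0 < T, 0 < b, 0 < al < 1 &
  forall f n s u x y, Lip1 rho f -> 0 <= s -> 0 <= u ->
    `|Psg P (s + n%:R * T) f x - Psg P (u + n%:R * T) f y| <=
    al ^+ n * (1 + b * ((V x + C) + (V y + C))) `^ delta].
Proof.
move=> d01; have [T [N [b [al [T0 N1 b0 al01 contr]]]]] :=
  Psg_contraction rhoP markovP mV V0 gamma0 K0 lyap premetric_theta asA asB d01.
have N0 : 0 <= N by exact: le_trans ler01 N1.
have al0 : 0 <= al by case/andP: al01 => /ltW.
exists T, b, al; split=> // f n s u x y fL s0 u0.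
have mf := measurable_Lip1 rhoP fL; have f01 := fL.1.
have nT0 k : 0 <= k%:R * T by rewrite mulr_ge0// ltW.
have lipn : wlip V (tcost theta N) b delta (al ^+ n) (Psg P (n%:R * T) f).
  elim: n => [|n IH].
    by rewrite mul0r Psg0//; exact: (Lip1_wlip N1 (ltW b0)).
  have -> : Psg P (n.+1%:R * T) f = Psg P T (Psg P (n%:R * T) f).
    apply/funext => z; rewrite -PsgD//; last exact: ltW.
    by rewrite -natr1 mulrDl mul1r addrC.
  by rewrite exprS; apply: contr => //; rewrite exprn_ge0.
rewrite !PsgD//.
have mth : measurable_fun setT (fun z : E * E => theta z.1 z.2).
  by apply: (measurable_lsc2 rhoP); case: premetric_theta.
have mc : measurable_fun setT (fun z : E * E => tcost theta N z.1 z.2).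
  by apply: measurable_minr => //; exact: measurable_funM.
exact: (wlip_product mV V0 mc (fun x y => tcost01 x y N0) (ltW b0) d01
  (lyapunov_bound markovP mV V0 gamma0 K0 lyap x s0)
  (lyapunov_bound markovP mV V0 gamma0 K0 lyap y u0) (exprn_ge0 n al0) lipn).
Qed.

(** The law pi must not depend on delta, whereas T, b and al do. So pi is built once, with delta =
    1/2, and the rate for any other delta is obtained by comparison with the sequence that defines
    pi. *)
Lemma limit_measure : exists pi : probability E R, forall delta, 0 < delta < 1 ->
  exists T b al D : R, [/\ 0 < T, 0 < b, 0 < al < 1, 0 <= D &
  forall f n s x, Lip1 rho f -> 0 <= s ->
    `|Psg P (s + n%:R * T) f x - \int[pi]_y f y| <=
    al ^+ n * (1 + b * (V x + D)) `^ delta].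
Proof.
have [x0 _] : exists x0 : E, True.
  by case: rhoP => _ _ [s _] _; exists (s 0%N).
have h01 : 0 < (2^-1 : R) < 1 by rewrite invr_gt0 ltr0n/= invf_lt1// ltr1n.
have [T [b [al [T0 b0 al01 rate]]]] := semigroup_rate h01.
have /andP[al0 al1] := al01.
set B := (1 + b * ((V x0 + C) + (V x0 + C))) `^ 2^-1 in rate.
have mu_cauchy n f : Lip1 rho f ->
    `|\int[P (n%:R * T) x0]_x f x - \int[P (n.+1%:R * T) x0]_x f x| <= al ^+ n * B.
  move=> fL; have := rate f n 0 T x0 x0 fL (lexx _) (ltW T0).
  by rewrite add0r -[n.+1]addn1 natrD mulrDl mul1r [T + _]addrC.
have [pi hpi] := wasserstein_complete rhoP mu_cauchy
  (fun n => sum_geometric_le n al01 (powR_ge0 _ _)).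
exists pi => delta d01.
have [T' [b' [al' [T0' b0' al01' rate']]]] := semigroup_rate d01.
exists T', b', al', (C + (V x0 + C)); split=> //.
  by rewrite !addr_ge0// ltW.
move=> f n s x fL s0; apply/ler_addgt0Pr => e e0.
have /cvgrPdist_le/(_ e e0)[m0 _ hm] := hpi f fL.
(* Beyond m0 the defining sequence is within e of pi on f; the second bound gives m T >= n T', so
   the difference can serve as the offset u. *)
pose m := maxn m0 (Num.truncn (n%:R * T' / T)).+1.
have mm0 : (m0 <= m)%N by exact: leq_maxl.
have mT : n%:R * T' <= m%:R * T.
  rewrite -ler_pdivrMr//; apply: le_trans (ltW (truncnS_gt _)) _.
  by rewrite ler_nat leq_maxr.
have u0 : 0 <= m%:R * T - n%:R * T' by rewrite subr_ge0.
have h1 := rate' f n s _ x x0 fL s0 u0.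
rewrite subrK addrA in h1.
have h2 := hm m mm0; rewrite distrC in h2.
rewrite !addrA in h1 *.
apply: le_trans (ler_distD (Psg P (m%:R * T) f x0) _ _) _.
exact: lerD.
Qed.

End ergodicity.

Lemma integral_Psg (R : realType) (d : measure_display) (E : measurableType d)
    (P : R -> E -> probability E R) t (mu nu : probability E R) (f : E -> R) :
  markov_tf P -> 0 <= t -> measurable_fun setT f -> (forall x, 0 <= f x <= 1) ->
  (forall A, measurable A -> (\int[mu]_x P t x A = nu A)%E) ->
  (\int[mu]_x (Psg P t f x)%:E = \int[nu]_x (f x)%:E)%E.
Proof.
move=> markovP t0 mf f01 muP.
have f0 x : (0 <= (f x)%:E)%E by rewrite lee_fin; case/andP: (f01 x).
have mfE : measurable_fun setT (EFin \o f) by exact/measurable_EFinP.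
rewrite -(markov_invariant_integral markovP t0 muP mfE f0).
by apply: eq_integral => x _; exact: PsgE.
Qed.

(** * Invariance and uniqueness of the limit law *)

Section invariance.
Context {R : realType} {d : measure_display} {E : measurableType d}.
Variables (rho : E -> E -> R) (P : R -> E -> probability E R).
Variables (pi : probability E R) (T : R).
Hypotheses (rhoP : polish rho) (markovP : markov_tf P) (fellerP : feller rho P).
Hypothesis T0 : 0 <= T.
Hypothesis Psg_pi : forall f s x, Lip1 rho f -> 0 <= s ->
  Psg P (s + n%:R * T) f x @[n --> \oo] --> \int[pi]_y f y.

(** Along the laws P_(nT)(x0, .) the integrals of P_t f are P_(t + nT) f x0 and tend to that of f
    under pi. As P_t f is continuous, this limit is also its integral under pi. *)
Lemma limit_invariant : is_invariant P pi.
Proof.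
have [x0 _] : exists x0 : E, True.
  by case: rhoP => _ _ [s _] _; exists (s 0%N).
move=> t A t0 mA.
have mP := markov_giry markovP t0.
have [mu muE] : exists mu : probability E R, forall A, measurable A ->
    (\int[pi]_x P t x A = mu A)%E.
  have bT : giry_bind pi mP setT = 1%E.
    rewrite giry_bindE//; transitivity (\int[pi]_x (cst 1%E x : \bar R))%E.
      by apply: eq_integral => x _; exact: probability_setT.
    by rewrite integral_cst// mul1e; exact: probability_setT.
  have [mu muE] := prob_of_measure bT.
  by exists mu => B mB; rewrite muE; exact/esym/giry_bindE.
rewrite muE//; apply/esym; move: A mA; apply: (prob_eq_Lip1 rhoP) => f fL.
have mf := measurable_Lip1 rhoP fL; have f01 := fL.1.
have -> : \int[mu]_x f x = \int[pi]_x Psg P t f x.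
  by rewrite /Rintegral (integral_Psg markovP t0 mf f01 muE).
have nT0 n : 0 <= n%:R * T by rewrite mulr_ge0.
have [mPf Pf01] := Psg01 markovP t0 mf f01.
have Pcont : rho_continuous rho (Psg P t f).
  suff h : Defs.bounded_fun f by case: (fellerP t0 h (Lip1_continuous rhoP fL)).
  by exists 1 => x; have /andP[f0 f1] := f01 x; rewrite ger0_norm.
apply/esym/(continuous_integral_lim rhoP (mu := fun n => P (n%:R * T) x0)) => //.
  move=> h hL; have := Psg_pi x0 hL (lexx 0).
  by under eq_fun do rewrite add0r.
have := Psg_pi x0 fL t0; apply: cvg_trans; apply: near_eq_cvg; apply: nearW => n.
by rewrite addrC PsgD.
Qed.

(** The integral of P_(nT) f under an invariant mu is constant in n and tends, by domination, to the
    integral of f under pi. *)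
Lemma limit_unique (mu : probability E R) : is_invariant P mu ->
  forall A, measurable A -> mu A = pi A.
Proof.
move=> mu_inv; apply: (prob_eq_Lip1 rhoP) => f fL.
have mf := measurable_Lip1 rhoP fL; have f01 := fL.1.
have nT0 n : 0 <= n%:R * T by rewrite mulr_ge0.
have Pf n := Psg01 markovP (nT0 n) mf f01.
have c : (\int[mu]_x (Psg P (n%:R * T) f x)%:E @[n --> \oo] -->
    \int[mu]_x (\int[pi]_y f y)%:E)%E.
  apply: (@dominated_cvg _ _ _ mu setT measurableT _ _ (cst 1%E)).
  - by move=> n; apply/measurable_EFinP; exact: (Pf n).1.
  - move=> x _; apply: cvg_EFin; first by exact: nearW.
    have := Psg_pi x fL (lexx 0).
    by under eq_fun do rewrite add0r.
  - by [].
  - by apply: (@prob_integrable01 _ _ _ mu (cst 1)) => // x; rewrite lexx ler01.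
  - by move=> n x _; have /andP[P0 P1] := (Pf n).2 x; rewrite /= lee_fin ger0_norm.
have E1 n : (\int[mu]_x (Psg P (n%:R * T) f x)%:E = \int[mu]_x (f x)%:E)%E.
  by apply: integral_Psg => // A mA; exact: mu_inv.
have c' : (\int[mu]_x (f x)%:E @[_ --> \oo] --> \int[mu]_x (\int[pi]_y f y)%:E)%E.
  by move: c; under eq_fun do rewrite E1.
rewrite -[RHS](Rintegral_prob_cst mu); congr fine.
by apply: (cvg_unique _ _ c') => //; exact: cvg_cst.
Qed.

End invariance.

(** * Explicit rate for linear phi *)

Section linear_rate.
Context {R : realType}.
Implicit Types gamma z y : R.

Lemma H_phi_linear gamma z : 0 < gamma -> 1 <= z ->
  H_phi (fun u => gamma * u) z = ln z / gamma.
Proof.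
move=> g0; rewrite le_eqVlt => /orP[/eqP <-|z1].
  by rewrite /H_phi set_itv1 integral_set1 ln1 mul0r.
have dF (x : R) : 0 < x -> is_derive x 1 (fun u : R => ln u / gamma) (1 / (gamma * x)).
  move=> x0; have h := is_derive1_ln x0.
  apply: is_derive_eq; rewrite scaler0 add0r.
  by rewrite -[_ *: _]/(_ * _) div1r invfM.
have cF (x : R) : 0 < x -> {for x, continuous (fun u : R => ln u / gamma)}.
  by move=> x0; apply: cvgM; [exact: continuous_ln|exact: cvg_cst].
rewrite /H_phi (@continuous_FTC2 _ _ (fun u => ln u / gamma))//.
- by rewrite ln1 mul0r -EFinB subr0.
- apply: continuous_in_subspaceT => x; rewrite inE/= in_itv/= => /andP[x1 _].
  have x0 : 0 < x by exact: lt_le_trans x1.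
  under eq_fun do rewrite div1r.
  apply: cvgV; first by rewrite mulf_neq0// gt_eqF.
  by apply: cvgM; [exact: cvg_cst|exact: cvg_id].
- split.
  + move=> x; rewrite in_itv/= => /andP[x1 _].
    have x0 : 0 < x by exact: lt_trans x1.
    by have [] := dF x x0.
  + by apply: cvg_at_right_filter; exact: cF.
  + by apply: cvg_at_left_filter; apply: cF; exact: lt_trans z1.
- move=> x; rewrite in_itv/= => /andP[x1 _].
  have x0 : 0 < x by exact: lt_trans x1.
  by rewrite derive1E; have [_ ->] := dF x x0.
Qed.

(** The rate has z in the denominator, so an upper bound and positivity are all it asks of z. The
    default value 1 of [xget] satisfies both, which avoids proving that a preimage exists. *)
Lemma H_phi_inv_linear gamma y : 0 < gamma -> 0 <= y ->
  1 <= H_phi_inv (fun u => gamma * u) y <= expR (gamma * y).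
Proof.
move=> g0 y0; rewrite /H_phi_inv; case: xgetP => [z _ [z1 <-]|_].
  have z0 : 0 < z by exact: lt_le_trans z1.
  by rewrite H_phi_linear// mulrC divfK ?gt_eqF// lnK ?posrE// z1 lexx.
by rewrite lexx/= -expR0 ler_expR mulr_ge0// ltW.
Qed.

End linear_rate.

(** A + b v is at most twice the larger of A and b v, and each alternative gives one summand of
    C. *)
Lemma powR_affine_le (R : realType) (b gamma D delta : R) : 0 < b -> 0 < gamma ->
  0 <= D -> 0 < delta -> exists2 C : R, 0 < C & forall v, 0 <= v ->
    (1 + b * (v + D)) `^ delta <= C * (1 + (gamma * v) `^ delta).
Proof.
move=> b0 g0 D0 d0; set A := 1 + b * D.
have A0 : 0 < A by rewrite ltr_wpDr// mulr_ge0// ltW.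
exists ((2 * A) `^ delta + (2 * b / gamma) `^ delta).
  by rewrite ltr_wpDr ?powR_ge0// powR_gt0// mulr_gt0.
move=> v v0; have bv0 : 0 <= b * v by rewrite mulr_ge0// ltW.
have -> : 1 + b * (v + D) = A + b * v by rewrite /A; ring.
have Av0 : 0 <= A + b * v by rewrite addr_ge0// ltW.
have P1 := powR_ge0 (2 * A) delta.
have P2 := powR_ge0 (2 * b / gamma) delta.
have P3 := powR_ge0 (gamma * v) delta.
have [vA|vA] := leP (b * v) A.
  apply: (@le_trans _ _ ((2 * A) `^ delta)); first by apply: le_powR; [exact: ltW| |lra].
  have := mulr_ge0 P1 P3; have := mulr_ge0 P2 P3; lra.
apply: (@le_trans _ _ ((2 * b / gamma) `^ delta * (gamma * v) `^ delta)).
  rewrite -powRM; last 2 first.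
  - by rewrite divr_ge0 ?mulr_ge0// ltW.
  - by rewrite mulr_ge0// ltW.
  apply: le_powR; [exact: ltW| |] => //.
  have -> : 2 * b / gamma * (gamma * v) = 2 * (b * v) by field; rewrite gt_eqF.
  lra.
have := mulr_ge0 P1 P3; lra.
Qed.

(** The integer part plus 1 exceeds t / T; this rounding is the factor al^-1. *)
Lemma geometric_le_expR (R : realType) (al T t : R) : 0 < al < 1 -> 0 < T -> 0 <= t ->
  al ^+ Num.truncn (t / T) <= al^-1 * expR (ln al / T * t).
Proof.
move=> /andP[a0 a1] T0 t0; set n := Num.truncn _.
rewrite ler_pdivlMl// -exprS -[al in leLHS](lnK (x := al)) ?posrE//.
rewrite -expRM_natl ler_expR.
have -> : ln al / T * t = t / T * ln al by ring.
have la : ln al < 0 by exact: ln_lt0 (introT andP (conj a0 a1)).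
by rewrite ler_wnM2r ?(ltW la)// ltW// truncnS_gt.
Qed.

Theorem theorem2p8 (R : realType) (d : measure_display) (E : measurableType d)
  (rho : E -> E -> R) (P : R -> E -> probability E R)
  (V : E -> R) (gamma K : R) (theta : E -> E -> R) (r L Rf : R -> R) (eps : R) :
  polish rho ->
  markov_tf P ->
  feller rho P ->
  (* (1) Lyapunov condition *)
  measurable_fun [set: E] V -> (forall x, 0 <= V x) -> 0 < gamma -> 0 < K ->
  (forall t x, 0 <= t ->
     (\int[P t x]_y (V y)%:E
      + gamma%:E * \int[lebesgue_measure]_(s in `[0%R, t]%classic) \int[P s x]_y (V y)%:E
      <= (V x + K * t)%:E)%E) ->
  (* (2) *)
  premetric rho theta ->
  (forall x y, Num.min (rho x y) 1 <= theta x y) ->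
  (* (3) *)
  assumptionA P theta r L ->
  (* (4* ) *)
  assumptionB2 P theta [set x | V x <= 4 * K / gamma] Rf eps ->
  exists pi : probability E R,
    [/\ is_invariant P pi,
        (forall pi' : probability E R, is_invariant P pi' ->
           forall A, measurable A -> pi' A = pi A) &
        forall delta : R, 0 < delta < 1 ->
          let phi := fun u : R => gamma * u in
          exists C1 C2 : R, [/\ 0 < C1, 0 < C2 &
            forall x t, 0 <= t ->
              (wasserstein (fun a b => Num.min (rho a b) 1%R) (P t x) pi
               <= (C1 * (1 + phi (V x) `^ delta)
                   / (phi (H_phi_inv phi (C2 * t))) `^ delta)%R%:E)%E]].
Proof.
move=> rhoP markovP fellerP mV V0 gamma0 K0 lyap premetric_theta rho_theta asA asB.
have [pi hpi] := limit_measure rhoP markovP mV V0 gamma0 K0 lyap premetric_theta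
  rho_theta asA asB.
have [T0 [T0_gt0 Psg_pi]] : exists T0 : R, 0 < T0 /\ forall f s x, Lip1 rho f ->
    0 <= s -> Psg P (s + n%:R * T0) f x @[n --> \oo] --> \int[pi]_y f y.
  have h01 : 0 < (2^-1 : R) < 1 by rewrite invr_gt0 ltr0n/= invf_lt1// ltr1n.
  have [T [b [al [D [T0 b0 /andP[al0 al1] D0 rate]]]]] := hpi _ h01.
  exists T; split=> // f s x fL s0; apply/cvgrPdist_le => e e0.
  have : al ^+ n * (1 + b * (V x + D)) `^ 2^-1 @[n --> \oo] --> 0.
    rewrite -[X in _ --> X](mul0r ((1 + b * (V x + D)) `^ 2^-1)).
    by apply: cvgM; [apply: cvg_expr; rewrite gtr0_norm|exact: cvg_cst].
  move=> /cvgrPdist_le/(_ e e0); apply: filterS => n.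
  rewrite sub0r normrN ger0_norm; last by rewrite mulr_ge0 ?powR_ge0// exprn_ge0// ltW.
  by apply: le_trans; rewrite distrC; exact: rate.
exists pi; split.
- exact: (limit_invariant rhoP markovP fellerP (ltW T0_gt0) Psg_pi).
- exact: (limit_unique rhoP markovP (ltW T0_gt0) Psg_pi).
move=> delta d01 phi; have /andP[d0 d1] := d01.
have [T [b [al [D [T_gt0 b0 al01 D0 rate]]]]] := hpi _ d01.
have /andP[al0 al1] := al01.
have [C C_gt0 hC] := powR_affine_le b0 gamma0 D0 d0.
have kap0 : 0 < - ln al / T by rewrite divr_gt0// oppr_gt0 ln_lt0.
have gd0 : 0 < gamma `^ delta by exact: powR_gt0.
(* C2 is such that exp (gamma C2 t)^delta cancels the decay exp (t ln al / T). In C1, al^-1 comes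
   from rounding t / T, gamma^delta from phi z = gamma z, and C from the weight. *)
exists (al^-1 * gamma `^ delta * C), (- ln al / T / (gamma * delta)); split.
- by rewrite mulr_gt0// mulr_gt0// invr_gt0.
- by rewrite divr_gt0// mulr_gt0.
move=> x t t0; apply: (kantorovich_rubinstein rhoP) => f fL.
pose n := Num.truncn (t / T).
have nT : 0 <= t - n%:R * T.
  by rewrite subr_ge0 -ler_pdivlMr// truncn_le// divr_ge0// ltW.
have := rate f n _ x fL nT; rewrite subrK => /le_trans; apply.
have C2t : 0 <= - ln al / T / (gamma * delta) * t.
  by rewrite mulr_ge0// ltW// divr_gt0// mulr_gt0.
have /andP[z1 zexp] := H_phi_inv_linear gamma0 C2t.
rewrite -/phi in z1 zexp; set z := H_phi_inv _ _ in z1 zexp *.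
have z0 : 0 < z by exact: lt_le_trans z1.
have pz0 : 0 < (phi z) `^ delta by rewrite powR_gt0// mulr_gt0.
rewrite ler_pdivlMr//.
have zd : (phi z) `^ delta <= gamma `^ delta * expR (- (ln al / T * t)).
  rewrite /phi powRM ?(ltW gamma0) ?(ltW z0)// ler_pM2l//.
  apply: (le_trans (le_powR (ltW d0) (ltW z0) zexp)).
  rewrite -expRM ler_expR le_eqVlt; apply/orP; left; apply/eqP; field.
  by rewrite !gt_eqF.
have e1 : expR (ln al / T * t) * expR (- (ln al / T * t)) = 1.
  by rewrite -expRD subrr expR0.
have W0 : 0 <= (1 + b * (V x + D)) `^ delta by exact: powR_ge0.
apply: (@le_trans _ _ (al^-1 * expR (ln al / T * t) *
    (C * (1 + (gamma * V x) `^ delta)) * (gamma `^ delta * expR (- (ln al / T * t))))).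
  apply: ler_pM => //; [|exact: ltW|].
    by rewrite mulr_ge0// exprn_ge0// ltW.
  apply: ler_pM => //; [by rewrite exprn_ge0// ltW|exact: geometric_le_expR|exact: hC].
rewrite le_eqVlt; apply/orP; left; apply/eqP; rewrite /phi.
transitivity (al^-1 * gamma `^ delta * C * (1 + (gamma * V x) `^ delta) *
  (expR (ln al / T * t) * expR (- (ln al / T * t)))); first by ring.
by rewrite e1 mulr1.
Qed.
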